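(* Let $d\geq 2$. Then: (i) $\mathrm{Sep}_d^{\vee_{\mathrm{fr}}}=\mathrm{Bpsd}_d$ and $\mathrm{Bpsd}_d^{\vee_{\mathrm{fr}}}=\mathrm{Sep}_d$. Both systems $\mathrm{Sep}_d$ and $\mathrm{Bpsd}_d$ are neither finitely generated nor finite-dimensional realizable. (ii) $\mathrm{Psd}_d^{\vee_{\mathrm{fr}}}=\mathrm{Psd}_d$ and $(\mathrm{Psd}_d^{\Gamma})^{\vee_{\mathrm{fr}}}=\mathrm{Psd}_d^{\Gamma}$, and both systems $\mathrm{Psd}_d$ and $\mathrm{Psd}_d^\Gamma$ are both finitely generated and finite-dimensional realizable. (iii) $\mathrm{Dpsd}_d^{\vee_{\mathrm{fr}}}=\mathrm{Decomp}_d$ and $\mathrm{Decomp}_d^{\vee_{\mathrm{fr}}}=\mathrm{Dpsd}_d$. Furthermore, the system $\mathrm{Dpsd}_d$ is finite-dimensional realizable, and the system $\mathrm{Decomp}_d$ is finitely generated.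
   Context: Here $\geqslant 0$ means (Hermitian) positive semidefinite, and $\mathrm{Her}_s(\mathbb{C})$ is the real space of Hermitian $s\times s$ matrices. Let $\mathcal{V}$ be a finite-dimensional $\mathbb{C}$-vector space with involution $*$ and real subspace $\mathcal{V}_h$ of Hermitian elements; $\mathrm{Mat}_s(\mathcal{V})=\mathcal{V}\otimes_{\mathbb{C}}\mathrm{Mat}_s(\mathbb{C})$ carries the involution $(v_{ij})^*_{i,j}=(v_{ji}^* )_{i,j}$. An abstract operator system $\mathcal{C}$ on $\mathcal{V}$ consists of a closed and salient (i.e. $\mathcal{C}_s\cap(-\mathcal{C}_s)=\{0\}$) convex cone $\mathcal{C}_s\subseteq \mathrm{Mat}_s(\mathcal{V})_h$ for each $s\geq 1$, and some $u\in\mathcal{C}_1$, such that (1) $A\in\mathcal{C}_s$, $V\in\mathrm{Mat}_{s,t}(\mathbb{C})$ imply $V^*AV\in\mathcal{C}_t$, and (2) $u\otimes I_s$ is an order unit (equivalently, an interior point) of $\mathcal{C}_s$ for all $s\ge 1$. $\mathcal{C}$ is finite-dimensional realizable if there are a finite-dimensional Hilbert space $\mathcal{H}$ and a $*$-linear map $\varphi:\mathcal{V}\to\mathbb{B}(\mathcal{H})$ with $\varphi(u)=\mathrm{id}_{\mathcal{H}}$ such that for all $s\geq 1$ and all $A\in\mathrm{Mat}_s(\mathcal{V})_h$: $A\in\mathcal{C}_s\Leftrightarrow(\varphi\otimes\mathrm{id})(A)\geqslant 0$. $\mathcal{C}$ is finitely generated if there are finitely many elements $A^{(1)},\ldots,A^{(n)}$,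 each belonging to some level $\mathcal{C}_s$, such that $\mathcal{C}$ is the smallest (with respect to level-wise inclusion) operator system on $\mathcal{V}$ containing all $A^{(j)}$. In the proposition, $\mathcal{V}=\mathrm{Mat}_d(\mathbb{C})$ with the usual conjugate-transpose involution, $u=I_d$, and $\mathrm{Mat}_s(\mathcal{V})=\mathrm{Mat}_d(\mathbb{C})\otimes\mathrm{Mat}_s(\mathbb{C})=\mathrm{Mat}_{ds}(\mathbb{C})$. The action is $V^*AV:=(I_d\otimes V)^*A(I_d\otimes V)$. The partial transpose is the linear map with $(A\otimes B)^\Gamma=A^T\otimes B$. For $s\geq 1$ define the following subsets of $\mathrm{Mat}_d(\mathbb{C})\otimes\mathrm{Mat}_s(\mathbb{C})$: - $\mathrm{Sep}_{d,s}=\{\sum_{i=1}^nA_i\otimes B_i\mid n\in\mathbb{N},\ A_i\geqslant 0,\ B_i\geqslant 0\}$; - $\mathrm{Bpsd}_{d,s}=\{X\mid (x\otimes y)^*X(x\otimes y)\geq 0\ \forall x\in\mathbb{C}^d,\ y\in\mathbb{C}^s\}$; - $\mathrm{Psd}_{d,s}=\{X \mid X\geqslant 0\}$; - $\mathrm{Psd}^\Gamma_{d,s}=\{X\mid X^\Gamma\geqslant 0\}$; - $\mathrm{Dpsd}_{d,s}=\mathrm{Psd}_{d,s}\cap\mathrm{Psd}^\Gamma_{d,s}$; - $\mathrm{Decomp}_{d,s}=\{X+Y\mid X\in\mathrm{Psd}_{d,s},\ Y\in\mathrm{Psd}^\Gamma_{d,s}\}$. The corresponding families indexed by $s\geq 1$,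 denoted $\mathrm{Sep}_d,\mathrm{Bpsd}_d,\mathrm{Psd}_d,\mathrm{Psd}_d^\Gamma,\mathrm{Dpsd}_d,\mathrm{Decomp}_d$, are abstract operator systems. Free dual: for an operator system $\mathcal{C}$ on $\mathrm{Mat}_d(\mathbb{C})$, the $s$-th level of $\mathcal{C}^{\vee_{\mathrm{fr}}}$ consists of all $A=\sum_{i,j=1}^dE_{ij}\otimes A_{ij}\in\mathrm{Her}_d(\mathbb{C})\otimes\mathrm{Her}_s(\mathbb{C})$ such that $\sum_{i,j=1}^d B_{ij}^T\otimes A_{ji}\geqslant 0$ for every $t\geq 1$ and every $B=\sum_{i,j=1}^dE_{ij}\otimes B_{ij}\in\mathcal{C}_t$; here $E_{ij}$ are the matrix units of $\mathrm{Mat}_d(\mathbb{C})$ and $B_{ij}^T$ is the transpose of the block $B_{ij}\in\mathrm{Mat}_t(\mathbb{C})$. (Equivalently, writing $A=\sum_kH_k\otimes A_k$, $B=\sum_kH_k\otimes B_k$ in a trace-orthonormal basis $(H_k)$ of $\mathrm{Her}_d(\mathbb{C})$, the condition is $\sum_kB_k^T\otimes A_k\geqslant 0$.) Equality of operator systems means level-wise equality. *)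

(* Defs.v *)
From HB Require Import structures.
From mathcomp Require Import all_boot all_order all_algebra.
From mathcomp Require Import all_classical all_reals all_analysis.
From mathcomp Require Import mxtens.
From mathcomp Require Export complex.

Set Implicit Arguments.
Unset Strict Implicit.
Unset Printing Implicit Defensive.

Import Order.TTheory GRing.Theory Num.Theory.
Import numFieldNormedType.Exports.

Local Open Scope classical_set_scope.
Local Open Scope ring_scope.
Local Open Scope sesquilinear_scope.

(* Mat_d(C) (x) Mat_s(C) is 'M[C]_(d * s), where A (x) B is the Kronecker
   product [A *t B]; its entry at (mxtens_index (i, k), mxtens_index (j, l))
   is A i j * B k l. *)

Section OperatorSystems.
Variable C : numClosedFieldType.

Definition qform n (A : 'M[C]_n) (x : 'cV[C]_n) : C := (x^t* *m A *m x) 0 0.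

(* For z : C, [0 <= z] means that z is real and nonnegative. *)
Definition psdmx n (A : 'M[C]_n) : Prop :=
  A \is hermsymmx /\ forall x : 'cV[C]_n, 0 <= qform A x.

Variable d : nat.

(* A level-indexed family; only the levels s >= 1 are meaningful, and every
   definition below ignores level 0. *)
Definition family := forall s : nat, set 'M[C]_(d * s).

Definition eq_family (F G : family) : Prop :=
  forall s : nat, (0 < s)%N -> F s = G s.

Definition sub_family (F G : family) : Prop :=
  forall s : nat, (0 < s)%N -> F s `<=` G s.

Definition compress s t (V : 'M[C]_(s, t)) (A : 'M[C]_(d * s)) :
    'M[C]_(d * t) :=
  ((1%:M : 'M[C]_d) *t V)^t* *m A *m ((1%:M : 'M[C]_d) *t V).

Definition convex_cone n (K : set 'M[C]_n) : Prop :=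
  [/\ K 0,
      forall A B, K A -> K B -> K (A + B)
    & forall (r : C) A, 0 <= r -> K A -> K (r *: A)].

Definition order_unit n (K : set 'M[C]_n) (e : 'M[C]_n) : Prop :=
  forall A : 'M[C]_n, A \is hermsymmx -> exists2 r : C, 0 < r & K (r *: e + A).

Record operator_system_with (u : 'M[C]_d) (F : family) : Prop := {
  opsys_herm : forall s A, (0 < s)%N -> F s A -> A \is hermsymmx;
  opsys_cone : forall s, (0 < s)%N -> convex_cone (F s);
  opsys_closed : forall s, (0 < s)%N -> closed (F s);
  opsys_salient : forall s A, (0 < s)%N -> F s A -> F s (- A) -> A = 0;
  opsys_compress : forall s t (V : 'M[C]_(s, t)) A,
    (0 < s)%N -> (0 < t)%N -> F s A -> F t (compress V A);
  opsys_unit_mem : F 1%N (u *t (1%:M : 'M[C]_1));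
  opsys_unit : forall s, (0 < s)%N -> order_unit (F s) (u *t (1%:M : 'M[C]_s))
}.

Definition operator_system (F : family) : Prop :=
  exists u : 'M[C]_d, operator_system_with u F.

Definition contains_all n (k : 'I_n -> nat) (A : forall j, 'M[C]_(d * k j))
    (F : family) : Prop :=
  forall j, F (k j) (A j).

Definition finitely_generated (F : family) : Prop :=
  exists (n : nat) (k : 'I_n -> nat) (A : forall j, 'M[C]_(d * k j)),
    [/\ forall j, (0 < k j)%N,
        operator_system F,
        contains_all A F
      & forall G, operator_system G -> contains_all A G -> sub_family F G].

Definition block s (X : 'M[C]_(d * s)) (i j : 'I_d) : 'M[C]_s :=
  \matrix_(k, l) X (mxtens_index (i, k)) (mxtens_index (j, l)).

Lemma sum_delta_block s (X : 'M[C]_(d * s)) :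
  X = \sum_i \sum_j delta_mx i j *t block X i j.
Proof.
apply/matrixP => a b; case: (mxtens_indexP a) => i k.
case: (mxtens_indexP b) => j l; rewrite summxE (bigD1 i) //= [X in _ + X]big1.
  rewrite addr0 summxE (bigD1 j) //= [X in _ + X]big1.
    by rewrite addr0 tensmxE !mxE !eqxx mul1r.
  by move=> j' nj; rewrite tensmxE mxE [j == _]eq_sym (negbTE nj) andbF mul0r.
move=> i' ni; rewrite summxE big1 // => j' _.
by rewrite tensmxE mxE eq_sym (negbTE ni) mul0r.
Qed.

Lemma block_tens s (A : 'M[C]_d) (B : 'M[C]_s) i j :
  block (A *t B) i j = A i j *: B.
Proof. by apply/matrixP => k l; rewrite mxE tensmxE mxE. Qed.

(* phi (x) id *)
Definition amplify n (phi : 'M[C]_d -> 'M[C]_n) s (X : 'M[C]_(d * s)) :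
    'M[C]_(n * s) :=
  \sum_i \sum_j phi (delta_mx i j) *t block X i j.

Lemma amplify_tens n (phi : {linear 'M[C]_d -> 'M[C]_n}) s
    (A : 'M[C]_d) (B : 'M[C]_s) :
  amplify phi (A *t B) = phi A *t B.
Proof.
rewrite [in RHS](matrix_sum_delta A) linear_sum; apply/matrixP => a b.
case: (mxtens_indexP a) => i k; case: (mxtens_indexP b) => j l.
rewrite tensmxE !summxE mulr_suml; apply: eq_bigr => i' _.
rewrite linear_sum !summxE mulr_suml; apply: eq_bigr => j' _.
by rewrite linearZ tensmxE block_tens !mxE mulrCA mulrA.
Qed.

(* A finite-dimensional Hilbert space is taken to be C^n with its standard
   inner product. *)
Definition realizable (u : 'M[C]_d) (F : family) : Prop :=
  exists (n : nat) (phi : {linear 'M[C]_d -> 'M[C]_n}),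
    [/\ forall A, phi (A^t*) = (phi A)^t*,
        phi u = 1%:M
      & forall s (A : 'M[C]_(d * s)), (0 < s)%N -> A \is hermsymmx ->
          F s A <-> psdmx (amplify phi A)].

Definition ptrans s (X : 'M[C]_(d * s)) : 'M[C]_(d * s) :=
  \matrix_(a, b)
    X (mxtens_index ((mxtens_unindex b).1, (mxtens_unindex a).2))
      (mxtens_index ((mxtens_unindex a).1, (mxtens_unindex b).2)).

Lemma ptrans_is_linear s : linear (@ptrans s).
Proof. by move=> c X Y; apply/matrixP => a b; rewrite !mxE. Qed.

Lemma ptrans_tens s (A : 'M[C]_d) (B : 'M[C]_s) : ptrans (A *t B) = A^T *t B.
Proof.
apply/matrixP => a b; case: (mxtens_indexP a) => i k.
case: (mxtens_indexP b) => j l.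
by rewrite mxE !mxtens_indexK !tensmxE /= mxE.
Qed.

Definition Sep : family := fun s =>
  [set X | exists (n : nat) (A : 'I_n -> 'M[C]_d) (B : 'I_n -> 'M[C]_s),
     (forall i, psdmx (A i) /\ psdmx (B i)) /\ X = \sum_i A i *t B i].

Definition Bpsd : family := fun s =>
  [set X | forall (x : 'cV[C]_d) (y : 'cV[C]_s), 0 <= qform X (x *t y)].

Definition Psd : family := fun s => [set X | psdmx X].

Definition PsdG : family := fun s => [set X | psdmx (ptrans X)].

Definition Dpsd : family := fun s => @Psd s `&` @PsdG s.

Definition Decomp : family := fun s =>
  [set Z | exists X Y, [/\ Psd X, PsdG Y & Z = X + Y]].

(* Her_d (x) Her_s over the reals is the set of Hermitian elements of
   'M[C]_(d * s). *)
Definition free_dual (F : family) : family := fun s =>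
  [set A | A \is hermsymmx /\
     forall t (B : 'M[C]_(d * t)), (0 < t)%N -> F t B ->
       psdmx (\sum_i \sum_j (block B i j)^T *t block A j i)].

End OperatorSystems.

Arguments Sep : clear implicits.
Arguments Bpsd : clear implicits.
Arguments Psd : clear implicits.
Arguments PsdG : clear implicits.
Arguments Dpsd : clear implicits.
Arguments Decomp : clear implicits.
Arguments free_dual {C d} F s _.

(* Main.v *)
(* Testing the free pairing on vectors shows that the free dual of a family
   closed under compression is its level-wise dual cone for the trace pairing.
   Positive matrices are sums of rank-one ones, so Psd and PsdG are self-dual,
   Bpsd is the dual of Sep and Dpsd that of Decomp; the reverse dualities are the
   bipolar theorem, which applies because the cones Sep (by Carathéodory) and
   Decomp are closed.

   Sep is not finitely generated and Bpsd is not realizable because finitely many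
   product vectors x (x) y involve finitely many x, and some Hermitian H that is
   not positive has x^* H x >= 0 for all of them.

   For the two remaining statements let phi : Mat_d -> Mat_n be a positive map.
   Choose x0 maximizing the rank of phi (x x^* ), and restrict phi to the span of
   x0 and an independent vector x1. Since the rank is locally constant, the Schur
   complement of phi ((x0 + z x1) (x0 + z x1)^* ) vanishes identically, and its
   second-order part splits phi, near x0, into a completely positive and a
   completely copositive map. Hence phi (x) id maps every positive definite
   matrix with positive definite partial transpose, scaled towards x0, to a
   positive matrix. Scaling does not affect separability, so an entangled 2 x 4
   matrix with positive partial transpose shows that phi (x) id does not
   characterize Sep. This excludes a realization of Sep, and, with phi the direct
   sum of the maps attached to generators, a finite generation of Bpsd. *)

(* To refute finite generation one needs a competing operator system that contains the generators
   but not the whole system. It is always the trace dual of a family L containing Sep: such a dual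
   is closed and convex and lies in Bpsd, hence is Hermitian and salient, so only the order unit
   remains to be checked. For Sep, L is Sep enlarged by the matrices H (x) Q; the condition tr H > 0
   keeps the order unit. For Bpsd, L consists of the positive matrices with positive image under phi
   (x) id.

   The size 2 x 4 is forced: the local argument sees only two directions of the first factor, and in
   sizes 2 x 2 and 2 x 3 a positive partial transpose already implies separability.

   Closedness of Sep and Decomp is never stated. The bipolar theorem instead asks that the part of
   the cone of bounded trace be reached from a compact box of real parameters. This is the only
   place that needs the real numbers, so the obstructions are proved over any closed field with the
   reverse dualities as hypotheses ([bip], [bip2]). *)
From HB Require Import structures.
Require Import Defs.
From mathcomp Require Import all_boot all_order all_algebra.
From mathcomp Require Import all_classical all_reals all_analysis.
From mathcomp Require Import mxtens ring lra.

Set Implicit Arguments.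
Unset Strict Implicit.
Unset Printing Implicit Defensive.

Import Order.TTheory GRing.Theory Num.Theory.
Import numFieldNormedType.Exports.

Local Open Scope classical_set_scope.
Local Open Scope ring_scope.
Local Open Scope sesquilinear_scope.

(** * Hermitian forms and positive semidefinite matrices *)

Section Forms.
Variable C : numClosedFieldType.

Lemma adjmxM m n p (A : 'M[C]_(m, n)) (B : 'M[C]_(n, p)) :
  (A *m B)^t* = B^t* *m A^t*.
Proof. by rewrite trmx_mul map_mxM. Qed.

Lemma adjmxD m n (A B : 'M[C]_(m, n)) : (A + B)^t* = A^t* + B^t*.
Proof. by rewrite linearD map_mxD. Qed.

Lemma adjmxN m n (A : 'M[C]_(m, n)) : (- A)^t* = - A^t*.
Proof. by rewrite linearN map_mxN. Qed.

Lemma adjmxB m n (A B : 'M[C]_(m, n)) : (A - B)^t* = A^t* - B^t*.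
Proof. by rewrite adjmxD adjmxN. Qed.

Lemma adjmxZ m n (a : C) (A : 'M[C]_(m, n)) : (a *: A)^t* = a^* *: A^t*.
Proof. by rewrite linearZ map_mxZ. Qed.

Lemma adjmx0 m n : (0 : 'M[C]_(m, n))^t* = 0.
Proof. by rewrite trmx0 map_mx0. Qed.

Lemma adjmx1 n : (1%:M : 'M[C]_n)^t* = 1%:M.
Proof. by rewrite trmx1 map_mx1. Qed.

Lemma adjmx_sum I (r : seq I) (P : pred I) m n (F : I -> 'M[C]_(m, n)) :
  (\sum_(i <- r | P i) F i)^t* = \sum_(i <- r | P i) (F i)^t*.
Proof. by rewrite linear_sum map_mx_sum. Qed.

Lemma adjmx_tens m n p q (A : 'M[C]_(m, n)) (B : 'M[C]_(p, q)) :
  (A *t B)^t* = A^t* *t B^t*.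
Proof. by rewrite trmx_tens map_mxT. Qed.

Lemma adjmxE m n (A : 'M[C]_(m, n)) i j : A^t* i j = (A j i)^*.
Proof. by rewrite !mxE. Qed.

Lemma hermsymmxP n (A : 'M[C]_n) : reflect (A^t* = A) (A \is hermsymmx).
Proof.
rewrite qualifE /= /hermitianmx /=.
by apply: (iffP eqP) => [{2}->|e]; rewrite expr0 scale1r ?e.
Qed.

Lemma tensmxDl m n p q (A A' : 'M[C]_(m, n)) (B : 'M[C]_(p, q)) :
  (A + A') *t B = A *t B + A' *t B.
Proof.
by apply/matrixP=> i j; rewrite !mxE mulrDl.
Qed.

Lemma tensmxDr m n p q (A : 'M[C]_(m, n)) (B B' : 'M[C]_(p, q)) :
  A *t (B + B') = A *t B + A *t B'.
Proof. by apply/matrixP=> i j; rewrite !mxE mulrDr. Qed.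

Lemma tensmxZl m n p q a (A : 'M[C]_(m, n)) (B : 'M[C]_(p, q)) :
  (a *: A) *t B = a *: (A *t B).
Proof. by apply/matrixP=> i j; rewrite !mxE mulrA. Qed.

Lemma tensmxZr m n p q a (A : 'M[C]_(m, n)) (B : 'M[C]_(p, q)) :
  A *t (a *: B) = a *: (A *t B).
Proof. by apply/matrixP=> i j; rewrite !mxE mulrCA. Qed.

Lemma tensmxNl m n p q (A : 'M[C]_(m, n)) (B : 'M[C]_(p, q)) :
  (- A) *t B = - (A *t B).
Proof. by rewrite -scaleN1r tensmxZl scaleN1r. Qed.

Lemma tensmx_suml I (r : seq I) (P : pred I) m n p q
    (F : I -> 'M[C]_(m, n)) (B : 'M[C]_(p, q)) :
  (\sum_(i <- r | P i) F i) *t B = \sum_(i <- r | P i) (F i *t B).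
Proof.
apply: (big_morph (fun A => A *t B)) => [A A'|]; first exact: tensmxDl.
exact: tens0mx.
Qed.

Lemma tensmx_sumr I (r : seq I) (P : pred I) m n p q
    (A : 'M[C]_(m, n)) (F : I -> 'M[C]_(p, q)) :
  A *t (\sum_(i <- r | P i) F i) = \sum_(i <- r | P i) (A *t F i).
Proof.
apply: (big_morph (fun B => A *t B)) => [B B'|]; first exact: tensmxDr.
exact: tensmx0.
Qed.

Lemma tensmx11 m n : (1%:M : 'M[C]_m) *t (1%:M : 'M[C]_n) = 1%:M.
Proof.
apply/matrixP => a b; case: (mxtens_indexP a) => i k.
case: (mxtens_indexP b) => j l; rewrite tensmxE !mxE -natrM mulnb.
by rewrite (can_eq (@mxtens_indexK m n)) xpair_eqE.
Qed.

Lemma sum_mxtens (V : nmodType) m n (F : 'I_(m * n) -> V) :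
  \sum_k F k = \sum_i \sum_j F (mxtens_index (i, j)).
Proof.
rewrite pair_bigA /= (reindex (@mxtens_index m n)) /=.
  by apply: eq_bigr => -[i j] _.
by exists (@mxtens_unindex m n) => k _; rewrite ?mxtens_indexK ?mxtens_unindexK.
Qed.

Lemma qformE n (A : 'M[C]_n) x : qform A x = \tr (A *m (x *m x^t*)).
Proof. by rewrite mulmxA mxtrace_mulC mulmxA /mxtrace big_ord1. Qed.

Lemma qformD n (A B : 'M[C]_n) x : qform (A + B) x = qform A x + qform B x.
Proof. by rewrite !qformE mulmxDl mxtraceD. Qed.

Lemma qformN n (A : 'M[C]_n) x : qform (- A) x = - qform A x.
Proof. by rewrite !qformE mulNmx linearN. Qed.

Lemma qformZ n a (A : 'M[C]_n) x : qform (a *: A) x = a * qform A x.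
Proof. by rewrite !qformE -scalemxAl mxtraceZ. Qed.

Lemma qform0 n x : qform (0 : 'M[C]_n) x = 0.
Proof. by rewrite qformE mul0mx mxtrace0. Qed.

Lemma qform_sum I (r : seq I) (P : pred I) n (F : I -> 'M[C]_n) x :
  qform (\sum_(i <- r | P i) F i) x = \sum_(i <- r | P i) qform (F i) x.
Proof.
apply: (big_morph (fun A => qform A x)) => [A B|]; first exact: qformD.
exact: qform0.
Qed.

Lemma qform_congr m n (V : 'M[C]_(m, n)) (A : 'M[C]_m) x :
  qform (V^t* *m A *m V) x = qform A (V *m x).
Proof. by rewrite /qform adjmxM !mulmxA. Qed.

Lemma qform_adj n (A : 'M[C]_n) x : qform (A^t*) x = (qform A x)^*.
Proof.
have -> : (qform A x)^* = (x^t* *m A *m x)^t* 0 0 by rewrite adjmxE.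
by rewrite !adjmxM trmxCK mulmxA.
Qed.

Lemma qform_rank1 n (v x : 'cV[C]_n) :
  qform (v *m v^t*) x = `|(v^t* *m x) 0 0| ^+ 2.
Proof.
rewrite /qform mulmxA -mulmxA mxE big_ord1 normCK mulrC; congr (_ * _).
by rewrite -adjmxE adjmxM trmxCK.
Qed.

Lemma qform_rank1_ge0 n (v x : 'cV[C]_n) : 0 <= qform (v *m v^t*) x.
Proof. by rewrite qform_rank1 exprn_ge0. Qed.

(* Polarization: the form at x + a y contains a x^* A y + a^* y^* A x;
   a = 1 and a = i separate the two cross terms. *)
Lemma qform_eq0 n (A : 'M[C]_n) : (forall x, qform A x = 0) -> A = 0.
Proof.
move=> A0.
have cross (x y : 'cV[C]_n) a :
    a * (x^t* *m A *m y) 0 0 + a^* * (y^t* *m A *m x) 0 0 = 0.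
  have := A0 (x + a *: y).
  have -> : qform A (x + a *: y) = qform A x + qform A (a *: y) +
      (a * (x^t* *m A *m y) 0 0 + a^* * (y^t* *m A *m x) 0 0).
    rewrite /qform adjmxD adjmxZ !mulmxDl !mulmxDr -!scalemxAl -!scalemxAr.
    move: (x^t* *m A *m x) (x^t* *m A *m y) (y^t* *m A *m x)
      (y^t* *m A *m y) => P Q S T.
    by rewrite !mxE; ring.
  by rewrite !A0 !add0r.
apply/matrixP => i j; rewrite mxE.
have Aij k l : A k l = ((delta_mx k 0 : 'cV[C]_n)^t* *m A *m
    (delta_mx l 0 : 'cV[C]_n)) 0 0.
  have -> : (delta_mx k 0 : 'cV[C]_n)^t* = delta_mx 0 k.
    by rewrite trmx_delta map_delta_mx.
  by rewrite -rowE -colE !mxE.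
have := cross (delta_mx i 0) (delta_mx j 0) 1.
have := cross (delta_mx i 0) (delta_mx j 0) 'i.
rewrite -!Aij conjC1 conjCi !mul1r mulNr -mulrBr => /eqP.
rewrite mulf_eq0 (negbTE (neq0Ci C)) /= subr_eq0 => /eqP <- /eqP.
by rewrite -mulr2n mulrn_eq0 /= => /eqP.
Qed.

Lemma qform_hermsym n (A : 'M[C]_n) :
  (forall x, qform A x \is Num.real) -> A \is hermsymmx.
Proof.
move=> Ar; apply/hermsymmxP/eqP; rewrite -subr_eq0; apply/eqP.
apply: qform_eq0 => x; rewrite qformD qformN qform_adj.
by rewrite (CrealP (Ar x)) subrr.
Qed.

Lemma psdmxP n (A : 'M[C]_n) : psdmx A <-> forall x, 0 <= qform A x.
Proof.
split=> [[]//|Age0]; split=> //.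
by apply: qform_hermsym => x; apply: ger0_real.
Qed.

Lemma psdmx_sum I (r : seq I) (P : pred I) n (F : I -> 'M[C]_n) :
  (forall i, P i -> psdmx (F i)) -> psdmx (\sum_(i <- r | P i) F i).
Proof.
move=> F0; apply/psdmxP => x; rewrite qform_sum.
by apply: sumr_ge0 => i Pi; case: (F0 i Pi).
Qed.

Lemma psdmxD n (A B : 'M[C]_n) : psdmx A -> psdmx B -> psdmx (A + B).
Proof.
move=> [_ A0] [_ B0]; apply/psdmxP => x.
by rewrite qformD addr_ge0.
Qed.

Lemma psdmxZ n a (A : 'M[C]_n) : 0 <= a -> psdmx A -> psdmx (a *: A).
Proof. by move=> a0 [_ A0]; apply/psdmxP => x; rewrite qformZ mulr_ge0. Qed.

Lemma psdmx0 n : psdmx (0 : 'M[C]_n).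
Proof. by apply/psdmxP => x; rewrite qform0. Qed.

Lemma psdmx_congr m n (V : 'M[C]_(m, n)) (A : 'M[C]_m) :
  psdmx A -> psdmx (V^t* *m A *m V).
Proof. by move=> [_ A0]; apply/psdmxP => x; rewrite qform_congr. Qed.

Lemma psdmx_rank1 n (v : 'cV[C]_n) : psdmx (v *m v^t*).
Proof. by apply/psdmxP => x; apply: qform_rank1_ge0. Qed.

Lemma psdmx_gram m n (V : 'M[C]_(m, n)) : psdmx (V^t* *m V).
Proof.
rewrite -[V^t*]mulmx1; apply: psdmx_congr; apply/psdmxP => x.
rewrite /qform mulmx1 mxE sumr_ge0 // => i _.
by rewrite adjmxE mulrC -normCK exprn_ge0.
Qed.

Lemma psdmx_cogram m n (G : 'M[C]_(m, n)) : psdmx (G *m G^t*).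
Proof. by rewrite -{1}[G]trmxCK; exact: psdmx_gram. Qed.

Lemma mxtrace_cogram m n (G : 'M[C]_(m, n)) :
  \tr (G *m G^t*) = \sum_i \sum_j `|G i j| ^+ 2.
Proof.
rewrite /mxtrace; apply: eq_bigr => i _; rewrite mxE; apply: eq_bigr => j _.
by rewrite adjmxE normCK.
Qed.

Lemma cogram_eq0 m n (G : 'M[C]_(m, n)) : G *m G^t* = 0 -> G = 0.
Proof.
move=> G0; have /eqP : \tr (G *m G^t*) = 0 by rewrite G0 mxtrace0.
rewrite mxtrace_cogram psumr_eq0; last first.
  by move=> i _; apply: sumr_ge0 => j _; rewrite exprn_ge0.
move=> /allP h; apply/matrixP => i j; rewrite mxE.
have := h i (mem_index_enum _); rewrite /= psumr_eq0; last first.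
  by move=> k _; rewrite exprn_ge0.
move=> /allP/(_ j (mem_index_enum _)) /=.
by rewrite expf_eq0 /= normr_eq0 => /eqP.
Qed.

Lemma mulmx_adj_sum m n (G : 'M[C]_(m, n)) :
  G *m G^t* = \sum_j col j G *m (col j G)^t*.
Proof.
apply/matrixP => a b; rewrite summxE mxE; apply: eq_bigr => j _.
by rewrite !mxE big_ord1 !mxE.
Qed.

(* A = U^* D U with U unitary and D >= 0 diagonal, so G = U^* D^(1/2). *)
Lemma psdmx_spectral n (A : 'M[C]_n) : psdmx A ->
  exists (U : 'M[C]_n) (D : 'rV[C]_n),
    [/\ U *m U^t* = 1%:M, U^t* *m U = 1%:M, forall i, 0 <= D 0 i
      & A = U^t* *m diag_mx D *m U].
Proof.
move=> [hA A0]; exists (spectralmx A), (spectral_diag A).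
have /unitarymxP UU := spectral_unitarymx A.
have UU' : (spectralmx A)^t* *m spectralmx A = 1%:M by apply: mulmx1C.
have eA : A = (spectralmx A)^t* *m diag_mx (spectral_diag A) *m spectralmx A.
  rewrite -(invmx_unitary (spectral_unitarymx A)).
  exact: (orthomx_spectralP (hermitian_normalmx hA)).
split=> // i; have := A0 ((spectralmx A)^t* *m delta_mx i 0).
rewrite [in qform A]eA qform_congr mulmxA UU mul1mx /qform.
have -> : (delta_mx i 0 : 'cV[C]_n)^t* = delta_mx 0 i.
  by rewrite trmx_delta map_delta_mx.
by rewrite -rowE -colE !mxE eqxx mulr1n.
Qed.

Lemma psdmx_factor n (A : 'M[C]_n) : psdmx A -> exists G : 'M[C]_n, A = G *m G^t*.
Proof.
move=> /psdmx_spectral[U [D [_ _ D0 ->]]].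
exists (U^t* *m diag_mx (map_mx sqrtC D)).
rewrite adjmxM trmxCK !mulmxA; congr (_ *m _); rewrite -!mulmxA; congr (_ *m _).
rewrite tr_diag_mx map_diag_mx mul_diag_mx; apply/matrixP => i j; rewrite !mxE.
have [->|_] := eqVneq i j; last by rewrite !mulr0n mulr0.
rewrite [X in _ = _ * (X *+ _)](_ : _ = sqrtC (D 0 j)).
  by rewrite mulr1n -expr2 sqrtCK.
by apply: geC0_conj; rewrite sqrtC_ge0.
Qed.

Lemma psdmx_sum_rank1 n (A : 'M[C]_n) : psdmx A ->
  exists v : 'I_n -> 'cV[C]_n, A = \sum_i v i *m (v i)^t*.
Proof.
by move=> /psdmx_factor[G ->]; exists (fun j => col j G); exact: mulmx_adj_sum.
Qed.

Lemma mxtrace_psd_mul n (A B : 'M[C]_n) :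
  psdmx A -> psdmx B -> 0 <= \tr (A *m B).
Proof.
move=> [_ A0] /psdmx_sum_rank1[v ->]; rewrite mulmx_sumr raddf_sum /=.
by apply: sumr_ge0 => i _; rewrite -qformE.
Qed.

Lemma mxtrace_psd n (A : 'M[C]_n) : psdmx A -> 0 <= \tr A.
Proof.
rewrite -[A in \tr A]mulmx1 => A0; apply: mxtrace_psd_mul => //.
by rewrite -(mul1mx 1%:M) -{1}adjmx1; apply: psdmx_gram.
Qed.

Lemma psdmx1 n : psdmx (1%:M : 'M[C]_n).
Proof. by rewrite -(mul1mx 1%:M) -{1}adjmx1; apply: psdmx_gram. Qed.

(* diag_mx D >= - (sum_i |D_i|) 1 in an eigenbasis. *)
Lemma hermsym_psd_shift n (A : 'M[C]_n) : A \is hermsymmx ->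
  exists2 r : C, 0 < r & psdmx (r *: 1%:M + A).
Proof.
move=> hA.
have UU : spectralmx A *m (spectralmx A)^t* = 1%:M.
  exact/unitarymxP/spectral_unitarymx.
have UU' : (spectralmx A)^t* *m spectralmx A = 1%:M by apply: mulmx1C.
have eA : A = (spectralmx A)^t* *m diag_mx (spectral_diag A) *m spectralmx A.
  rewrite -(invmx_unitary (spectral_unitarymx A)).
  exact: (orthomx_spectralP (hermitian_normalmx hA)).
pose r := 1 + \sum_i `|spectral_diag A 0 i|.
have rE : 0 < r by rewrite ltr_pwDl // sumr_ge0.
exists r => //.
have -> : r *: 1%:M + A = r *: 1%:M + (spectralmx A)^t* *m diag_mx (spectral_diag A) *m
    spectralmx A by rewrite -eA.
have -> : r *: 1%:M + (spectralmx A)^t* *m diag_mx (spectral_diag A) *m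
    spectralmx A = (spectralmx A)^t* *m (r *: 1%:M + diag_mx (spectral_diag A))
    *m spectralmx A.
  by rewrite mulmxDr mulmxDl -scalemxAr mulmx1 -scalemxAl UU'.
apply: psdmx_congr; apply/psdmxP => x; rewrite /qform -mulmxA mxE.
apply: sumr_ge0 => i _; rewrite mulmxDl -scalemxAl mul1mx mul_diag_mx.
rewrite !mxE -mulrDl mulrCA mulr_ge0 //; last by rewrite mulrC -normCK exprn_ge0.
have real_D : spectral_diag A 0 i \is Num.real.
  by have /mxOverP := hermitian_spectral_diag_real hA; apply.
rewrite /r (bigD1 i) //= -addrA addr_ge0 // -addrA addrCA addr_ge0 ?sumr_ge0 //.
by rewrite -[X in _ + X]opprK subr_ge0 -normrN real_ler_norm // realN.
Qed.

End Forms.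

(** * Blocks, compressions and partial transposition *)

Section Tensors.
Variables (C : numClosedFieldType) (d : nat).

Lemma qform_tens_prod m n (A : 'M[C]_m) (B : 'M[C]_n) (x : 'cV[C]_m)
    (y : 'cV[C]_n) :
  qform (A *t B) (x *t y) = qform A x * qform B y.
Proof.
have i0 : (0 : 'I_(1 * 1)) = mxtens_index ((0 : 'I_1), (0 : 'I_1)).
  by apply/val_inj.
rewrite /qform -(tensmxE (x^t* *m A *m x)) -!tensmx_mul -adjmx_tens.
by rewrite -i0.
Qed.

Lemma mulmx_tens_adj m n (x : 'cV[C]_m) (y : 'cV[C]_n) :
  (x *t y) *m (x *t y)^t* = (x *m x^t*) *t (y *m y^t*).
Proof. by rewrite adjmx_tens tensmx_mul. Qed.

Lemma mxtrace_tens m n (A : 'M[C]_m) (B : 'M[C]_n) :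
  \tr (A *t B) = \tr A * \tr B.
Proof.
rewrite /mxtrace sum_mxtens mulr_suml; apply: eq_bigr => i _.
by rewrite mulr_sumr; apply: eq_bigr => j _; rewrite tensmxE.
Qed.

Lemma block0 s i j : block (0 : 'M[C]_(d * s)) i j = 0.
Proof. by apply/matrixP => k l; rewrite !mxE. Qed.

Lemma eq_block s (X Y : 'M[C]_(d * s)) :
  (forall i j, block X i j = block Y i j) -> X = Y.
Proof.
by move=> XY; rewrite (sum_delta_block X) (sum_delta_block Y); apply: eq_bigr
  => i _; apply: eq_bigr => j _; rewrite XY.
Qed.

Lemma block_sum_tens s (F : 'I_d -> 'I_d -> 'M[C]_s) i j :
  block (\sum_i \sum_j delta_mx i j *t F i j) i j = F i j.
Proof.
apply/matrixP => k l; rewrite mxE summxE (bigD1 i) //= [X in _ + X]big1.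
  rewrite addr0 summxE (bigD1 j) //= [X in _ + X]big1.
    by rewrite addr0 tensmxE !mxE !eqxx mul1r.
  by move=> j' nj; rewrite tensmxE mxE [j == _]eq_sym (negbTE nj) andbF mul0r.
move=> i' ni; rewrite summxE big1 // => j' _.
by rewrite tensmxE mxE eq_sym (negbTE ni) mul0r.
Qed.

Lemma block_adj s (X : 'M[C]_(d * s)) i j : block (X^t*) i j = (block X j i)^t*.
Proof. by apply/matrixP => k l; rewrite !mxE. Qed.

Lemma mxtrace_mul_block s (X Y : 'M[C]_(d * s)) :
  \tr (X *m Y) = \sum_i \sum_j \tr (block X i j *m block Y j i).
Proof.
rewrite /mxtrace sum_mxtens; apply: eq_bigr => i _.
rewrite exchange_big /=; apply: eq_bigr => k _.
rewrite mxE sum_mxtens; apply: eq_bigr => j _.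
by rewrite mxE; apply: eq_bigr => l _; rewrite !mxE.
Qed.

Lemma compressD s t (V : 'M[C]_(s, t)) (A B : 'M[C]_(d * s)) :
  compress V (A + B) = compress V A + compress V B.
Proof. by rewrite /compress mulmxDr mulmxDl. Qed.

Lemma compress0 s t (V : 'M[C]_(s, t)) : compress V (0 : 'M[C]_(d * s)) = 0.
Proof. by rewrite /compress mulmx0 mul0mx. Qed.

Lemma compress_sum I (r : seq I) (P : pred I) s t (V : 'M[C]_(s, t))
    (F : I -> 'M[C]_(d * s)) :
  compress V (\sum_(i <- r | P i) F i) = \sum_(i <- r | P i) compress V (F i).
Proof.
apply: (big_morph (compress V)) => [A B|]; first exact: compressD.
exact: compress0.
Qed.

Lemma compress_tens s t (V : 'M[C]_(s, t)) (A : 'M[C]_d) (B : 'M[C]_s) :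
  compress V (A *t B) = A *t (V^t* *m B *m V).
Proof. by rewrite /compress adjmx_tens adjmx1 !tensmx_mul mul1mx mulmx1. Qed.

Lemma compress_block s t (V : 'M[C]_(s, t)) (X : 'M[C]_(d * s)) i j :
  block (compress V X) i j = V^t* *m block X i j *m V.
Proof.
rewrite {1}(sum_delta_block X) compress_sum.
under eq_bigr do rewrite compress_sum.
under eq_bigr do under eq_bigr do rewrite compress_tens.
by rewrite block_sum_tens.
Qed.

Lemma compress1 s (A : 'M[C]_(d * s)) : compress 1%:M A = A.
Proof. by rewrite /compress tensmx11 adjmx1 mul1mx mulmx1. Qed.

Lemma mxtrace_compress s t (V : 'M[C]_(s, t)) (A : 'M[C]_(d * s))
    (B : 'M[C]_(d * t)) :
  \tr (compress V A *m B) = \tr (A *m compress (V^t*) B).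
Proof.
rewrite /compress !adjmx_tens !adjmx1 trmxCK.
by rewrite -!mulmxA mxtrace_mulC !mulmxA.
Qed.

Lemma psdmx_compress s t (V : 'M[C]_(s, t)) (A : 'M[C]_(d * s)) :
  psdmx A -> psdmx (compress V A).
Proof. exact: psdmx_congr. Qed.

Lemma qform_tens_block s (Z : 'M[C]_(d * s)) (x : 'cV[C]_d) (y : 'cV[C]_s) :
  qform Z (x *t y) = qform (\matrix_(i, j) qform (block Z i j) y) x.
Proof.
rewrite {1}(sum_delta_block Z) qform_sum.
rewrite [\matrix_(_, _) _](matrix_sum_delta) qform_sum; apply: eq_bigr => i _.
rewrite !qform_sum; apply: eq_bigr => j _.
by rewrite qform_tens_prod qformZ mxE mulrC.
Qed.

(** Polarization once per factor: for fixed y the contracted d x d matrix vanishes, and then so does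
    the form of each block. *)
Lemma qform_prod_eq0 s (Z : 'M[C]_(d * s)) :
  (forall (x : 'cV[C]_d) (y : 'cV[C]_s), qform Z (x *t y) = 0) -> Z = 0.
Proof.
move=> Z0; apply: eq_block => i j; rewrite block0; apply: qform_eq0 => y.
have : \matrix_(i, j) qform (block Z i j) y = 0.
  by apply: qform_eq0 => x; rewrite -qform_tens_block.
by move=> /matrixP/(_ i j); rewrite !mxE.
Qed.

Lemma qform_prod_hermsym s (Z : 'M[C]_(d * s)) :
  (forall (x : 'cV[C]_d) (y : 'cV[C]_s), qform Z (x *t y) \is Num.real) ->
  Z \is hermsymmx.
Proof.
move=> Zr; apply/hermsymmxP/eqP; rewrite -subr_eq0; apply/eqP.
apply: qform_prod_eq0 => x y; rewrite qformD qformN qform_adj.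
by rewrite (CrealP (Zr x y)) subrr.
Qed.

(** The coefficient matrix W of a bipartite vector; A (x) B acts on it as A W B^T, which makes its
    form the trace in [qform_tens]. *)
Definition vec_rows t s (w : 'cV[C]_(t * s)) : 'M[C]_(t, s) :=
  \matrix_(i, j) w (mxtens_index (i, j)) 0.

Lemma qform_tens t s (A : 'M[C]_t) (B : 'M[C]_s) w :
  qform (A *t B) w =
  \tr ((vec_rows w)^t* *m A *m vec_rows w *m B^T).
Proof.
have qE n (M : 'M[C]_n) v : qform M v = \sum_i \sum_j (v i 0)^* * M i j * v j 0.
  rewrite /qform mxE exchange_big /=; apply: eq_bigr => j _.
  by rewrite mxE mulr_suml; apply: eq_bigr => i _; rewrite !mxE.
rewrite qE sum_mxtens /mxtrace.
under eq_bigr do under eq_bigr do rewrite sum_mxtens.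
rewrite exchange_big /=; apply: eq_bigr => k _.
rewrite mxE.
transitivity (\sum_i \sum_l \sum_j (w (mxtens_index (i, k)) 0)^* *
   A i j * w (mxtens_index (j, l)) 0 * B k l).
  apply: eq_bigr => i _; rewrite exchange_big /=; apply: eq_bigr => l _.
  by apply: eq_bigr => j _; rewrite tensmxE; ring.
rewrite exchange_big /=; apply: eq_bigr => l _.
rewrite !mxE mulr_suml exchange_big /=; apply: eq_bigr => j _.
rewrite !mxE !mulr_suml; apply: eq_bigr => i _.
by rewrite !mxE.
Qed.

(** Transposing the whole trace removes the transposes from the blocks of B and puts the conjugate
    of W in the place of W. *)
Lemma free_pairing_form t s (B : 'M[C]_(d * t)) (A : 'M[C]_(d * s)) w :
  qform (\sum_i \sum_j (block B i j)^T *t block A j i) w =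
  \tr (compress (map_mx Num.conj (vec_rows w)) B *m A).
Proof.
rewrite mxtrace_mul_block qform_sum; apply: eq_bigr => i _.
rewrite qform_sum; apply: eq_bigr => j _.
rewrite qform_tens compress_block -mxtrace_tr !trmx_mul !trmxK mxtrace_mulC.
rewrite !mulmxA; congr (\tr (_ *m _)); congr (_ *m _ *m _).
  by apply/matrixP => a b; rewrite !mxE conjCK.
by apply/matrixP => a b; rewrite !mxE.
Qed.

Lemma ptransD s (X Y : 'M[C]_(d * s)) : ptrans (X + Y) = ptrans X + ptrans Y.
Proof. by apply/matrixP => a b; rewrite !mxE. Qed.

Lemma ptransZ s a (X : 'M[C]_(d * s)) : ptrans (a *: X) = a *: ptrans X.
Proof. by apply/matrixP => i j; rewrite !mxE. Qed.

Lemma ptrans0 s : ptrans (0 : 'M[C]_(d * s)) = 0.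
Proof. by apply/matrixP => i j; rewrite !mxE. Qed.

Lemma ptrans_sum I (r : seq I) (P : pred I) s (F : I -> 'M[C]_(d * s)) :
  ptrans (\sum_(i <- r | P i) F i) = \sum_(i <- r | P i) ptrans (F i).
Proof.
apply: (big_morph (@ptrans C d s)) => [A B|]; first exact: ptransD.
exact: ptrans0.
Qed.

Lemma block_ptrans s (X : 'M[C]_(d * s)) i j :
  block (ptrans X) i j = block X j i.
Proof. by apply/matrixP => k l; rewrite !mxE !mxtens_indexK. Qed.

Lemma ptransK s (X : 'M[C]_(d * s)) : ptrans (ptrans X) = X.
Proof. by apply: eq_block => i j; rewrite !block_ptrans. Qed.

Lemma ptrans_compress s t (V : 'M[C]_(s, t)) (X : 'M[C]_(d * s)) :
  ptrans (compress V X) = compress V (ptrans X).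
Proof.
by apply: eq_block => i j; rewrite !(block_ptrans, compress_block).
Qed.

Lemma mxtrace_ptrans s (X Y : 'M[C]_(d * s)) :
  \tr (ptrans X *m ptrans Y) = \tr (X *m Y).
Proof.
rewrite !mxtrace_mul_block exchange_big /=; apply: eq_bigr => i _.
by apply: eq_bigr => j _; rewrite !block_ptrans.
Qed.

Lemma mxtrace_ptrans1 s (X : 'M[C]_(d * s)) : \tr (ptrans X) = \tr X.
Proof.
rewrite /mxtrace !sum_mxtens; apply: eq_bigr => i _; apply: eq_bigr => k _.
by rewrite mxE !mxtens_indexK.
Qed.

Lemma ptrans1 s : ptrans (1%:M : 'M[C]_(d * s)) = 1%:M.
Proof. by rewrite -tensmx11 ptrans_tens trmx1. Qed.

Lemma adjmx_ptrans s (X : 'M[C]_(d * s)) : (ptrans X)^t* = ptrans (X^t*).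
Proof. by apply/matrixP => a b; rewrite !mxE. Qed.

(** The transpose of x x^* is the projection on the conjugate of x, so partial transposition sends
    product projections to product projections. *)
Lemma ptrans_rank1 s (x : 'cV[C]_d) (y : 'cV[C]_s) :
  ptrans ((x *t y) *m (x *t y)^t*) =
  (map_mx Num.conj x *t y) *m (map_mx Num.conj x *t y)^t*.
Proof.
rewrite !mulmx_tens_adj ptrans_tens trmx_mul; congr ((_ *m _) *t _).
  by apply/matrixP => i j; rewrite !mxE.
by apply/matrixP => i j; rewrite !mxE conjCK.
Qed.

End Tensors.

(** * Trace duality and operator systems *)

Section HalfSpaces.
Variable C : numClosedFieldType.

Lemma continuous_sumr (T : topologicalType) (K : numFieldType) I (r : seq I)
    (F : I -> T -> K) :
  (forall i, continuous (F i)) -> continuous (fun x => \sum_(i <- r) F i x).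
Proof.
move=> Fc; elim: r => [|i r IHr] x.
  by under [X in continuous_at _ X]eq_fun do rewrite big_nil; exact: cvg_cst.
under [X in continuous_at _ X]eq_fun do rewrite big_cons.
by apply: cvgD; [exact: Fc|exact: IHr].
Qed.

Lemma closed_halfspace n (B : 'M[C]_n) : closed [set A | 0 <= \tr (B *m A)].
Proof.
pose f (A : 'M[C]_n) := \sum_i \sum_j B i j * A j i.
have fE A : \tr (B *m A) = f A.
  by rewrite /mxtrace /f; apply: eq_bigr => i _; rewrite mxE.
have fc : continuous f.
  apply: continuous_sumr => i; apply: continuous_sumr => j A.
  apply: (@cvgM C 'M[C]_n (nbhs A) _ (fun=> B i j) (fun A : 'M[C]_n => A j i)).
    exact: cvg_cst.
  exact: (@coord_continuous C n n j i A).
(* In C, 0 <= z includes that z is real; writing it as |z| = z makes it the preimage of a point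
   under a continuous map. *)
have -> : [set A | 0 <= \tr (B *m A)] =
    (fun A => `|f A| - f A) @^-1` [set x | x = 0].
  apply/seteqP; split=> A /=; rewrite fE.
    by move=> /ger0_norm ->; rewrite subrr.
  by move=> /eqP; rewrite subr_eq0 => /eqP <-.
apply: closed_comp; last first.
  exact: (accessible_closed_set1 (hausdorff_accessible (@norm_hausdorff C C))).
move=> A _; apply: (@cvgB C C 'M[C]_n (nbhs A) _ (fun A => `|f A|) f).
  by apply: cvg_norm; exact: fc.
exact: fc.
Qed.

End HalfSpaces.

Section Duality.
Variables (C : numClosedFieldType) (d : nat).

(** A list of vector pairs: addition is concatenation, and Carathéodory's argument can drop a term
    and count the rest. *)
Definition sep_sum s (r : seq ('cV[C]_d * 'cV[C]_s)) : 'M[C]_(d * s) :=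
  \sum_(p <- r) (p.1 *t p.2) *m (p.1 *t p.2)^t*.

Lemma SepP s (X : 'M[C]_(d * s)) : Sep C d s X <-> exists r, X = sep_sum r.
Proof.
split; last first.
  move=> [r ->]; exists (size r), (fun i => (tnth (in_tuple r) i).1 *m
    (tnth (in_tuple r) i).1^t*), (fun i => (tnth (in_tuple r) i).2 *m
    (tnth (in_tuple r) i).2^t*).
  split=> [i|]; first by split; exact: psdmx_rank1.
  by rewrite /sep_sum big_tnth; apply: eq_bigr => i _; rewrite -mulmx_tens_adj.
have cl0 : exists r, 0 = @sep_sum s r by exists [::]; rewrite /sep_sum big_nil.
have clD A B : (exists r, A = @sep_sum s r) -> (exists r, B = @sep_sum s r) ->
    exists r, A + B = @sep_sum s r.
  by move=> [r ->] [r' ->]; exists (r ++ r'); rewrite /sep_sum big_cat.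
move=> [n [A [B [AB ->]]]]; apply: (big_ind _ cl0 clD) => i _.
have [/psdmx_sum_rank1[v ->] /psdmx_sum_rank1[w ->]] := AB i.
rewrite tensmx_suml; apply: (big_ind _ cl0 clD) => a _.
rewrite tensmx_sumr; apply: (big_ind _ cl0 clD) => b _.
by exists [:: (v a, w b)]; rewrite /sep_sum big_seq1 mulmx_tens_adj.
Qed.

Lemma Sep_tens s (A : 'M[C]_d) (B : 'M[C]_s) :
  psdmx A -> psdmx B -> Sep C d s (A *t B).
Proof.
by move=> A0 B0; exists 1%N, (fun=> A), (fun=> B); rewrite big_ord1.
Qed.

Lemma Sep_rank1 s (x : 'cV[C]_d) (y : 'cV[C]_s) :
  Sep C d s ((x *t y) *m (x *t y)^t*).
Proof. by rewrite mulmx_tens_adj; apply: Sep_tens; exact: psdmx_rank1. Qed.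

Lemma Sep0 s : Sep C d s 0.
Proof. by apply/SepP; exists [::]; rewrite /sep_sum big_nil. Qed.

Lemma SepD s (X Y : 'M[C]_(d * s)) :
  Sep C d s X -> Sep C d s Y -> Sep C d s (X + Y).
Proof.
move=> /SepP[r ->] /SepP[r' ->]; apply/SepP; exists (r ++ r').
by rewrite /sep_sum big_cat.
Qed.

Lemma SepZ s a (X : 'M[C]_(d * s)) :
  0 <= a -> Sep C d s X -> Sep C d s (a *: X).
Proof.
move=> a0 [n [A [B [AB ->]]]]; exists n, (fun i => a *: A i), B; split.
  by move=> i; have [? ?] := AB i; split=> //; exact: psdmxZ.
by rewrite scaler_sumr; apply: eq_bigr => i _; rewrite tensmxZl.
Qed.

Lemma Sep_compress s t (V : 'M[C]_(s, t)) X :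
  Sep C d s X -> Sep C d t (compress V X).
Proof.
move=> [n [A [B [AB ->]]]]; exists n, A, (fun i => V^t* *m B i *m V); split.
  by move=> i; have [? ?] := AB i; split=> //; exact: psdmx_congr.
by rewrite compress_sum; apply: eq_bigr => i _; rewrite compress_tens.
Qed.

Lemma Sep_sub_Psd s : Sep C d s `<=` Psd C d s.
Proof.
by move=> X /SepP[r ->]; apply: psdmx_sum => p _; exact: psdmx_rank1.
Qed.

Lemma Sep_sub_PsdG s : Sep C d s `<=` PsdG C d s.
Proof.
move=> X /SepP[r ->]; rewrite /PsdG /= ptrans_sum; apply: psdmx_sum => p _.
by rewrite ptrans_rank1; exact: psdmx_rank1.
Qed.

Lemma Sep_sub_Dpsd s : Sep C d s `<=` Dpsd C d s.
Proof. by move=> X SX; split; [exact: Sep_sub_Psd|exact: Sep_sub_PsdG]. Qed.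

(** Hermitianity is not imposed: once F contains Sep, the dual lies in Bpsd, where it is
    automatic. *)
Definition tdual (F : Defs.family C d) : Defs.family C d :=
  fun s => [set A | forall B, F s B -> 0 <= \tr (B *m A)].
Arguments tdual F s _ : clear implicits.

Lemma tdual_Sep s : tdual (Sep C d) s = Bpsd C d s.
Proof.
apply/seteqP; split=> X /= hX.
  move=> x y; rewrite qformE mxtrace_mulC; apply: hX; exact: Sep_rank1.
move=> _ /SepP[r ->]; rewrite mulmx_suml raddf_sum /=.
by apply: sumr_ge0 => p _; rewrite mxtrace_mulC -qformE.
Qed.

Lemma tdual_Psd s : tdual (Psd C d) s = Psd C d s.
Proof.
apply/seteqP; split=> X /= hX.
  apply/psdmxP => x; rewrite qformE mxtrace_mulC; apply: hX.
  exact: psdmx_rank1.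
by move=> B B0; exact: mxtrace_psd_mul.
Qed.

Lemma tdual_PsdG s : tdual (PsdG C d) s = PsdG C d s.
Proof.
apply/seteqP; split=> X /= hX.
  apply/psdmxP => x; rewrite qformE mxtrace_mulC -mxtrace_ptrans ptransK.
  by apply: hX; rewrite /PsdG /= ptransK; exact: psdmx_rank1.
by move=> B B0; rewrite -mxtrace_ptrans; exact: mxtrace_psd_mul.
Qed.

Lemma PsdG_ptrans s (X : 'M[C]_(d * s)) : psdmx X -> PsdG C d s (ptrans X).
Proof. by rewrite /PsdG /= ptransK. Qed.

Lemma Psd_sub_Decomp s : Psd C d s `<=` Decomp C d s.
Proof.
move=> X X0; exists X, 0; split=> //; rewrite ?addr0 // /PsdG /=.
by rewrite ptrans0; exact: psdmx0.
Qed.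

Lemma PsdG_sub_Decomp s : PsdG C d s `<=` Decomp C d s.
Proof.
by move=> X X0; exists 0, X; split=> //; rewrite ?add0r //; exact: psdmx0.
Qed.

Lemma Sep_cone s : convex_cone (Sep C d s).
Proof. by split; [exact: Sep0|exact: SepD|exact: SepZ]. Qed.

Lemma Decomp_cone s : convex_cone (Decomp C d s).
Proof.
split.
- by apply: Psd_sub_Decomp; exact: psdmx0.
- move=> _ _ [X1 [Y1 [X10 Y10 ->]]] [X2 [Y2 [X20 Y20 ->]]].
  exists (X1 + X2), (Y1 + Y2); split; [exact: psdmxD| |by rewrite addrACA].
  by rewrite /PsdG /= ptransD; exact: psdmxD.
- move=> a _ a0 [X [Y [X0 Y0 ->]]]; exists (a *: X), (a *: Y).
  split; [exact: psdmxZ| |by rewrite scalerDr].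
  by rewrite /PsdG /= ptransZ; exact: psdmxZ.
Qed.

Lemma Sep_herm_trace s X : Sep C d s X -> X \is hermsymmx /\ 0 <= \tr X.
Proof.
by move=> /Sep_sub_Psd X0; split; [case: X0|exact: mxtrace_psd].
Qed.

Lemma Decomp_herm_trace s X : Decomp C d s X -> X \is hermsymmx /\ 0 <= \tr X.
Proof.
move=> [Y [Z [Y0 Z0 ->]]]; split; last first.
  by rewrite mxtraceD -[\tr Z]mxtrace_ptrans1 addr_ge0 ?mxtrace_psd.
apply/hermsymmxP; rewrite adjmxD; case: Y0 Z0 => [/hermsymmxP -> _] [].
by move=> /hermsymmxP; rewrite adjmx_ptrans => /(can_inj (@ptransK _ _ _)) ->.
Qed.

Lemma tdual_Decomp s : tdual (Decomp C d) s = Dpsd C d s.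
Proof.
apply/seteqP; split=> X /= hX.
  split; first by rewrite -tdual_Psd => B /Psd_sub_Decomp; exact: hX.
  by rewrite -tdual_PsdG => B /PsdG_sub_Decomp; exact: hX.
move=> _ [Y [Z [Y0 Z0 ->]]]; rewrite mulmxDl mxtraceD.
case: hX; rewrite -tdual_Psd -tdual_PsdG => h1 h2.
by apply: addr_ge0; [exact: h1|exact: h2].
Qed.

Lemma tdualS (F G : Defs.family C d) s :
  F s `<=` G s -> tdual G s `<=` tdual F s.
Proof. by move=> FG X GX B /FG; exact: GX. Qed.

Lemma Bpsd_herm s X : Bpsd C d s X -> X \is hermsymmx.
Proof. by move=> hX; apply: qform_prod_hermsym => x y; exact/ger0_real/hX. Qed.

Lemma Psd_sub_Bpsd s : Psd C d s `<=` Bpsd C d s.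
Proof. by rewrite -tdual_Sep -tdual_Psd; apply: tdualS; exact: Sep_sub_Psd. Qed.

Lemma Sep_sub_Bpsd s : Sep C d s `<=` Bpsd C d s.
Proof. by move=> X /Sep_sub_Psd; exact: Psd_sub_Bpsd. Qed.

Definition compress_closed (F : Defs.family C d) : Prop :=
  forall s t (V : 'M[C]_(s, t)) A, F s A -> F t (compress V A).

(** Compression by V is adjoint, for the trace pairing, to compression by the conjugate transpose of
    V. *)
Lemma tdual_compress_closed F : compress_closed F -> compress_closed (tdual F).
Proof.
move=> cF s t V A FA B FB; rewrite mxtrace_mulC mxtrace_compress.
by rewrite mxtrace_mulC; exact/FA/cF.
Qed.

Lemma Psd_compress_closed : compress_closed (Psd C d).
Proof. by move=> s t V A; exact: psdmx_compress. Qed.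

Lemma PsdG_compress_closed : compress_closed (PsdG C d).
Proof.
by move=> s t V A; rewrite /PsdG /= ptrans_compress; exact: psdmx_compress.
Qed.

Lemma Dpsd_compress_closed : compress_closed (Dpsd C d).
Proof.
by move=> s t V A [? ?]; split;
  [exact: Psd_compress_closed|exact: PsdG_compress_closed].
Qed.

Lemma Bpsd_compress_closed : compress_closed (Bpsd C d).
Proof.
move=> s t V A; rewrite -!tdual_Sep; apply: tdual_compress_closed.
exact: Sep_compress.
Qed.

Lemma Decomp_compress_closed : compress_closed (Decomp C d).
Proof.
move=> s t V _ [X [Y [X0 Y0 ->]]]; exists (compress V X), (compress V Y).
split; [exact: Psd_compress_closed|exact: PsdG_compress_closed|].
exact: compressD.
Qed.

Lemma vec_rows_surj t s (W : 'M[C]_(t, s)) :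
  exists w : 'cV[C]_(t * s), vec_rows w = W.
Proof.
exists (\col_k W (mxtens_unindex k).1 (mxtens_unindex k).2).
by apply/matrixP => i j; rewrite !mxE mxtens_indexK.
Qed.

(* Testing the free pairing on vectors amounts to taking the trace pairing
   with all compressions of B. *)
Lemma psd_free_pairing t s (B : 'M[C]_(d * t)) (A : 'M[C]_(d * s)) :
  psdmx (\sum_i \sum_j (block B i j)^T *t block A j i) <->
  forall V : 'M[C]_(t, s), 0 <= \tr (compress V B *m A).
Proof.
split=> [[_ BA] V|BA].
  have [w ew] := vec_rows_surj (map_mx Num.conj V).
  have := BA w; rewrite free_pairing_form ew.
  by rewrite (_ : map_mx _ _ = V) //; apply/matrixP => i j; rewrite !mxE conjCK.
by apply/psdmxP => w; rewrite free_pairing_form.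
Qed.

(** Stability under compression absorbs the test matrices V of [psd_free_pairing]; containing Sep
    supplies the Hermitianity that [free_dual] demands. *)
Lemma free_dual_tdual (F : Defs.family C d) :
  compress_closed F -> (forall s, Sep C d s `<=` F s) ->
  eq_family (free_dual F) (tdual F).
Proof.
move=> cF SF s s0; apply/seteqP; split=> A /=.
  move=> [_ hA] B FB; have /psd_free_pairing/(_ 1%:M) := hA s B s0 FB.
  by rewrite compress1.
move=> hA; split; last first.
  by move=> t B t0 FB; apply/psd_free_pairing => V; exact/hA/cF.
by apply: Bpsd_herm; rewrite -tdual_Sep; apply: tdualS hA; exact: SF.
Qed.

Lemma operator_system_eq (F G : Defs.family C d) :
  eq_family F G -> operator_system F -> operator_system G.
Proof.
move=> FG [u [h1 h2 h3 h4 h5 h6 h7]]; exists u; split.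
- by move=> s A s0; rewrite -FG //; exact: h1.
- by move=> s s0; rewrite -FG //; exact: h2.
- by move=> s s0; rewrite -FG //; exact: h3.
- by move=> s A s0; rewrite -FG //; exact: h4.
- by move=> s t V A s0 t0; rewrite -!FG //; exact: h5.
- by rewrite -FG.
- by move=> s s0; rewrite -FG //; exact: h7.
Qed.

(** The source of all operator systems below. An intersection of half-spaces is closed and convex,
    and inclusion in Bpsd gives Hermitianity and salience; only the order unit depends on L. *)
Lemma operator_system_tdual (L : Defs.family C d) :
  compress_closed L -> (forall s, Sep C d s `<=` L s) ->
  (forall s (A : 'M[C]_(d * s)), A \is hermsymmx ->
     exists2 r : C, 0 < r & tdual L s (r *: 1%:M + A)) ->
  operator_system (tdual L).
Proof.
move=> cL SL oL.
have LB s : tdual L s `<=` Bpsd C d s by rewrite -tdual_Sep; exact: tdualS.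
have coneL s : convex_cone (tdual L s).
  split=> [B _|A B hA hB X LX|r A r0 hA X LX].
  - by rewrite mulmx0 mxtrace0.
  - by rewrite mulmxDr mxtraceD addr_ge0 ?hA ?hB.
  - by rewrite -scalemxAr mxtraceZ mulr_ge0 ?hA.
exists 1%:M; split.
- by move=> s A _ /LB; exact: Bpsd_herm.
- by move=> s _; exact: coneL.
- move=> s _; rewrite (_ : tdual L s =
    \bigcap_(B in L s) [set A | 0 <= \tr (B *m A)]) //.
  by apply: closed_bigI => B _; exact: closed_halfspace.
- move=> s A _ /LB h1 /LB h2; apply: qform_prod_eq0 => x y.
  apply/eqP; rewrite eq_le h1 andbT.
  by have := h2 x y; rewrite qformN oppr_ge0.
- by move=> s t V A _ _; exact: tdual_compress_closed.
(* The order unit property at A = 0 puts a positive multiple of the identity in the cone. *)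
- rewrite tensmx11; have [|r r0 /=] := oL 1%N 0.
    by apply/hermsymmxP; rewrite adjmx0.
  rewrite addr0 => h; have [_ _ hZ] := coneL 1%N.
  have := hZ r^-1 _ _ h; rewrite scalerA mulVf ?gt_eqF // scale1r; apply.
  by rewrite invr_ge0 ltW.
- by move=> s _ A hA; rewrite tensmx11; exact: oL.
Qed.

End Duality.

Arguments tdual {C d} F s _.

(** * The bipolar theorem *)

Section Bipolar.
Variable R : realType.
Local Notation C := (R[i]%C).

(** Continuity is kept in R, where compactness of boxes and the extreme value theorem apply. *)
Definition continuous_ReIm (T : topologicalType) (f : T -> C) : Prop :=
  continuous (fun x => complex.Re (f x)) /\ continuous (fun x => complex.Im (f x)).

Lemma continuous_ReIm_cst (T : topologicalType) (c : C) :
  continuous_ReIm (fun _ : T => c).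
Proof. by split=> x; exact: cvg_cst. Qed.

Lemma continuous_ReImD (T : topologicalType) (f g : T -> C) :
  continuous_ReIm f -> continuous_ReIm g -> continuous_ReIm (fun x => f x + g x).
Proof.
move=> [f1 f2] [g1 g2]; split=> x.
  have -> : (fun x => complex.Re (f x + g x)) =
      (fun x => complex.Re (f x) + complex.Re (g x)).
    by apply/funext => y; case: (f y) (g y) => [a b] [c e].
  by apply: cvgD; [exact: f1|exact: g1].
have -> : (fun x => complex.Im (f x + g x)) =
    (fun x => complex.Im (f x) + complex.Im (g x)).
  by apply/funext => y; case: (f y) (g y) => [a b] [c e].
by apply: cvgD; [exact: f2|exact: g2].
Qed.

Lemma continuous_ReImM (T : topologicalType) (f g : T -> C) :
  continuous_ReIm f -> continuous_ReIm g -> continuous_ReIm (fun x => f x * g x).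
Proof.
move=> [f1 f2] [g1 g2]; split=> x.
  have -> : (fun x => complex.Re (f x * g x)) = (fun x =>
      complex.Re (f x) * complex.Re (g x) - complex.Im (f x) * complex.Im (g x)).
    by apply/funext => y; case: (f y) (g y) => [a b] [c e].
  by apply: cvgB; apply: cvgM; [exact: f1|exact: g1|exact: f2|exact: g2].
have -> : (fun x => complex.Im (f x * g x)) = (fun x =>
    complex.Re (f x) * complex.Im (g x) + complex.Im (f x) * complex.Re (g x)).
  by apply/funext => y; case: (f y) (g y) => [a b] [c e].
by apply: cvgD; apply: cvgM; [exact: f1|exact: g2|exact: f2|exact: g1].
Qed.

Lemma continuous_ReIm_conj (T : topologicalType) (f : T -> C) :
  continuous_ReIm f -> continuous_ReIm (fun x => (f x)^*).
Proof.
move=> [f1 f2]; split=> x.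
  have -> : (fun x => complex.Re (f x)^*) = (fun x => complex.Re (f x)).
    by apply/funext => y; case: (f y) => a b.
  exact: f1.
have -> : (fun x => complex.Im (f x)^*) = (fun x => - complex.Im (f x)).
  by apply/funext => y; case: (f y) => a b.
by apply: cvgN; exact: f2.
Qed.

Lemma continuous_ReIm_sum (T : topologicalType) I (r : seq I) (F : I -> T -> C) :
  (forall i, continuous_ReIm (F i)) ->
  continuous_ReIm (fun x => \sum_(i <- r) F i x).
Proof.
move=> Fc; elim: r => [|i r IHr].
  have -> : (fun x => \sum_(i <- [::]) F i x) = (fun=> 0).
    by apply/funext => x; rewrite big_nil.
  exact: continuous_ReIm_cst.
have -> : (fun x => \sum_(j <- i :: r) F j x) =
    (fun x => F i x + \sum_(j <- r) F j x).
  by apply/funext => x; rewrite big_cons.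
exact: continuous_ReImD.
Qed.

Definition continuous_entries (T : topologicalType) m n (P : T -> 'M[C]_(m, n)) :=
  forall i j, continuous_ReIm (fun x => P x i j).

Lemma continuous_entriesM (T : topologicalType) m n p (P : T -> 'M[C]_(m, n))
    (Q : T -> 'M[C]_(n, p)) :
  continuous_entries P -> continuous_entries Q ->
  continuous_entries (fun x => P x *m Q x).
Proof.
move=> Pc Qc i j.
have -> : (fun x => (P x *m Q x) i j) = (fun x => \sum_k P x i k * Q x k j).
  by apply/funext => x; rewrite mxE.
by apply: continuous_ReIm_sum => k; exact: continuous_ReImM.
Qed.

Lemma continuous_entriesD (T : topologicalType) m n (P Q : T -> 'M[C]_(m, n)) :
  continuous_entries P -> continuous_entries Q ->
  continuous_entries (fun x => P x + Q x).
Proof.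
move=> Pc Qc i j.
have -> : (fun x => (P x + Q x) i j) = (fun x => P x i j + Q x i j).
  by apply/funext => x; rewrite mxE.
exact: continuous_ReImD.
Qed.

Lemma continuous_entries_adj (T : topologicalType) m n (P : T -> 'M[C]_(m, n)) :
  continuous_entries P -> continuous_entries (fun x => (P x)^t*).
Proof.
move=> Pc i j.
have -> : (fun x => (P x)^t* i j) = (fun x => (P x j i)^*).
  by apply/funext => x; rewrite !mxE.
exact: continuous_ReIm_conj.
Qed.

Lemma continuous_entries_sum (T : topologicalType) I (r : seq I) m n
    (P : I -> T -> 'M[C]_(m, n)) :
  (forall k, continuous_entries (P k)) ->
  continuous_entries (fun x => \sum_(k <- r) P k x).
Proof.
move=> Pc i j.
have -> : (fun x => (\sum_(k <- r) P k x) i j) = (fun x => \sum_(k <- r) P k x i j).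
  by apply/funext => x; rewrite summxE.
by apply: continuous_ReIm_sum => k; exact: Pc.
Qed.

(** On Hermitian matrices, [rtr (A *m B)] is the real inner product of the nearest point
    argument. *)
Definition rtr m (A : 'M[C]_m) : R := complex.Re (\tr A).

Lemma rtrD m (A B : 'M[C]_m) : rtr (A + B) = rtr A + rtr B.
Proof. by rewrite /rtr mxtraceD; case: (\tr A) (\tr B) => [a b] [c e]. Qed.

Lemma rtrN m (A : 'M[C]_m) : rtr (- A) = - rtr A.
Proof.
by rewrite /rtr (_ : \tr (- A) = - \tr A) ?linearN //; case: (\tr A).
Qed.

Lemma rtrZ m (a : R) (A : 'M[C]_m) : rtr ((a%:C)%C *: A) = a * rtr A.
Proof. by rewrite /rtr mxtraceZ; case: (\tr A) => [b c] /=; rewrite mul0r subr0. Qed.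

Lemma rtr_mulC m (A B : 'M[C]_m) : rtr (A *m B) = rtr (B *m A).
Proof. by rewrite /rtr mxtrace_mulC. Qed.

Lemma rtr_ge0 m (A : 'M[C]_m) : 0 <= \tr A -> 0 <= rtr A.
Proof. by rewrite /rtr lecE => /andP[]. Qed.

Lemma herm_tr_real m (A B : 'M[C]_m) : A \is hermsymmx -> B \is hermsymmx ->
  \tr (A *m B) \is Num.real.
Proof.
move=> /hermsymmxP hA /hermsymmxP hB; apply/CrealP.
have -> : (\tr (A *m B))^* = \tr ((A *m B)^t*).
  by rewrite trace_map_mx mxtrace_tr.
by rewrite adjmxM hA hB mxtrace_mulC.
Qed.

Lemma herm_tr_ge0 m (A B : 'M[C]_m) : A \is hermsymmx -> B \is hermsymmx ->
  (0 <= \tr (A *m B)) = (0 <= rtr (A *m B)).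
Proof.
by move=> hA hB; rewrite -[\tr _]RRe_real ?herm_tr_real // ler0c.
Qed.

Lemma rtr_sqr_ge0 m (A : 'M[C]_m) : A \is hermsymmx -> 0 <= rtr (A *m A).
Proof.
move=> /hermsymmxP hA; apply: rtr_ge0; rewrite -{1}hA.
by apply: mxtrace_psd; exact: psdmx_gram.
Qed.

Lemma rtr_sqr_eq0 m (A : 'M[C]_m) :
  A \is hermsymmx -> rtr (A *m A) <= 0 -> A = 0.
Proof.
move=> hA A0.
have {A0} : \tr (A *m A) = 0.
  rewrite -[\tr _]RRe_real ?herm_tr_real //.
  by rewrite -/(rtr _) (_ : rtr _ = 0) //; apply/eqP; rewrite eq_le A0 rtr_sqr_ge0.
have sE : \tr (A *m A) = \sum_i \sum_j `|A i j| ^+ 2.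
  rewrite /mxtrace; apply: eq_bigr => i _; rewrite mxE; apply: eq_bigr => j _.
  by rewrite normCK -{2}(hermsymmxP _ hA) adjmxE.
rewrite sE => /eqP; rewrite psumr_eq0; last first.
  by move=> i _; apply: sumr_ge0 => j _; rewrite exprn_ge0.
move=> /allP A0; apply/matrixP => i j; rewrite mxE.
have := A0 i (mem_index_enum _); rewrite /= psumr_eq0; last first.
  by move=> k _; rewrite exprn_ge0.
move=> /allP/(_ j (mem_index_enum _)) /=.
by rewrite expf_eq0 /= normr_eq0 => /eqP.
Qed.

Lemma hermsymmxD m (A B : 'M[C]_m) :
  A \is hermsymmx -> B \is hermsymmx -> A + B \is hermsymmx.
Proof.
by move=> /hermsymmxP hA /hermsymmxP hB; apply/hermsymmxP; rewrite adjmxD hA hB.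
Qed.

Lemma hermsymmxN m (A : 'M[C]_m) : A \is hermsymmx -> - A \is hermsymmx.
Proof. by move=> /hermsymmxP hA; apply/hermsymmxP; rewrite adjmxN hA. Qed.

Lemma hermsymmxZ m (a : R) (A : 'M[C]_m) :
  A \is hermsymmx -> (a%:C)%C *: A \is hermsymmx.
Proof.
move=> /hermsymmxP hA; apply/hermsymmxP; rewrite adjmxZ hA.
by congr (_ *: _); exact: conjc_real.
Qed.

(* Cauchy-Schwarz against the identity matrix. *)
Lemma sqr_rtr_le m (A : 'M[C]_m) : A \is hermsymmx ->
  rtr A ^+ 2 <= m%:R * rtr (A *m A).
Proof.
move=> hA; case: m A hA => [|m] A hA.
  by rewrite /rtr /mxtrace !big_ord0 /= expr0n mul0r.
set N := m.+1; have h1 : (1%:M : 'M[C]_N) \is hermsymmx.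
  by apply/hermsymmxP; rewrite adjmx1.
(* This is N times the part of A orthogonal to the identity; its squared norm is N (N tr A^2 - (tr
   A)^2). *)
have hD : ((N%:R : R)%:C)%C *: A - ((rtr A)%:C)%C *: 1%:M \is hermsymmx.
  by rewrite hermsymmxD ?hermsymmxN ?hermsymmxZ.
have := rtr_sqr_ge0 hD; rewrite mulmxBl !mulmxBr.
rewrite -!scalemxAl -!scalemxAr !mulmx1 !mul1mx.
rewrite !(rtrD, rtrN, rtrZ).
have -> : rtr (1%:M : 'M[C]_N) = N%:R.
  by rewrite /rtr mxtrace1 -[N%:R in LHS](rmorph_nat (real_complex R)).
have N0 : 0 < N%:R :> R by rewrite ltr0n.
move: (rtr A) (rtr (A *m A)) N0 => x y; move: (N%:R : R) => n n0 h.
rewrite -subr_ge0 -(pmulr_rge0 _ n0); apply: le_trans h _.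
by rewrite le_eqVlt; apply/orP; left; apply/eqP; ring.
Qed.

(** The first-order condition at a minimum: x is the gain to first order along a direction, t^2 y
    the second-order loss. *)
Lemma quadratic_min_le0 (x y t0 : R) : 0 < t0 -> 0 <= y ->
  (forall t, 0 < t -> t <= t0 -> 2 * t * x <= t ^+ 2 * y) -> x <= 0.
Proof.
move=> t00 y0 h; rewrite leNgt; apply/negP => x0.
(* For this t one has t y < x, against 2 x <= t y. *)
pose t := Num.min t0 (x / (y + 1)).
have y1 : 0 < y + 1 by lra.
have tp : 0 < t by rewrite lt_min t00 divr_gt0.
have tt0 : t <= t0 by rewrite ge_min lexx.
have tx : t * (y + 1) <= x by rewrite -ler_pdivlMr // ge_min lexx orbT.
have := h t tp tt0; have tx0 : 0 < t * x by rewrite mulr_gt0.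
have : t * (t * (y + 1)) <= t * x by rewrite ler_pM2l.
have : 0 <= t * t by rewrite mulr_ge0 // ltW.
by move=> h1 h2 h3; nra.
Qed.

(* The nearest point argument: [P] parametrizes the cone [K] in such a way that
   the part of [K] of bounded trace is reached from a compact box. *)
Lemma bipolar (I : eqType) m (K : set 'M[C]_m) (P : (I -> R) -> 'M[C]_m) X :
  continuous_entries (P : prod_topology (fun _ : I => R) -> 'M[C]_m) ->
  convex_cone K -> (forall A, K A -> A \is hermsymmx /\ 0 <= \tr A) ->
  (forall f, K (P f)) ->
  (forall b : R, exists M : R, forall A, K A -> rtr A <= b ->
    exists2 f, (forall i, `|f i| <= M) & P f = A) ->
  X \is hermsymmx ->
  (forall Z, Z \is hermsymmx -> (forall A, K A -> 0 <= \tr (Z *m A)) ->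
    0 <= \tr (Z *m X)) ->
  K X.
Proof.
move=> Pc [K0 KD KZ] Kh KP Kb hX dX.
pose c := rtr (X *m X); have c0 : 0 <= c by exact: rtr_sqr_ge0.
(* The nearest point has squared norm at most 4 c, hence squared trace at most b - 1 by
   Cauchy-Schwarz. Its trace is thus strictly below b, which leaves room to move away from it. *)
pose b := 4 * m%:R * c + 1.
have b1 : 1 <= b by rewrite lerDr mulr_ge0 ?mulr_ge0.
have [M hM] := Kb b.
pose T := prod_topology (fun _ : I => R).
pose g (f : T) : R := rtr ((X - P f) *m (X - P f)).
pose box : set T := [set f | forall i, `[- M, M]%classic (f i)].
have boxE (f : T) : box f <-> forall i, `|f i| <= M.
  by split=> h i; have := h i; rewrite /= in_itv /= -ler_norml.
have gc : continuous g.
  have h : continuous_entries (fun f : T => (X - P f) *m (X - P f)).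
    have h' : continuous_entries (fun f : T => X - P f).
      move=> i j; have -> : (fun f : T => (X - P f) i j) =
          (fun f => X i j + (-1) * P f i j).
        by apply/funext => f; rewrite !mxE mulN1r.
      apply: continuous_ReImD; first exact: continuous_ReIm_cst.
      by apply: continuous_ReImM; [exact: continuous_ReIm_cst|exact: Pc].
    exact: continuous_entriesM.
  have [] : continuous_ReIm (fun f : T => \tr ((X - P f) *m (X - P f))).
    by apply: continuous_ReIm_sum => i; exact: h.
  by [].
have tr0b : rtr (0 : 'M[C]_m) <= b by rewrite /rtr mxtrace0 /=; lra.
have [f1 f1M P1] := hM 0 K0 tr0b.
have box0 : box !=set0 by exists f1; apply/boxE.
have boxc : compact box.
  exact: (@tychonoff I (fun=> R) (fun=> `[- M, M]%classic)
    (fun=> @segment_compact R (- M) M)).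
have [f0 _ f0min] := compact_EVT_min box0 boxc (continuous_subspaceT gc).
set P0 := P f0 in f0min.
have K00 : K P0 by exact: KP.
have [hP0 tP0] := Kh _ K00.
have hD : X - P0 \is hermsymmx by rewrite hermsymmxD ?hermsymmxN.
have minP A : K A -> rtr A <= b -> rtr ((X - P0) *m (X - P0)) <=
    rtr ((X - A) *m (X - A)).
  move=> KA /(hM _ KA)[f fM <-]; apply: f0min.
  by rewrite inE; apply/boxE.
have sqE (A B : 'M[C]_m) (t : R) : rtr ((A - (t%:C)%C *: B) *m (A - (t%:C)%C *: B)) =
    rtr (A *m A) - 2 * t * rtr (A *m B) + t ^+ 2 * rtr (B *m B).
  rewrite mulmxBl !mulmxBr -!scalemxAl -!scalemxAr !(rtrD, rtrN, rtrZ).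
  by rewrite (rtr_mulC B A); ring.
(* P0 is at least as close to X as 0 is, so |P0| <= 2 |X|; the expansion of |X - P0 / 2|^2 >= 0
   replaces the triangle inequality. *)
have tP0b : rtr P0 < b.
  have h1 : rtr ((X - P0) *m (X - P0)) <= c.
    by have := minP 0 K0 tr0b; rewrite subr0.
  have := sqE X P0 1; rewrite rmorph1 scale1r => h2.
  have h3 := sqE X P0 (2^-1); rewrite -/c in h2 h3.
  have hH : X - ((2^-1 : R)%:C)%C *: P0 \is hermsymmx.
    by rewrite hermsymmxD ?hermsymmxN ?hermsymmxZ.
  have := rtr_sqr_ge0 hH; rewrite h3 => h4.
  have h5 := sqr_rtr_le hP0; have h6 := rtr_ge0 tP0.
  have h7 : rtr (P0 *m P0) <= 4 * c by lra.
  have h8 : rtr P0 ^+ 2 <= b - 1.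
    apply: le_trans h5 _; rewrite /b addrK.
    have : 0 <= m%:R :> R by [].
    by move: (m%:R : R) => n n0; nra.
  by rewrite ltNge; apply/negP; move: h8 b1; move: (rtr P0) (b) => v w; clear; nra.
(* Minimality against P0 + t A, with t small enough for the trace to stay below b. *)
have dir A : K A -> rtr ((X - P0) *m A) <= 0.
  move=> KA; have [hA tA] := Kh _ KA; have tA' := rtr_ge0 tA.
  apply: (@quadratic_min_le0 _ (rtr (A *m A)) ((b - rtr P0) / (rtr A + 1))).
  - by rewrite divr_gt0 ?subr_gt0 //; lra.
  - exact: rtr_sqr_ge0.
  move=> t tp; rewrite ler_pdivlMr; last by lra.
  move=> tb; have KA' : K (P0 + (t%:C)%C *: A).
    by apply: KD => //; apply: KZ => //; rewrite ler0c ltW.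
  have := minP _ KA'; rewrite rtrD rtrZ opprD addrA sqE.
  have h : rtr P0 + t * rtr A <= b.
    by move: tb tA' tp; move: (rtr A) (rtr P0) => v w; clear; nra.
  by move=> /(_ h); lra.
have dirP : 0 <= rtr ((X - P0) *m P0).
  rewrite -oppr_le0; apply: (@quadratic_min_le0 _ (rtr (P0 *m P0)) 1).
  - exact: ltr01.
  - exact: rtr_sqr_ge0.
  move=> t tp t1; have KA' : K (((1 - t)%:C)%C *: P0).
    by apply: KZ => //; rewrite ler0c subr_ge0.
  have := minP _ KA'; rewrite rtrZ.
  have -> : X - ((1 - t)%:C)%C *: P0 = X - P0 - ((- t)%:C)%C *: P0.
    rewrite rmorphB rmorph1 rmorphN scalerBl scale1r scaleNr opprB opprK.
    by rewrite addrA addrAC.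
  have h : (1 - t) * rtr P0 <= b.
    by have := rtr_ge0 tP0; move: tP0b tp t1; move: (rtr P0) => v; clear; nra.
  by rewrite sqE => /(_ h); rewrite sqrrN; lra.
have hND : - (X - P0) \is hermsymmx by rewrite hermsymmxN.
(* By [dir], P0 - X is in the dual cone. The resulting sign of the product of X - P0 with X,
   together with [dirP], gives |X - P0|^2 <= 0. *)
have : 0 <= \tr (- (X - P0) *m X).
  apply: dX => // A KA; have [hA _] := Kh _ KA.
  by rewrite herm_tr_ge0 // mulNmx rtrN oppr_ge0 dir.
rewrite herm_tr_ge0 // mulNmx rtrN oppr_ge0 => h.
have D0 : X - P0 = 0.
  apply: rtr_sqr_eq0 => //; rewrite mulmxBr rtrD rtrN.
  by lra.
by move/eqP: D0; rewrite subr_eq0 => /eqP ->.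
Qed.

End Bipolar.

(** * Closedness of the separable and decomposable cones *)

Section ClosedCones.
Variable R : realType.
Local Notation C := (R[i]%C).

(* Taking adjoints in a complex dependency gives a real one. *)
Lemma herm_real_dependency n m (S : 'I_n -> 'M[C]_m) :
  (forall i, S i \is hermsymmx) -> (m * m < n)%N ->
  exists b : 'I_n -> R,
    (exists i, 0 < b i) /\ \sum_i ((b i)%:C)%C *: S i = 0.
Proof.
move=> hS mn; pose M := \matrix_(i < n) mxvec (S i).
have : kermx M != 0.
  rewrite -mxrank_eq0 mxrank_ker -lt0n subn_gt0.
  exact: leq_ltn_trans (rank_leq_col M) mn.
case/rowV0Pn => u /sub_kermxP uM u0.
have uS : \sum_i u 0 i *: S i = 0.
  apply: (can_inj mxvecK); rewrite linear_sum linear0 -[RHS]uM.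
  rewrite [in RHS]mulmx_sum_row.
  by apply: eq_bigr => i _; rewrite linearZ rowK.
have uS' : \sum_i (u 0 i)^* *: S i = 0.
  have := congr1 (fun A : 'M[C]_m => A^t*) uS; rewrite adjmx_sum adjmx0.
  apply: etrans.
  by apply: eq_bigr => i _; rewrite adjmxZ (hermsymmxP _ (hS i)).
suff [b [[i bi] bS]] : exists b : 'I_n -> R,
    (exists i, b i != 0) /\ \sum_i ((b i)%:C)%C *: S i = 0.
  have [bi0|bi0] := ltP 0 (b i); first by exists b; split=> //; exists i.
  exists (fun i => - b i); split.
    by exists i; rewrite oppr_gt0 lt_neqAle bi.
  under eq_bigr do rewrite rmorphN scaleNr.
  by rewrite sumrN bS oppr0.
have uRe : \sum_i ((complex.Re (u 0 i))%:C)%C *: S i = 0.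
  transitivity (2^-1 *: (\sum_i u 0 i *: S i + \sum_i (u 0 i)^* *: S i));
    last by rewrite uS uS' addr0 scaler0.
  rewrite -big_split scaler_sumr /=; apply: eq_bigr => i _.
  by rewrite -scalerDl scalerA [2^-1 * _]mulrC -ReJ_add.
have uIm : \sum_i ((complex.Im (u 0 i))%:C)%C *: S i = 0.
  transitivity ((2^-1 * 'i%C) *:
    (\sum_i (u 0 i)^* *: S i - \sum_i u 0 i *: S i));
    last by rewrite uS uS' subrr scaler0.
  rewrite -sumrB scaler_sumr /=; apply: eq_bigr => i _.
  by rewrite -scalerBl scalerA mulrAC [2^-1 * _]mulrC -ImJ_sub.
have [i ui] : exists i, u 0 i != 0.
  apply/existsP; apply: contraNT u0; rewrite negb_exists => /forallP h.
  by apply/eqP/rowP => i; rewrite mxE; apply/eqP; have := h i; rewrite negbK.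
have [r0|r0] := eqVneq (complex.Re (u 0 i)) 0; last first.
  by exists (fun i => complex.Re (u 0 i)); split=> //; exists i.
exists (fun i => complex.Im (u 0 i)); split=> //; exists i.
by apply: contraNneq ui => i0; rewrite [u 0 i]complexE r0 i0 mulr0 addr0.
Qed.

Variable d : nat.

(* Carathéodory: a representation with the least number of terms has linearly
   independent terms. *)
Lemma Sep_bounded_sum s (X : 'M[C]_(d * s)) : Sep C d s X ->
  exists2 r, (size r <= (d * s) * (d * s))%N & X = sep_sum r.
Proof.
move=> /SepP[r0 X0].
pose Q n := `[< exists2 r, size r = n & X = @sep_sum C d s r >].
have exQ : exists n, Q n by exists (size r0); apply/asboolP; exists r0.
case: (ex_minnP exQ) => n /asboolP[r rn Xr] nmin.
exists r => //; rewrite rn leqNgt; apply/negP => ltn.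
pose p (i : 'I_n) := nth (0, 0) r i.
pose S (i : 'I_n) := ((p i).1 *t (p i).2) *m ((p i).1 *t (p i).2)^t*.
have XS : X = \sum_i S i by rewrite Xr /sep_sum (big_nth (0, 0)) big_mkord rn.
have hS i : S i \is hermsymmx by case: (psdmx_rank1 ((p i).1 *t (p i).2)).
have [b [[i bi] bS]] := herm_real_dependency hS ltn.
(* Subtracting 1 / b_j times the dependency, for the largest b_j, keeps all coefficients nonnegative
   and kills the j-th. *)
pose j := [arg max_(j > i) b j]%O.
have jmax k : b k <= b j.
  by rewrite /j; case: arg_maxP => // j0 _ h; exact: h.
have bj : 0 < b j by exact: lt_le_trans bi (jmax i).
pose t k := 1 - b k / b j.
have t0 k : 0 <= t k by rewrite subr_ge0 ler_pdivrMr // mul1r.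
have Xt : X = \sum_k ((t k)%:C)%C *: S k.
  have -> : \sum_k ((t k)%:C)%C *: S k =
      \sum_k S k - (((b j)^-1)%:C)%C *: \sum_k ((b k)%:C)%C *: S k.
    rewrite scaler_sumr -sumrB; apply: eq_bigr => k _.
    rewrite scalerA -rmorphM mulrC -[X in _ = X - _]scale1r -scalerBl.
    by rewrite /t rmorphB rmorph1.
  by rewrite bS scaler0 subr0.
have tj : t j = 0 by rewrite /t divff ?subrr // gt_eqF.
(* The coefficient is absorbed into the first factor. *)
pose q k := (sqrtC ((t k)%:C)%C *: (p k).1, (p k).2).
have Xq : X = sep_sum [seq q k | k <- enum 'I_n & k != j].
  rewrite Xt (bigD1 j) //= tj scale0r add0r /sep_sum big_map big_filter.
  rewrite big_enum_cond /=; apply: eq_bigr => k _.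
  rewrite /S !mulmx_tens_adj /q /= adjmxZ -scalemxAl -scalemxAr scalerA tensmxZl.
  by rewrite geC0_conj ?sqrtC_ge0 ?ler0c // -expr2 sqrtCK.
have : (n <= n.-1)%N.
  apply: nmin; apply/asboolP; eexists; last exact: Xq.
  rewrite size_map size_filter.
  have := count_predC (pred1 j) (enum 'I_n).
  rewrite count_uniq_mem ?enum_uniq // mem_enum size_enum_ord /= => e.
  exact: (congr1 predn e).
by move: ltn; case: (n) => // m _; rewrite ltnn.
Qed.

Definition sqnorm n (x : 'cV[C]_n) : R := complex.Re (\tr (x *m x^t*)).

Lemma sqnormE n (x : 'cV[C]_n) : ((sqnorm x)%:C)%C = \tr (x *m x^t*).
Proof. by rewrite RRe_real // ger0_real // mxtrace_psd //; exact: psdmx_rank1. Qed.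

(** The bound b + 1 avoids a square root: x^2 <= b implies |x| <= b + 1. *)
Lemma entry_le_trace m n (G : 'M[C]_(m, n)) (b : R) i j :
  \tr (G *m G^t*) <= (b%:C)%C ->
  `|complex.Re (G i j)| <= b + 1 /\ `|complex.Im (G i j)| <= b + 1.
Proof.
rewrite mxtrace_cogram (bigD1 i) //= (bigD1 j) //= => hb.
have {hb} : `|G i j| ^+ 2 <= (b%:C)%C.
  apply: le_trans hb; rewrite -addrA lerDl addr_ge0 //.
    by apply: sumr_ge0 => k _; rewrite exprn_ge0.
  by apply: sumr_ge0 => k _; apply: sumr_ge0 => l _; rewrite exprn_ge0.
rewrite -add_Re2_Im2 lecR; move: (complex.Re _) (complex.Im _) => x y h.
have b0 : 0 <= b by apply: le_trans h; rewrite addr_ge0 ?sqr_ge0.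
by split; rewrite ler_norml; apply/andP; split; nra.
Qed.

Lemma sqnorm_eq0 n (x : 'cV[C]_n) : sqnorm x = 0 -> x = 0.
Proof.
move=> x0; have : \tr (x *m x^t*) = 0 by rewrite -sqnormE x0.
rewrite mxtrace_cogram => /eqP; rewrite psumr_eq0; last first.
  by move=> i _; apply: sumr_ge0 => j _; rewrite exprn_ge0.
move=> /allP h; apply/matrixP => i j; rewrite mxE (ord1 j).
have := h i (mem_index_enum _); rewrite /= big_ord1.
by rewrite expf_eq0 /= normr_eq0 => /eqP.
Qed.

Lemma sqnorm_ge0 n (x : 'cV[C]_n) : 0 <= sqnorm x.
Proof. by rewrite -ler0c sqnormE mxtrace_psd //; exact: psdmx_rank1. Qed.

(** A product projection does not bound its two factors separately. Moving the norm of y into x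
    makes both bounded in terms of the trace, as a compact parameter box requires. *)
Lemma rank1_normalize s (x : 'cV[C]_d) (y : 'cV[C]_s) :
  exists (x' : 'cV[C]_d) (y' : 'cV[C]_s),
    [/\ (x' *t y') *m (x' *t y')^t* = (x *t y) *m (x *t y)^t*,
        \tr (y' *m y'^t*) <= 1
      & \tr (x' *m x'^t*) = \tr ((x *t y) *m (x *t y)^t*)].
Proof.
rewrite !mulmx_tens_adj mxtrace_tens -!sqnormE.
have [y0|y0] := eqVneq (sqnorm y) 0.
  exists 0, 0; rewrite mulmx_tens_adj (sqnorm_eq0 y0) !mul0mx mxtrace0 !tensmx0.
  have -> : sqnorm (0 : 'cV[C]_s) = 0 by rewrite /sqnorm mul0mx mxtrace0.
  by rewrite rmorph0 mulr0 mxtrace0.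
have yp : 0 < sqnorm y by rewrite lt_neqAle eq_sym y0 sqnorm_ge0.
pose a : C := sqrtC ((sqnorm y)%:C)%C.
have a0 : 0 <= a by rewrite sqrtC_ge0 ler0c sqnorm_ge0.
have aa : a * a = ((sqnorm y)%:C)%C by rewrite -expr2 sqrtCK.
have an0 : a != 0 by rewrite sqrtC_eq0 (fmorph_eq0 (real_complex R)).
have xE : (a *: x) *m (a *: x)^t* = ((sqnorm y)%:C)%C *: (x *m x^t*).
  by rewrite adjmxZ -scalemxAl -scalemxAr scalerA geC0_conj // aa.
have yE : (a^-1 *: y) *m (a^-1 *: y)^t* = (((sqnorm y)%:C)%C)^-1 *: (y *m y^t*).
  by rewrite adjmxZ -scalemxAl -scalemxAr scalerA geC0_conj ?invr_ge0 // -invfM aa.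
have sy0 : ((sqnorm y)%:C)%C != 0 by rewrite (fmorph_eq0 (real_complex R)).
exists (a *: x), (a^-1 *: y); rewrite mulmx_tens_adj xE yE; split.
- by rewrite tensmxZl tensmxZr scalerA divff // scale1r.
- by rewrite mxtraceZ -sqnormE mulVf.
- by rewrite mxtraceZ -sqnormE mulrC.
Qed.

(** A complex parameter is stored as two real ones, so that the parameter space is a power of R. *)
Definition pair_complex (I : Type) (f : I * bool -> R) (k : I) : C :=
  Complex (f (k, true)) (f (k, false)).

Definition ReIm (I : Type) (w : I -> C) (k : I * bool) : R :=
  if k.2 then complex.Re (w k.1) else complex.Im (w k.1).

Lemma continuous_pair_complex (I : eqType) (k : I) :
  continuous_ReIm (fun f : prod_topology (fun _ : I * bool => R) =>
    pair_complex f k).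
Proof.
split=> f.
  exact: (@proj_continuous _ (fun _ : (I * bool)%type => R) (k, true) f).
exact: (@proj_continuous _ (fun _ : (I * bool)%type => R) (k, false) f).
Qed.

(** Carathéodory fixes the number N of product vectors and [rank1_normalize] bounds them, so the
    separable matrices of bounded trace come from a compact box. *)
Lemma tdual_Bpsd s : tdual (Bpsd C d) s = Sep C d s.
Proof.
apply/seteqP; split=> X /= hX; last first.
  by move=> B; rewrite -tdual_Sep mxtrace_mulC; exact.
pose N := ((d * s) * (d * s))%N.
pose I := ('I_N * ('I_d + 'I_s))%type.
pose x (f : I * bool -> R) (n : 'I_N) : 'cV[C]_d :=
  \col_i pair_complex f (n, inl i).
pose y (f : I * bool -> R) (n : 'I_N) : 'cV[C]_s :=
  \col_i pair_complex f (n, inr i).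
pose P f := \sum_n (x f n *t y f n) *m (x f n *t y f n)^t*.
have xc n : continuous_entries (fun f : prod_topology (fun _ : I * bool => R) =>
    x f n).
  move=> i j; have -> : (fun f => x f n i j) =
    (fun f => pair_complex f (n, inl i)) by apply/funext => f; rewrite mxE.
  exact: continuous_pair_complex.
have yc n : continuous_entries (fun f : prod_topology (fun _ : I * bool => R) =>
    y f n).
  move=> i j; have -> : (fun f => y f n i j) =
    (fun f => pair_complex f (n, inr i)) by apply/funext => f; rewrite mxE.
  exact: continuous_pair_complex.
have xyc n : continuous_entries (fun f : prod_topology (fun _ : I * bool => R) =>
    x f n *t y f n).
  move=> a b; case: (mxtens_indexP a) => i k; case: (mxtens_indexP b) => j l.
  have -> : (fun f => (x f n *t y f n) (mxtens_index (i, k)) (mxtens_index (j, l)))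
    = (fun f => x f n i j * y f n k l) by apply/funext => f; rewrite tensmxE.
  by apply: continuous_ReImM; [exact: xc|exact: yc].
apply: (@bipolar R (I * bool)%type _ _ P).
- apply: continuous_entries_sum => n; apply: continuous_entriesM => //.
  exact: continuous_entries_adj.
- exact: Sep_cone.
- exact: Sep_herm_trace.
- move=> f; apply/SepP; exists [seq (x f n, y f n) | n <- enum 'I_N].
  by rewrite /sep_sum big_map big_enum.
(* Entries of the first factors are bounded by |b| + 1, those of the normalized second factors by
   2. *)
- move=> b; exists (`|b| + 2) => A SA trA.
  have [r rN Ar] := Sep_bounded_sum SA.
  (* Shorter sums are padded to N terms by the default pair of zero vectors. *)
  pose z (n : nat) := nth (0, 0) r n.
  have Az : A = \sum_(n < N) ((z n).1 *t (z n).2) *m ((z n).1 *t (z n).2)^t*.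
    rewrite Ar /sep_sum (big_nth (0, 0)) big_mkord.
    rewrite (big_ord_widen N (fun n => ((z n).1 *t (z n).2) *m
      ((z n).1 *t (z n).2)^t*)) // [RHS](bigID (fun n : 'I_N => (n < size r)%N)) /=.
    rewrite [X in _ + X]big1 ?addr0 // => n; rewrite -leqNgt => h.
    by rewrite /z nth_default //= tens0mx mul0mx.
  have /choice[x' /choice[y' xy']] := fun n : 'I_N =>
    rank1_normalize (z n).1 (z n).2.
  pose w (k : I) : C := match k with
    (n, inl i) => x' n i 0 | (n, inr i) => y' n i 0 end.
  exists (ReIm w).
    have xb n : \tr (x' n *m (x' n)^t*) <= ((`|b|)%:C)%C.
      have [_ _ ->] := xy' n.
      have hA : \tr A \is Num.real.
        by apply/ger0_real/mxtrace_psd/Sep_sub_Psd.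
      apply: (@le_trans _ _ (\tr A)).
        rewrite [in leRHS]Az raddf_sum (bigD1 n) //= lerDl sumr_ge0 // => k _.
        by apply: mxtrace_psd; exact: psdmx_rank1.
      by rewrite -(RRe_real hA) lecR (le_trans trA) // ler_norm.
    move=> [[n [i|i]] []] /=.
    + by have [h _] := entry_le_trace i 0 (xb n); apply: le_trans h _; lra.
    + by have [_ h] := entry_le_trace i 0 (xb n); apply: le_trans h _; lra.
    + have [_ h _] := xy' n.
      have [{}h _] := entry_le_trace (b := 1) i 0 h.
      by apply: le_trans h _; have := normr_ge0 b; lra.
    + have [_ h _] := xy' n.
      have [_ {}h] := entry_le_trace (b := 1) i 0 h.
      by apply: le_trans h _; have := normr_ge0 b; lra.
  rewrite Az; apply: eq_bigr => n _; have [<- _ _] := xy' n.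
  have -> : x (ReIm w) n = x' n.
    apply/matrixP => i j; rewrite (ord1 j) mxE /pair_complex /ReIm /=.
    by case: (x' n i 0).
  have -> // : y (ReIm w) n = y' n.
  apply/matrixP => i j; rewrite (ord1 j) mxE /pair_complex /ReIm /=.
  by case: (y' n i 0).
- apply: Bpsd_herm; rewrite -tdual_Sep; apply: tdualS hX; exact: Sep_sub_Bpsd.
- move=> Z _ hZ; apply: hX; rewrite -tdual_Sep => B SB.
  by rewrite mxtrace_mulC; exact: hZ.
Qed.

(** The parameters are two Gram factors; partial transposition preserves the trace, so the trace of
    the sum bounds both. *)
Lemma tdual_Dpsd s : tdual (Dpsd C d) s = Decomp C d s.
Proof.
apply/seteqP; split=> X /= hX; last first.
  by move=> B; rewrite -tdual_Decomp mxtrace_mulC; exact.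
pose n := (d * s)%N.
pose I := (bool * ('I_n * 'I_n))%type.
pose G (f : I * bool -> R) (k : bool) : 'M[C]_n :=
  \matrix_(i, j) pair_complex f (k, (i, j)).
pose P f := G f true *m (G f true)^t* + @ptrans C d s (G f false *m (G f false)^t*).
have Gc k : continuous_entries (fun f : prod_topology (fun _ : I * bool => R) =>
    G f k *m (G f k)^t*).
  have h : continuous_entries (fun f : prod_topology (fun _ : I * bool => R) =>
      G f k).
    move=> i j; have -> : (fun f => G f k i j) =
      (fun f => pair_complex f (k, (i, j))) by apply/funext => f; rewrite mxE.
    exact: continuous_pair_complex.
  by apply: continuous_entriesM => //; exact: continuous_entries_adj.
apply: (@bipolar R (I * bool)%type _ _ P).
- apply: continuous_entriesD => // i j.
  have -> : (fun f => ptrans (G f false *m (G f false)^t*) i j) =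
      (fun f => (G f false *m (G f false)^t*)
        (mxtens_index ((mxtens_unindex j).1, (mxtens_unindex i).2))
        (mxtens_index ((mxtens_unindex i).1, (mxtens_unindex j).2))).
    by apply/funext => f; rewrite mxE.
  exact: Gc.
- exact: Decomp_cone.
- exact: Decomp_herm_trace.
- move=> f; exists (G f true *m (G f true)^t*),
    (ptrans (G f false *m (G f false)^t*)).
  split=> //; first exact: psdmx_cogram.
  by apply: PsdG_ptrans; exact: psdmx_cogram.
- move=> b; exists (`|b| + 1) => _ [X1 [Y1 [H1 H2 ->]]] trA.
  have [G1 X1E] := psdmx_factor H1; have [G2 Y1E] := psdmx_factor H2.
  pose w (k : I) : C := if k.1 then G1 k.2.1 k.2.2 else G2 k.2.1 k.2.2.
  have [t1 t2] := (mxtrace_psd H1, mxtrace_psd H2); rewrite mxtrace_ptrans1 in t2.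
  have trb : \tr X1 + \tr Y1 <= ((`|b|)%:C)%C.
    rewrite -mxtraceD -(@RRe_real _ (\tr (X1 + Y1))) ?lecR ?(le_trans trA) ?ler_norm //.
    by rewrite mxtraceD realD // ger0_real.
  exists (ReIm w).
    have b1 : \tr (G1 *m G1^t*) <= ((`|b|)%:C)%C.
      by rewrite -X1E; apply: le_trans trb; rewrite lerDl.
    have b2 : \tr (G2 *m G2^t*) <= ((`|b|)%:C)%C.
      by rewrite -Y1E mxtrace_ptrans1; apply: le_trans trb; rewrite lerDr.
    move=> [[[] [i j]] []] /=.
    + by have [] := entry_le_trace i j b1.
    + by have [] := entry_le_trace i j b1.
    + by have [] := entry_le_trace i j b2.
    + by have [] := entry_le_trace i j b2.
  rewrite X1E -[Y1 in RHS]ptransK Y1E /P.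
  have e k : G (ReIm w) k =
      if k then G1 else G2.
    apply/matrixP => i j; rewrite mxE /pair_complex /ReIm /= /w /=.
    by case: k; [case: (G1 i j)|case: (G2 i j)].
  by rewrite !e.
- apply: Bpsd_herm; rewrite -tdual_Sep; apply: tdualS hX; exact: Sep_sub_Dpsd.
- move=> Z _ hZ; apply: hX; rewrite -tdual_Decomp => B SB.
  by rewrite mxtrace_mulC; exact: hZ.
Qed.

End ClosedCones.

(** * Positive maps near a point of maximal rank *)

Section LocalPositivity.
Variable C : numClosedFieldType.

Definition orthoproj n (p : 'M[C]_n) := p^t* = p /\ p *m p = p.

Lemma diag_mxM n (D E : 'rV[C]_n) :
  diag_mx D *m diag_mx E = diag_mx (\row_i (D 0 i * E 0 i)).
Proof.
rewrite mul_diag_mx; apply/matrixP => i j; rewrite !mxE.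
by case: eqVneq => [->|_]; rewrite ?mulr0n ?mulr0 ?mulr1n.
Qed.

Lemma orthoproj_diag n (U : 'M[C]_n) (P : pred 'I_n) : U *m U^t* = 1%:M ->
  orthoproj (U^t* *m diag_mx (\row_i (P i)%:R) *m U).
Proof.
move=> UU; split.
  rewrite !adjmxM trmxCK mulmxA; congr (_ *m _ *m _).
  rewrite tr_diag_mx map_diag_mx; congr diag_mx; apply/rowP => i.
  by rewrite !mxE; exact: rmorph_nat.
rewrite -!mulmxA [U *m (_ *m _)]mulmxA UU mul1mx [diag_mx _ *m (_ *m U)]mulmxA.
rewrite diag_mxM !mulmxA; congr (_ *m diag_mx _ *m _); apply/rowP => i.
by rewrite !mxE -natrM mulnb andbb.
Qed.

(** Eigenvectors are rescaled by inverse square roots of the nonzero eigenvalues; the others are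
    scaled by 1, which keeps W invertible. *)
Lemma psdmx_congr_proj n (A : 'M[C]_n) : psdmx A ->
  exists (W p : 'M[C]_n),
    [/\ W \in unitmx, orthoproj p & W^t* *m A *m W = p].
Proof.
move=> /psdmx_spectral[U [D [UU UU' D0 ->]]].
pose e : 'rV[C]_n := \row_i (if D 0 i == 0 then 1 else (sqrtC (D 0 i))^-1).
pose f : 'rV[C]_n := \row_i (if D 0 i == 0 then 1 else sqrtC (D 0 i)).
have ec : (diag_mx e)^t* = diag_mx e.
  rewrite tr_diag_mx map_diag_mx; congr diag_mx; apply/rowP => i; rewrite !mxE.
  case: eqP => _; first exact: rmorph1.
  by apply: geC0_conj; rewrite invr_ge0 sqrtC_ge0.
exists (U^t* *m diag_mx e), (diag_mx (\row_i (D 0 i != 0)%:R)); split.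
- have : U^t* *m diag_mx e *m (diag_mx f *m U) = 1%:M.
    rewrite !mulmxA -[U^t* *m _ *m _]mulmxA diag_mxM -[RHS]UU'.
    rewrite (_ : \row_i _ = const_mx 1) ?diag_const_mx ?mulmx1 //.
    apply/rowP => i; rewrite !mxE; case: eqVneq => Di; first by rewrite mulr1.
    by rewrite mulVf // sqrtC_eq0.
  by case/mulmx1_unit.
- have := @orthoproj_diag n 1%:M (fun i => D 0 i != 0).
  by rewrite adjmx1 !mul1mx mulmx1; exact.
rewrite adjmxM trmxCK ec !mulmxA -[diag_mx e *m U *m _]mulmxA UU mulmx1.
rewrite -[diag_mx e *m _ *m U *m _]mulmxA UU mulmx1 !diag_mxM; congr diag_mx.
apply/rowP => i; rewrite !mxE; case: eqVneq => [->|Di]; first by rewrite mulr0 mul0r.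
by rewrite mulrAC -invfM -expr2 sqrtCK mulVf.
Qed.

Lemma range_orthoproj n m (S : 'M[C]_(n, m)) :
  exists (s : 'M[C]_n) (g : 'M[C]_(m, n)),
    [/\ orthoproj s, s *m S = S & s = S *m g].
Proof.
have /psdmx_spectral[U [D [UU UU' D0 SE]]] := psdmx_cogram S.
pose s := U^t* *m diag_mx (\row_i (D 0 i != 0)%:R) *m U.
(* Since 0^-1 = 0, the right factor is the pseudo-inverse of S S^*. *)
pose g := S^t* *m (U^t* *m diag_mx (\row_i (D 0 i)^-1) *m U).
have sP : orthoproj s by exact: orthoproj_diag.
have sD : s *m (S *m S^t*) = S *m S^t*.
  rewrite SE /s !mulmxA -[_ *m U *m U^t*]mulmxA UU mulmx1 -[U^t* *m _ *m _]mulmxA.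
  rewrite diag_mxM; congr (_ *m diag_mx _ *m _); apply/rowP => i; rewrite !mxE.
  by case: eqVneq => [->|_]; rewrite ?mulr0 ?mul1r.
exists s, g; split=> //.
  apply/eqP; rewrite -subr_eq0; apply/eqP/cogram_eq0.
  rewrite adjmxB adjmxM (proj1 sP) mulmxBr mulmxBl -mulmxA.
  rewrite [S *m (S^t* *m s)]mulmxA.
  have h : S *m S^t* *m s = S *m S^t*.
    have := congr1 (fun A : 'M[C]_n => A^t*) sD.
    by rewrite (adjmxM s) (proj1 sP) (adjmxM S) trmxCK.
  by rewrite h sD (mulmxBl (s *m S)) -(mulmxA s) sD !subrr.
rewrite /g mulmxA SE !mulmxA -[_ *m U *m U^t*]mulmxA UU mulmx1.
rewrite -[U^t* *m _ *m _]mulmxA diag_mxM.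
congr (_ *m diag_mx _ *m _); apply/rowP => i; rewrite !mxE.
by case: eqVneq => [->|Di]; rewrite ?mul0r ?divff.
Qed.

(* A nonvanishing minor of N0 is a polynomial in the parameter with value 1 at
   0, so it cannot vanish at infinitely many points. *)
Lemma mxrank_perturb n (N0 N1 N2 : 'M[C]_n) r :
  (forall k : nat, (\rank (N0 + k.+1%:R *: N1 + k.+1%:R ^+ 2 *: N2)%R <= r)%N) ->
  (\rank N0 <= r)%N.
Proof.
move=> Nr; rewrite leqNgt; apply/negP => rN.
have /row_fullP[L LN] : row_full (col_base N0) by rewrite col_base_full.
have /row_freeP[Q NQ] : row_free (row_base N0) by rewrite row_base_free.
have LNQ : L *m N0 *m Q = 1%:M.
  have := congr1 (mulmx L) (mulmx_base N0).
  by rewrite mulmxA LN mul1mx => <-; exact: NQ.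
pose M : 'M[{poly C}]_(\rank N0) := map_mx polyC (L *m N0 *m Q) +
  'X *: map_mx polyC (L *m N1 *m Q) + 'X^2 *: map_mx polyC (L *m N2 *m Q).
have detE a : (\det M).[a] =
    \det (L *m (N0 + a *: N1 + a ^+ 2 *: N2) *m Q).
  rewrite -horner_evalE -det_map_mx; congr (\det _).
  rewrite !mulmxDr !mulmxDl -!scalemxAr -!scalemxAl.
  move: (L *m N0 *m Q) (L *m N1 *m Q) (L *m N2 *m Q) @M => A0 A1 A2 M.
  by apply/matrixP => i j; rewrite !mxE /= /horner_eval !hornerE.
have M0 : \det M != 0.
  apply/eqP => M0; have := detE 0; rewrite M0 horner0 scale0r addr0.
  rewrite expr0n scale0r addr0 LNQ det1 => /eqP.
  by rewrite eq_sym oner_eq0.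
pose rs := [seq k.+1%:R : C | k <- iota 0 (size (\det M))].
have rsu : uniq rs.
  rewrite map_inj_uniq ?iota_uniq // => a b /eqP.
  by rewrite eqr_nat => /eqP[].
have rsr : all (root (\det M)) rs.
  apply/allP => _ /mapP[k _ ->]; apply/rootP; rewrite detE.
  apply/eqP; rewrite -[_ == 0]negbK -unitfE -unitmxE -row_free_unit /row_free.
  rewrite neq_ltn (leq_ltn_trans _ rN) //.
  apply: leq_trans (Nr k).
  exact: leq_trans (mxrankM_maxl _ _) (mxrankM_maxr _ _).
by have := max_poly_roots M0 rsr rsu; rewrite size_map size_iota ltnn.
Qed.

(* Schur complement of the block p: it vanishes when the rank is minimal. *)
Lemma mxrank_block_min n (p B B' D : 'M[C]_n) : p *m p = p ->
  p *m B = B -> B *m p = 0 -> p *m B' = 0 -> B' *m p = B' ->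
  p *m D = 0 -> D *m p = 0 ->
  (\rank (p + B + B' + D)%R <= \rank p)%N -> D = B' *m B.
Proof.
move=> pp pB Bp pB' B'p pD Dp; set N := p + B + B' + D => Nr.
have pN : p *m N = p + B by rewrite /N !mulmxDr pp pB pB' pD !addr0.
(* As p N p = p, the rank of p N is at least that of p. So the rows of p N span those of N, and N =
   Y p N expresses the lower blocks through the upper ones. *)
have : (N <= p *m N)%MS.
  rewrite -(mxrank_leqif_sup (submxMl p N)) eqn_leq mxrankS ?submxMl //=.
  apply: (@leq_trans (\rank p)); first exact: Nr.
  have {1}<- : p *m N *m p = p.
    by rewrite pN mulmxDl pp Bp addr0.
  exact: mxrankM_maxl.
case/submxP => Y NY; rewrite pN in NY.
have pBp : (p + B) *m p = p by rewrite mulmxDl pp Bp addr0.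
have e1 : B' = (1%:M - p) *m Y *m p.
  have -> : (1%:M - p) *m Y *m p = (1%:M - p) *m N *m p.
    by rewrite [in RHS]NY mulmxA -[RHS]mulmxA pBp.
  by rewrite mulmxBl mul1mx pN /N !mulmxBl !mulmxDl pp Bp B'p Dp !addr0 addrC addKr.
have e2 : D = (1%:M - p) *m Y *m B.
  have -> : (1%:M - p) *m Y *m B = (1%:M - p) *m N *m (1%:M - p).
    rewrite [in RHS]NY mulmxA -[RHS]mulmxA; congr (_ *m _).
    by rewrite mulmxBr mulmx1 pBp addrC addKr.
  rewrite mulmxBl mul1mx pN /N.
  have -> : p + B + B' + D - (p + B) = B' + D.
    by rewrite -(addrA (p + B)) [X in X - _]addrC addrK.
  by rewrite mulmxBr mulmx1 mulmxDl B'p Dp addr0 addrC addKr.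
by rewrite e1 -mulmxA pB -e2.
Qed.

End LocalPositivity.

(** * Second-order structure of a positive family whose rank is maximal at the origin *)

Section BlockForm.
Variables (C : numClosedFieldType) (n : nat) (p q H F : 'M[C]_n).
Hypothesis hp : orthoproj p.
Hypothesis hq : q = 1%:M - p.
(** The value of the positive map at the projection on x0 + z x1, in coordinates where its value at
    x0 is the projection p. *)
Let Phi (z : C) := p + (z^* *: H + z *: H^t*) + (z * z^*) *: F.
Hypothesis Phi_psd : forall z, psdmx (Phi z).
Hypothesis Phi_rank : forall z, (\rank (Phi z) <= \rank p)%N.
Hypothesis F_psd : psdmx F.

(** In the upper right corner of [Phi z], z^* multiplies S and z multiplies T: S will carry the
    completely positive part and T the completely copositive one. *)
Let S := p *m H *m q.
Let T := p *m H^t* *m q.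

Let pp : p *m p = p. Proof. by case: hp. Qed.
Let pq : p *m q = 0. Proof. by rewrite hq mulmxBr mulmx1 pp subrr. Qed.
Let qp : q *m p = 0. Proof. by rewrite hq mulmxBl mul1mx pp subrr. Qed.
Let qa : q^t* = q. Proof. by rewrite hq adjmxB adjmx1; case: hp => ->. Qed.

(** On the kernel of p the form of [Phi z] starts with a term real-linear in z, which must vanish
    for the form to be nonnegative in every direction z. *)
Lemma block_qq_eq0 : q *m H *m q = 0.
Proof.
apply: qform_eq0 => w; rewrite -[X in X *m H]qa qform_congr.
set v := q *m w; set h := qform H v.
have pv : qform p v = 0.
  have pv0 : p *m v = 0 by rewrite /v mulmxA pq mul0mx.
  by rewrite /qform -mulmxA pv0 mulmx0 mxE.
have f0 : 0 <= qform F v by case: F_psd.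
set f := qform F v in f0.
(* At z = - t h the form equals - t (2 - t f) |h|^2, and this t ensures t f <= 1. *)
pose t := (f + 1)^-1; have t0 : 0 < t by rewrite invr_gt0 ltr_wpDl.
have tc : t^* = t by apply: geC0_conj; exact: ltW.
have [_ /(_ v)] := Phi_psd (- t * h).
rewrite /Phi !qformD !qformZ qform_adj pv add0r -/h -/f.
have -> : (- t * h)^* = - t * h^*.
  by rewrite -[in RHS]tc -(rmorphN Num.conj); exact: rmorphM.
have -> : - t * h^* * h + - t * h * h^* + - t * h * (- t * h^*) * f =
    - (t * (2 - t * f)) * (h * h^*) by ring.
have tf : t * f <= 1.
  by rewrite mulrC ler_pdivrMr ?ltr_wpDl // mul1r lerDl.
rewrite mulNr oppr_ge0 -normCK => hle.
have : `|h| ^+ 2 <= 0.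
  rewrite -(pmulr_rle0 _ (_ : 0 < t * (2 - t * f))) // mulr_gt0 // subr_gt0.
  by apply: le_lt_trans tf _; rewrite ltr1n.
by move=> h0; apply/eqP; rewrite -normr_eq0 -sqrf_eq0 eq_le h0 exprn_ge0.
Qed.

Let qHaq : q *m H^t* *m q = 0.
Proof.
by have := congr1 (fun A : 'M[C]_n => A^t*) block_qq_eq0;
  rewrite !adjmxM qa adjmx0 mulmxA.
Qed.

Let M (w : C) := w^* *: H + w *: H^t*.

(** After a congruence, [Phi (a * w)] becomes polynomial in a with the wanted block matrix as
    constant term. The rank bound at infinitely many a passes to a = 0, where the Schur complement
    must vanish. *)
Lemma block_schur (w : C) :
  (w * w^*) *: (q *m F *m q) = (q *m M w *m p) *m (p *m M w *m q).
Proof.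
have qMq : q *m M w *m q = 0.
  by rewrite /M mulmxDr mulmxDl -!scalemxAr -!scalemxAl block_qq_eq0 qHaq
    !scaler0 addr0.
apply: (mxrank_block_min pp).
- by rewrite !mulmxA pp.
- by rewrite -mulmxA qp mulmx0.
- by rewrite !mulmxA pq !mul0mx.
- by rewrite -mulmxA pp.
- by rewrite -scalemxAr !mulmxA pq !mul0mx scaler0.
- by rewrite -scalemxAl -mulmxA qp mulmx0 scaler0.
pose c := w * w^*.
apply: (@mxrank_perturb _ _ _ (p *m M w *m p + c *: (p *m F *m q + q *m F *m p))
  (c *: (p *m F *m p))) => k.
set a : C := k.+1%:R.
have a0 : a != 0 by rewrite pnatr_eq0.
have ac : a^* = a by rewrite /a; exact: rmorph_nat.
(* This brings q F q to order zero in a; no negative power of a survives because q H q = 0. *)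
pose E := p + a^-1 *: q.
have EE X : E *m X *m E = p *m X *m p + a^-1 *: (p *m X *m q + q *m X *m p) +
    (a^-1 * a^-1) *: (q *m X *m q).
  rewrite /E !mulmxDl !mulmxDr -!scalemxAl -!scalemxAr !scalerA scalerDr.
  by rewrite -!addrA; congr (_ + _); rewrite addrCA.
clearbody E; have EPhi : E *m Phi (a * w) *m E = p + p *m M w *m q + q *m M w *m p +
    c *: (q *m F *m q) + a *: (p *m M w *m p + c *: (p *m F *m q + q *m F *m p)) +
    a ^+ 2 *: (c *: (p *m F *m p)).
  have -> : Phi (a * w) = p + a *: M w + (a ^+ 2 * c) *: F.
    have awc : (a * w)^* = a * w^* by rewrite -[in RHS]ac; exact: rmorphM.
    rewrite /Phi /M awc scalerDr !scalerA; congr (_ + _ + _ *: _).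
    by rewrite /c; ring.
  move: (M w) qMq => Mw qMq.
  rewrite !mulmxDr !mulmxDl -!scalemxAr -!scalemxAl !EE qMq.
  have -> : p *m p *m p = p by rewrite !pp.
  have -> : p *m p *m q = 0 by rewrite pp pq.
  rewrite qp !mul0mx.
  move: (p *m Mw *m p) (p *m Mw *m q) (q *m Mw *m p) (p *m F *m p)
    (p *m F *m q) (q *m F *m p) (q *m F *m q) => A1 A2 A3 A4 A5 A6 A7.
  by apply/matrixP => i j; rewrite !mxE; field.
rewrite -EPhi; apply: leq_trans (Phi_rank (a * w)).
exact: leq_trans (mxrankM_maxl _ _) (mxrankM_maxr _ _).
Qed.

Let Sa : S^t* = q *m H^t* *m p.
Proof. by rewrite /S !adjmxM qa mulmxA; case: hp => ->. Qed.
Let Ta : T^t* = q *m H *m p.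
Proof. by rewrite /T !adjmxM trmxCK qa mulmxA; case: hp => ->. Qed.

Let schur_expand (w : C) : (w * w^*) *: (q *m F *m q) =
  (w * w^*) *: (S^t* *m S + T^t* *m T) + w^* ^+ 2 *: (T^t* *m S) +
  w ^+ 2 *: (S^t* *m T).
Proof.
rewrite block_schur.
have -> : q *m M w *m p = w^* *: T^t* + w *: S^t*.
  by rewrite /M mulmxDr mulmxDl -!scalemxAr -!scalemxAl Sa Ta.
have -> : p *m M w *m q = w^* *: S + w *: T.
  by rewrite /M mulmxDr mulmxDl -!scalemxAr -!scalemxAl.
rewrite !mulmxDl !mulmxDr -!scalemxAl -!scalemxAr.
move: (T^t* *m S) (T^t* *m T) (S^t* *m S) (S^t* *m T) => A1 A2 A3 A4.
by apply/matrixP => i j; rewrite !mxE; ring.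
Qed.

(* Comparing the identity [schur_expand] at w = 1, i and 1 + i. *)
Lemma block_cross_eq0 : S^t* *m T = 0.
Proof.
have := schur_expand 1; have := schur_expand 'i; have := schur_expand (1 + 'i).
move: (q *m F *m q) (T^t* *m S) (T^t* *m T) (S^t* *m S) (S^t* *m T)
  => A0 A1 A2 A3 A4 /matrixP e1 /matrixP e2 /matrixP e3.
apply/matrixP => k l; rewrite mxE.
have i2 : 'i * 'i = -1 :> C by rewrite -expr2 sqrCi.
have := e1 k l; have := e2 k l; have := e3 k l; rewrite !mxE.
have cE : (1 + 'i)^* = 1 - 'i :> C.
  by rewrite rmorphD rmorph1; congr (_ + _); exact: conjCi.
rewrite cE !rmorph1 conjCi; move: (A0 k l) (A1 k l) (A2 k l) (A3 k l)
  (A4 k l) => a0 a1 a2 a3 a4 h3 h2 h1.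
have : 8 * a4 = 0.
  have i0 : 'i != 0 :> C := neq0Ci C.
  have k1 : a0 = a3 + a2 + a1 + a4 by move: h3; rewrite !expr1n !mul1r.
  have k2 : a0 = a3 + a2 - a1 - a4.
    move: h2; rewrite mulrN i2 opprK !mul1r !expr2 mulrNN i2.
    by rewrite !mulN1r.
  have k3 : 2 * a0 = 2 * (a3 + a2) - 2 * 'i * a1 + 2 * 'i * a4.
    move: h1; rewrite !expr2.
    have -> : (1 + 'i) * (1 - 'i) = 2 :> C.
      have -> : (1 + 'i) * (1 - 'i) = 1 - 'i * 'i :> C by ring.
      by rewrite i2; ring.
    have -> : (1 - 'i) * (1 - 'i) = - 2 * 'i :> C.
      have -> : (1 - 'i) * (1 - 'i) = 1 + 'i * 'i - 2 * 'i :> C by ring.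
      by rewrite i2; ring.
    have -> : (1 + 'i) * (1 + 'i) = 2 * 'i :> C.
      have -> : (1 + 'i) * (1 + 'i) = 1 + 'i * 'i + 2 * 'i :> C by ring.
      by rewrite i2; ring.
    by move=> ->; ring.
  have s1 : a1 = - a4.
    apply/eqP; rewrite -subr_eq0 opprK.
    rewrite -(mulrI_eq0 _ (lregP (_ : 2 != 0 :> C))) ?pnatr_eq0 //.
    have -> : 2 * (a1 + a4) = (a3 + a2 + a1 + a4) - (a3 + a2 - a1 - a4) by ring.
    by rewrite -k1 -k2 subrr.
  rewrite s1 in k1 k3; have k1' : a0 = a3 + a2 by rewrite k1; ring.
  rewrite k1' in k3; have : 4 * 'i * a4 = 0.
    have -> : 4 * 'i * a4 = 2 * (a3 + a2) - 2 * 'i * - a4 + 2 * 'i * a4 -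
      2 * (a3 + a2) by ring.
    by rewrite -k3 subrr.
  move/eqP; rewrite !mulf_eq0 (negbTE i0) pnatr_eq0 /= => /eqP ->.
  by rewrite mulr0.
by move/eqP; rewrite mulf_eq0 pnatr_eq0 /= => /eqP.
Qed.

Lemma block_qFq : q *m F *m q = S^t* *m S + T^t* *m T.
Proof.
have := schur_expand 1; rewrite rmorph1 !mulr1 !expr1n !scale1r => ->.
rewrite block_cross_eq0 addr0.
have -> : T^t* *m S = (S^t* *m T)^t* by rewrite adjmxM trmxCK.
by rewrite block_cross_eq0 adjmx0 addr0.
Qed.

End BlockForm.

(** * Positivity after rescaling towards the base point *)

Section DiagonalScaling.
Variable C : numClosedFieldType.

(* The matrix [[A, B], [B^*, X]] of two-by-two blocks is a sum of squares. *)
Definition gram_blocks s (A B X : 'M[C]_s) : Prop :=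
  exists (m : nat) (u v : 'I_m -> 'cV[C]_s),
    [/\ A = \sum_k u k *m (u k)^t*, B = \sum_k u k *m (v k)^t*
      & X = \sum_k v k *m (v k)^t*].

Lemma gram_blocks_psd s (A B X : 'M[C]_s) m n (a b : 'M[C]_(m, n)) :
  gram_blocks A B X ->
  psdmx ((a^t* *m a) *t A + (a^t* *m b) *t B + (b^t* *m a) *t B^t* +
    (b^t* *m b) *t X).
Proof.
move=> [K [u [v [-> -> ->]]]].
rewrite adjmx_sum !tensmx_sumr -!big_split /=; apply: psdmx_sum => k _.
have := psdmx_gram (a *t (u k)^t* + b *t (v k)^t*).
rewrite adjmxD !adjmx_tens !trmxCK !mulmxDl !mulmxDr !tensmx_mul.
by rewrite adjmxM trmxCK !addrA.
Qed.

Lemma psdmx_tens m n (A : 'M[C]_m) (B : 'M[C]_n) :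
  psdmx A -> psdmx B -> psdmx (A *t B).
Proof. by move=> A0 B0; apply: Sep_sub_Psd; exact: Sep_tens. Qed.

Lemma psd_small_perturb n (A B : 'M[C]_n) (e : C) :
  0 < e -> A \is hermsymmx -> B \is hermsymmx ->
  exists2 t : C, 0 < t & psdmx (e *: 1%:M + t *: A + t ^+ 2 *: B).
Proof.
move=> e0 /hermsym_psd_shift[r r0 Ar] /hermsym_psd_shift[r' r'0 Br].
have d0 : 0 < e + r + r' by rewrite !addr_gt0.
(* As t <= 1, the loss t r + t^2 r' is at most t (e + r + r') = e. *)
pose t := e / (e + r + r'); have t0 : 0 < t by rewrite divr_gt0.
have t1 : t <= 1 by rewrite ler_pdivrMr // mul1r -addrA lerDl addr_ge0 // ltW.
exists t => //.
have -> : e *: 1%:M + t *: A + t ^+ 2 *: B = (e - t * r - t ^+ 2 * r') *: 1%:M +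
    (t *: (r *: 1%:M + A) + t ^+ 2 *: (r' *: 1%:M + B)).
  by apply/matrixP => i j; rewrite !mxE; ring.
apply: psdmxD; last first.
  by apply: psdmxD; apply: psdmxZ; rewrite ?exprn_ge0 // ltW.
apply: psdmxZ; last exact: psdmx1.
rewrite -addrA -opprD subr_ge0.
apply: (@le_trans _ _ (t * (e + r + r'))); last first.
  by rewrite /t mulfVK // gt_eqF.
rewrite !mulrDr -[leLHS]add0r -addrA lerD //; first by rewrite mulr_ge0 // ltW.
by rewrite lerD2l expr2 -mulrA ler_pM2l // ler_piMl // ltW.
Qed.

(* The remainder of the block form after removing the two sums of squares
   attached to S and T is controlled by the terms in e. *)
Lemma scaled_block_psd n s (p q H F : 'M[C]_n) (A B X : 'M[C]_s) (e : C) :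
  orthoproj p -> q = 1%:M - p -> psdmx F ->
  q *m H *m q = 0 ->
  (p *m H *m q)^t* *m (p *m H^t* *m q) = 0 ->
  q *m F *m q = (p *m H *m q)^t* *m (p *m H *m q) +
    (p *m H^t* *m q)^t* *m (p *m H^t* *m q) ->
  gram_blocks A B X -> gram_blocks A (B^t*) X -> 0 < e ->
  exists2 t : C, 0 < t &
    psdmx (p *t (A + e *: 1%:M) + t *: (H *t B + H^t* *t B^t*) +
           t ^+ 2 *: (F *t (X + e *: 1%:M))).
Proof.
move=> [pa pp] hq F0 qHq.
set S := p *m H *m q; set T := p *m H^t* *m q => ST qFq g1 g2 e0.
have pq : p *m q = 0 by rewrite hq mulmxBr mulmx1 pp subrr.
have qp : q *m p = 0 by rewrite hq mulmxBl mul1mx pp subrr.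
have qa : q^t* = q by rewrite hq adjmxB adjmx1 pa.
have pS : p *m S = S by rewrite /S !mulmxA pp.
have pT : p *m T = T by rewrite /T !mulmxA pp.
(* Because S^* T = 0, the ranges of S and T are orthogonal. Splitting p as v + (p - v), with v the
   projection on the range of S, lets [g1] handle S and [g2] handle T. *)
have [v [g [[va vv] vS vg]]] := range_orthoproj S.
have vT : v *m T = 0.
  by rewrite -va vg adjmxM -mulmxA ST mulmx0.
have pv : p *m v = v by rewrite vg mulmxA pS.
have vp : v *m p = v.
  by have := congr1 (fun M : 'M[C]_n => M^t*) pv; rewrite adjmxM va pa.
have wa : (p - v)^t* = p - v by rewrite adjmxB pa va.
have ww : (p - v) *m (p - v) = p - v.
  by rewrite mulmxBl !mulmxBr pp pv vp vv subrr subr0.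
have wT : (p - v) *m T = T by rewrite mulmxBl pT vT subr0.
have eH : H = p *m H *m p + S + T^t*.
  have -> : T^t* = q *m H *m p by rewrite /T !adjmxM trmxCK qa pa mulmxA.
  rewrite {1}(_ : H = (p + q) *m H *m (p + q)); last first.
    by rewrite hq addrC subrK mul1mx mulmx1.
  by rewrite !mulmxDl !mulmxDr qHq addr0.
have eF : F = p *m F *m p + p *m F *m q + q *m F *m p + q *m F *m q.
  rewrite {1}(_ : F = (p + q) *m F *m (p + q)); last first.
    by rewrite hq addrC subrK mul1mx mulmx1.
  by rewrite !mulmxDl !mulmxDr !addrA.
clearbody S T; have Fa : F^t* = F by apply/hermsymmxP; case: F0.
have XA : psdmx X /\ psdmx A.
  by case: g1 => [K [u [w [-> _ ->]]]]; split; apply: psdmx_sum => k _;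
    exact: psdmx_rank1.
have [X0 A0] := XA.
pose Y := X + e *: 1%:M.
have Y0 : psdmx Y by apply: psdmxD => //; apply: psdmxZ; [exact: ltW|exact: psdmx1].
have hY : Y \is hermsymmx by case: Y0.
have [r r0 rY] : exists2 r : C, 0 < r & psdmx (r *: 1%:M + - Y).
  apply: hermsym_psd_shift; apply/hermsymmxP.
  by rewrite adjmxN (hermsymmxP _ hY).
(* D F D keeps the cross blocks of F while shrinking q F q by th^2. Since Y <= r, th^2 Y <= e, so
   the e-term of the q-corner covers what D F D uses there. *)
pose th := sqrtC (e / r); have th0 : 0 < th by rewrite sqrtC_gt0 divr_gt0.
have thc : th^* = th by apply: geC0_conj; exact: ltW.
have thVc : (th^-1)^* = th^-1 by apply: geC0_conj; rewrite invr_ge0 ltW.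
have th2 : th ^+ 2 = e / r by rewrite sqrtCK.
pose D := th^-1 *: p + th *: q.
have Da : D^t* = D by rewrite adjmxD !adjmxZ thc thVc pa qa.
have DFD : D *m F *m D = th^-1 ^+ 2 *: (p *m F *m p) + p *m F *m q +
    q *m F *m p + th ^+ 2 *: (q *m F *m q).
  rewrite /D !mulmxDl !mulmxDr -!scalemxAl -!scalemxAr !scalerA.
  by rewrite mulVf ?mulfV ?gt_eqF // !scale1r !addrA -!expr2.
have h1 : psdmx ((D *m F *m D) *t Y).
  by apply: psdmx_tens => //; rewrite -{1}Da; exact: psdmx_congr.
have h2 : psdmx ((q *m F *m q) *t (e *: 1%:M - th ^+ 2 *: Y)).
  apply: psdmx_tens; first by rewrite -{1}qa; exact: psdmx_congr.
  rewrite (_ : e *: 1%:M - th ^+ 2 *: Y = (e / r) *: (r *: 1%:M + - Y)).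
    by apply: psdmxZ => //; rewrite ltW // divr_gt0.
  rewrite th2; move: (Y) => Y'.
  by rewrite scalerDr scalerN scalerA divfK // gt_eqF.
(* Only the p-corners of [M1] and [M2] are used, absorbed by e p (x) 1 for small t; the factor 1 -
   th^-2 corrects the coefficient of p F p in D F D. *)
pose M1 := H *t B + H^t* *t B^t*.
pose M2 := (1 - th^-1 ^+ 2) *: (F *t Y).
have hM1 : M1 \is hermsymmx.
  by apply/hermsymmxP; rewrite adjmxD !adjmx_tens !trmxCK addrC.
have hM2 : M2 \is hermsymmx.
  apply/hermsymmxP; rewrite adjmxZ adjmx_tens Fa (hermsymmxP _ hY).
  congr (_ *: _); rewrite rmorphB rmorph1; congr (_ - _).
  by rewrite -[in RHS]thVc; exact: rmorphXn.
have [t t0 h3] := psd_small_perturb e0 hM1 hM2.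
exists t => //.
have tc : t^* = t by apply: geC0_conj; exact: ltW.
have Sv : S^t* *m v = S^t* by rewrite -{2}vS adjmxM va.
have Tw : T^t* *m (p - v) = T^t* by rewrite -{2}wT adjmxM wa.
have k1 : psdmx (v *t A + t *: (S *t B) + t *: (S^t* *t B^t*) +
    t ^+ 2 *: ((S^t* *m S) *t X)).
  have := gram_blocks_psd v (t *: S) g1; rewrite adjmxZ tc va vv.
  rewrite -(scalemxAr t v) vS -(scalemxAl t _ v) Sv -scalemxAl -scalemxAr.
  by rewrite scalerA -expr2 !tensmxZl.
have k2 : psdmx ((p - v) *t A + t *: (T *t B^t*) + t *: (T^t* *t B) +
    t ^+ 2 *: ((T^t* *m T) *t X)).
  have := gram_blocks_psd (p - v) (t *: T) g2; rewrite adjmxZ tc wa ww trmxCK.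
  rewrite -(scalemxAr t (p - v)) wT -(scalemxAl t _ (p - v)) Tw -scalemxAl.
  by rewrite -scalemxAr scalerA -expr2 !tensmxZl.
have k3 : psdmx (e *: (p *t 1%:M) + t *: ((p *m H *m p) *t B +
    (p *m H *m p)^t* *t B^t*) +
    t ^+ 2 *: ((1 - th^-1 ^+ 2) *: ((p *m F *m p) *t Y))).
  have := psdmx_congr (p *t 1%:M) h3; congr psdmx.
  have tE (Z1 : 'M[C]_n) (Z2 : 'M[C]_s) : (p *t 1%:M) *m (Z1 *t Z2) *m (p *t 1%:M) =
      (p *m Z1 *m p) *t Z2 by rewrite !tensmx_mul mul1mx mulmx1.
  rewrite adjmx_tens adjmx1 pa /M1 /M2 !mulmxDr !mulmxDl.
  rewrite -!scalemxAr -!scalemxAl mulmx1 tensmx_mul pp mulmx1.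
  rewrite !mulmxDr !mulmxDl !tE.
  by rewrite (_ : (p *m H *m p)^t* = p *m H^t* *m p) // !adjmxM pa mulmxA.
have t2 : 0 <= t ^+ 2 by rewrite exprn_ge0 // ltW.
(* [k1] and [k2] give p (x) A, the S and T terms and q F q (x) X; [k3] gives the p-corner; [h1] and
   [h2] give the cross blocks of F and e q F q. *)
have := psdmxD (psdmxD (psdmxD k1 k2) k3)
  (psdmxD (psdmxZ t2 h1) (psdmxZ t2 h2)).
congr psdmx.
have eHa : H^t* = (p *m H *m p)^t* + S^t* + T by rewrite {1}eH !adjmxD trmxCK.
have eHB : H *t B = (p *m H *m p + S + T^t*) *t B by rewrite -eH.
have eFY : F *t Y = (p *m F *m p + p *m F *m q + q *m F *m p + q *m F *m q) *t Y.
  by rewrite -eF.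
rewrite DFD eHa eHB eFY qFq /Y.
move: (p *m H *m p) (p *m F *m p) (p *m F *m q) (q *m F *m p)
  (S^t* *m S) (T^t* *m T) (th ^+ 2) (th^-1 ^+ 2) => Z1 Z2 Z3 Z4 Z5 Z6 c1 c2.
move: (Z1^t*) (B^t*) (S^t*) (T^t*) => Z1a Ba Sa Ta.
by apply/matrixP => i j; rewrite !mxE; ring.
Qed.

End DiagonalScaling.

(** * Matrices supported on two directions of the first factor *)

Section TwoBlocks.
Variable C : numClosedFieldType.

Definition two_block d s (x0 x1 : 'cV[C]_d) (A B X : 'M[C]_s) : 'M[C]_(d * s) :=
  (x0 *m x0^t*) *t A + (x0 *m x1^t*) *t B + (x1 *m x0^t*) *t B^t* +
  (x1 *m x1^t*) *t X.

Lemma amplifyD d n (phi : 'M[C]_d -> 'M[C]_n) s (X Y : 'M[C]_(d * s)) :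
  amplify phi (X + Y) = amplify phi X + amplify phi Y.
Proof.
rewrite /amplify -big_split /=; apply: eq_bigr => i _; rewrite -big_split /=.
apply: eq_bigr => j _; rewrite -tensmxDr; congr (_ *t _).
by apply/matrixP => k l; rewrite !mxE.
Qed.

Lemma amplifyZ d n (phi : 'M[C]_d -> 'M[C]_n) s a (X : 'M[C]_(d * s)) :
  amplify phi (a *: X) = a *: amplify phi X.
Proof.
rewrite /amplify scaler_sumr; apply: eq_bigr => i _; rewrite scaler_sumr.
apply: eq_bigr => j _; rewrite -tensmxZr; congr (_ *t _).
by apply/matrixP => k l; rewrite !mxE.
Qed.

Lemma amplify0 d n (phi : 'M[C]_d -> 'M[C]_n) s :
  amplify phi (0 : 'M[C]_(d * s)) = 0.
Proof.
by rewrite /amplify big1 // => i _; rewrite big1 // => j _;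
  rewrite block0 tensmx0.
Qed.

Lemma amplify_sum d n (phi : 'M[C]_d -> 'M[C]_n) s I (r : seq I) (P : pred I)
    (F : I -> 'M[C]_(d * s)) :
  amplify phi (\sum_(i <- r | P i) F i) = \sum_(i <- r | P i) amplify phi (F i).
Proof.
apply: (big_morph (@amplify _ _ _ phi s)) => [X Y|]; first exact: amplifyD.
exact: amplify0.
Qed.

Lemma amplify_compress d n (phi : 'M[C]_d -> 'M[C]_n) s t (V : 'M[C]_(s, t))
    (X : 'M[C]_(d * s)) :
  amplify phi (compress V X) = compress V (amplify phi X).
Proof.
rewrite /amplify compress_sum; apply: eq_bigr => i _; rewrite compress_sum.
by apply: eq_bigr => j _; rewrite compress_tens compress_block.
Qed.

Lemma mul_delta_col m d (a : 'I_m) (b : 'I_d) (x : 'cV[C]_d) :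
  delta_mx a b *m x = x b 0 *: delta_mx a 0.
Proof.
apply/matrixP => i j; rewrite !mxE (bigD1 b) //= big1 => [|k nk].
  by rewrite !mxE !eqxx (ord1 j) eqxx !andbT addr0 mulrC.
by rewrite !mxE (negbTE nk) andbF mul0r.
Qed.

(** J identifies the span of x0 and x1 with C^2, which later carries separability back to size 2 x
    4. *)
Lemma exists_coframe d (x0 : 'cV[C]_d) : (1 < d)%N -> x0 != 0 ->
  exists (x1 : 'cV[C]_d) (J : 'M[C]_(2, d)),
    J *m x0 = delta_mx 0 0 /\ J *m x1 = delta_mx 1 0.
Proof.
move=> d1 x00; have [i xi] : exists i, x0 i 0 != 0.
  apply/existsP; apply: contraNT x00; rewrite negb_exists => /forallP h.
  apply/eqP/matrixP => i j; rewrite (ord1 j) mxE; apply/eqP.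
  by have := h i; rewrite negbK.
have [j ji] : exists j : 'I_d, j != i.
  pose j0 : 'I_d := Ordinal (ltnW d1); pose j1 : 'I_d := Ordinal d1.
  have [e|e] := eqVneq i j0; first by exists j1; rewrite e.
  by exists j0; rewrite eq_sym.
exists (delta_mx j 0), ((x0 i 0)^-1 *: delta_mx 0 i +
  (delta_mx 1 j - (x0 j 0 / x0 i 0) *: delta_mx 1 i)).
split; rewrite mulmxDl mulmxBl -!scalemxAl !mul_delta_col.
  by rewrite !scalerA mulVf // scale1r divfK // subrr addr0.
by rewrite !mxE !eqxx /= eq_sym (negbTE ji) /= !scale0r !scaler0 subr0 add0r scale1r.
Qed.

Lemma Sep_local m d s (J : 'M[C]_(m, d)) (X : 'M[C]_(d * s)) :
  Sep C d s X -> Sep C m s ((J *t 1%:M) *m X *m (J *t 1%:M)^t*).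
Proof.
move=> [n [A [B [AB ->]]]].
exists n, (fun i => J *m A i *m J^t*), B; split.
  move=> i; have [? ?] := AB i; split=> //.
  by rewrite -{1}[J]trmxCK; exact: psdmx_congr.
rewrite mulmx_sumr mulmx_suml; apply: eq_bigr => i _.
by rewrite adjmx_tens adjmx1 !tensmx_mul mul1mx mulmx1.
Qed.

Lemma two_block_local m d s (J : 'M[C]_(m, d)) x0 x1 (A B X : 'M[C]_s) :
  (J *t 1%:M) *m two_block x0 x1 A B X *m (J *t 1%:M)^t* =
  two_block (J *m x0) (J *m x1) A B X.
Proof.
have E (x y : 'cV[C]_d) (Z : 'M[C]_s) :
    (J *t 1%:M) *m ((x *m y^t*) *t Z) *m (J *t 1%:M)^t* =
    ((J *m x) *m (J *m y)^t*) *t Z.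
  by rewrite adjmx_tens adjmx1 !tensmx_mul mul1mx mulmx1 adjmxM !mulmxA.
by rewrite /two_block !mulmxDr !mulmxDl !E.
Qed.

Lemma two_blockZ d s x0 x1 t (A B X : 'M[C]_s) : 0 < t ->
  two_block x0 (t *: x1) A B X =
  two_block x0 (x1 : 'cV[C]_d) A (t *: B) (t ^+ 2 *: X).
Proof.
move=> t0; have tc : t^* = t by apply: geC0_conj; exact: ltW.
rewrite /two_block !adjmxZ tc -!scalemxAl -!scalemxAr !tensmxZl !tensmxZr.
by rewrite scalerA -expr2.
Qed.

Lemma two_block_psd d s x0 (x1 : 'cV[C]_d) (A B X : 'M[C]_s) :
  gram_blocks A B X -> psdmx (two_block x0 x1 A B X).
Proof.
move=> g; have := gram_blocks_psd (x0^t*) (x1^t*) g.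
by rewrite !trmxCK.
Qed.

Lemma two_block_shift d s x0 (x1 : 'cV[C]_d) e (A B X : 'M[C]_s) :
  two_block x0 x1 (A + e *: 1%:M) B (X + e *: 1%:M) = two_block x0 x1 A B X +
    e *: ((x0 *m x0^t* + x1 *m x1^t*) *t 1%:M).
Proof.
rewrite /two_block !tensmxDr !tensmxDl !tensmxZr scalerDr.
by rewrite -!addrA; congr (_ + _); rewrite addrC -!addrA; congr (_ + _);
  congr (_ + _); congr (_ + _); rewrite addrC.
Qed.

(* x0 maximizes the rank of phi (x x^* ); the scaling t -> 0 zooms in at x0,
   where positivity of the map only sees second-order data. *)
Lemma positive_map_local d n s (phi : {linear 'M[C]_d -> 'M[C]_n}) :
  (1 < d)%N -> (forall M : 'M[C]_d, phi (M^t*) = (phi M)^t*) ->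
  (forall x : 'cV[C]_d, psdmx (phi (x *m x^t*))) ->
  exists (x0 x1 : 'cV[C]_d) (J : 'M[C]_(2, d)),
    [/\ J *m x0 = delta_mx 0 0, J *m x1 = delta_mx 1 0
      & forall (A B X : 'M[C]_s) e,
          gram_blocks A B X -> gram_blocks A (B^t*) X -> 0 < e ->
          exists2 t, 0 < t & psdmx (amplify phi
            (two_block x0 (t *: x1) (A + e *: 1%:M) B (X + e *: 1%:M)))].
Proof.
move=> d1 phia phi0.
pose Q k := `[< exists2 x : 'cV[C]_d, x != 0 & \rank (phi (x *m x^t*)) = k >].
have exQ : exists k, Q k.
  exists (\rank (phi ((delta_mx (Ordinal d1) 0 : 'cV[C]_d) *m
    (delta_mx (Ordinal d1) 0)^t*))); apply/asboolP.
  exists (delta_mx (Ordinal d1) 0) => //.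
  apply/eqP => /matrixP/(_ (Ordinal d1) 0); rewrite !mxE !eqxx => /eqP.
  by rewrite oner_eq0.
have Qb k : Q k -> (k <= n)%N by move=> /asboolP[x _ <-]; exact: rank_leq_row.
case: (ex_maxnP exQ Qb) => r /asboolP[x0 x00 rx0] rmax.
have {rmax} rmax (x : 'cV[C]_d) : (\rank (phi (x *m x^t*)) <= r)%N.
  have [->|x0'] := eqVneq x 0; first by rewrite mul0mx linear0 mxrank0.
  by apply: rmax; apply/asboolP; exists x.
have [x1 [J [J0 J1]]] := exists_coframe d1 x00.
exists x0, x1, J; split=> // A B X e g1 g2 e0.
(* This congruence reaches the normal form of the block lemmas; maximality of the rank at x0 becomes
   their rank hypothesis. *)
have [W [p [Wu hp Wp]]] := psdmx_congr_proj (phi0 x0).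
pose psi M := W^t* *m phi M *m W.
have psiD M N : psi (M + N) = psi M + psi N.
  by rewrite /psi linearD mulmxDr mulmxDl.
have psiZ a M : psi (a *: M) = a *: psi M.
  by rewrite /psi linearZ /= -scalemxAr -scalemxAl.
pose H := psi (x0 *m x1^t*); pose F := psi (x1 *m x1^t*).
have Ha : H^t* = psi (x1 *m x0^t*).
  by rewrite /H /psi !adjmxM trmxCK -phia adjmxM trmxCK mulmxA.
have PhiE z : p + (z^* *: H + z *: H^t*) + (z * z^*) *: F =
    psi ((x0 + z *: x1) *m (x0 + z *: x1)^t*).
  rewrite Ha /H /F -Wp -/(psi _) adjmxD adjmxZ mulmxDl !mulmxDr.
  rewrite -!scalemxAl -!scalemxAr scalerA.
  by rewrite !psiD !psiZ !addrA.
have F0 : psdmx F by apply: psdmx_congr; exact: phi0.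
have Phi0 z : psdmx (p + (z^* *: H + z *: H^t*) + (z * z^*) *: F).
  by rewrite PhiE; apply: psdmx_congr; exact: phi0.
have rp : \rank p = r.
  rewrite -Wp mxrankMfree ?row_free_unit // -rx0.
  by rewrite eqmxMfull // row_full_unit map_unitmx unitmx_tr.
have PhiR z : (\rank (p + (z^* *: H + z *: H^t*) + (z * z^*) *: F)%R <= \rank p)%N.
  rewrite PhiE rp; apply: leq_trans (rmax (x0 + z *: x1)).
  exact: leq_trans (mxrankM_maxl _ _) (mxrankM_maxr _ _).
have qE : 1%:M - p = 1%:M - p by [].
have e1 := block_qq_eq0 hp qE Phi0 F0.
have e2 := block_cross_eq0 hp qE Phi0 PhiR F0.
have e3 := block_qFq hp qE Phi0 PhiR F0.
have [t t0 ht] := scaled_block_psd hp qE F0 e1 e2 e3 g1 g2 e0.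
exists t => //; rewrite two_blockZ //.
have := psdmx_congr (invmx W *t 1%:M) ht; congr psdmx.
have psiK M : (invmx W)^t* *m psi M *m invmx W = phi M.
  rewrite /psi !mulmxA -adjmxM mulmxV // adjmx1 mul1mx.
  by rewrite -mulmxA mulmxV // mulmx1.
have E M (Z : 'M[C]_s) : (invmx W *t 1%:M)^t* *m (psi M *t Z) *m
    (invmx W *t 1%:M) = amplify phi (M *t Z).
  by rewrite adjmx_tens adjmx1 !tensmx_mul mul1mx mulmx1 psiK amplify_tens.
have tc : t^* = t by apply: geC0_conj; exact: ltW.
have pE : p = psi (x0 *m x0^t*) by rewrite /psi Wp.
rewrite pE Ha /two_block adjmxZ tc !tensmxZr !amplifyD !amplifyZ -!E.
by rewrite !mulmxDr !mulmxDl -!scalemxAr -!scalemxAl mulmxDr mulmxDl scalerDr !addrA.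
Qed.

End TwoBlocks.

(** * An entangled matrix with positive partial transpose *)

Section EdgeExample.
Variable C : numClosedFieldType.

(** Entries come from functions on nat, so that Gram identities are verified by evaluating natural
    numbers. *)
Definition natcol n (f : nat -> nat) : 'cV[C]_n := \col_i (f i)%:R.

Lemma natcol_gram n f g :
  natcol n f *m (natcol n g)^t* = \matrix_(i, j) (f i * g j)%:R.
Proof.
apply/matrixP => i j; rewrite !mxE big_ord1 !mxE natrM; congr (_ * _).
exact: rmorph_nat.
Qed.

Definition natmx n (f : nat -> nat -> nat) : 'M[C]_n := \matrix_(i, j) (f i j)%:R.

Lemma natmx_gram m n (f g : nat -> nat -> nat) :
  \sum_(k < m) natcol n (f k) *m (natcol n (g k))^t* =
  natmx n (fun i j => \sum_(k < m) f k i * g k j)%N.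
Proof.
apply/matrixP => i j; rewrite summxE mxE natr_sum; apply: eq_bigr => k _.
by rewrite natcol_gram mxE.
Qed.

Lemma eq_natmx n (f g : nat -> nat -> nat) :
  (forall i j, (i < n)%N -> (j < n)%N -> f i j = g i j) -> natmx n f = natmx n g.
Proof. by move=> fg; apply/matrixP => i j; rewrite !mxE fg. Qed.

(** [[A, B], [B^*, X]] is a multiple of the 2 x 4 entangled state of P. Horodecki at parameter 8/17,
    a value that makes all entries integers. It and its partial transpose both have rank 5. *)
Definition edgeA (i j : nat) : nat := (16 * (i == j))%N.
Definition edgeB (i j : nat) : nat := (16 * (j == i.+1))%N.
Definition edgeX (i j : nat) : nat :=
  (16 * ((i == j) && (0 < i)) +
   (5 * (i == 0) + 3 * (i == 3)) * (5 * (j == 0) + 3 * (j == 3)))%N.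

(* Both decompositions use 4 e_k; the last terms are 5 e_0 + 3 e_3 and its
   reversal, and 5^2 - 3^2 = 4^2 makes the diagonals agree. *)
Definition edge_u (k i : nat) : nat := (4 * (i == k))%N.
Definition edge_v (k i : nat) : nat :=
  (if k == 4 then 5 * (i == 0) + 3 * (i == 3) else 4 * (i == k.+1))%N.
Definition edge_v' (k i : nat) : nat :=
  (if k == 4 then 3 * (i == 0) + 5 * (i == 3) else 4 * (i.+1 == k))%N.

Local Notation A := (natmx 4%N edgeA).
Local Notation B := (natmx 4%N edgeB).
Local Notation X := (natmx 4%N edgeX).

Lemma edge_gram : gram_blocks A B X.
Proof.
(* No index below 4 equals 4, so the fifth u is zero and the fifth pair contributes to X only. *)
exists 5%N, (fun k => natcol 4%N (edge_u k)), (fun k => natcol 4%N (edge_v k)).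
split; rewrite natmx_gram; apply: eq_natmx => i j;
  by case: i => [|[|[|[|//]]]] _; case: j => [|[|[|[|//]]]] _;
     rewrite !big_ord_recl big_ord0.
Qed.

Lemma edge_gramT : gram_blocks A (B^t*) X.
Proof.
have -> : B^t* = natmx 4%N (fun i j => edgeB j i).
  by apply/matrixP => i j; rewrite !mxE; exact: rmorph_nat.
exists 5%N, (fun k => natcol 4%N (edge_u k)), (fun k => natcol 4%N (edge_v' k)).
split; rewrite natmx_gram; apply: eq_natmx => i j;
  by case: i => [|[|[|[|//]]]] _; case: j => [|[|[|[|//]]]] _;
     rewrite !big_ord_recl big_ord0.
Qed.

Local Notation e0 := (delta_mx 0 0 : 'cV[C]_2).
Local Notation e1 := (delta_mx 1 0 : 'cV[C]_2).

Lemma ord2_cases (i : 'I_2) : i = 0 \/ i = 1.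
Proof. by case: i => [[|[|//]]] h; [left|right]; exact/val_inj. Qed.

Lemma block_two_block s (M N Y : 'M[C]_s) (i j : 'I_2) :
  block (two_block e0 e1 M N Y) i j =
  if i == 0 then (if j == 0 then M else N) else (if j == 0 then N^t* else Y).
Proof.
have eE (a b : 'I_2) : (delta_mx a 0 : 'cV[C]_2) *m (delta_mx b 0)^t* =
    delta_mx a b.
  by rewrite trmx_delta map_delta_mx mul_delta_mx.
rewrite /two_block !eE; apply/matrixP => k l; rewrite !mxE !mxtens_indexK /=.
by case: (ord2_cases i) => ->; case: (ord2_cases j) => ->;
  rewrite /= ?mxE !(mul1r, mul0r, addr0, add0r).
Qed.

Lemma ptrans_two_block s (M N Y : 'M[C]_s) :
  ptrans (two_block e0 e1 M N Y) = two_block e0 e1 M (N^t*) Y.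
Proof.
apply: eq_block => i j; rewrite block_ptrans !block_two_block trmxCK.
by case: (ord2_cases i) => ->; case: (ord2_cases j) => ->.
Qed.

Lemma dot_tens m n (x w : 'cV[C]_m) (y c : 'cV[C]_n) :
  ((x *t y)^t* *m (w *t c)) 0 0 = (x^t* *m w) 0 0 * (y^t* *m c) 0 0.
Proof.
have i0 : (0 : 'I_(1 * 1)) = mxtens_index ((0 : 'I_1), (0 : 'I_1)).
  by apply/val_inj.
by rewrite -(tensmxE (x^t* *m w)) -tensmx_mul -adjmx_tens -i0.
Qed.

(* The hypotheses say that e0 (x) a + e1 (x) b is in the kernel of the matrix. *)
Lemma sep_sum_kernel s (r : seq ('cV[C]_2 * 'cV[C]_s)) M N Y
    (a b : 'cV[C]_s) p :
  two_block e0 e1 M N Y = sep_sum r -> M *m a + N *m b = 0 ->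
  N^t* *m a + Y *m b = 0 -> p \in r ->
  (p.1 0 0)^* * (p.2^t* *m a) 0 0 + (p.1 1 0)^* * (p.2^t* *m b) 0 0 = 0.
Proof.
move=> ZE h1 h2 pr; set Z := two_block _ _ _ _ _ in ZE.
pose z : 'cV[C]_(2 * s) := e0 *t a + e1 *t b.
have oE (i j : 'I_2) : (delta_mx i 0 : 'cV[C]_2)^t* *m (delta_mx j 0 : 'cV[C]_2) =
    (i == j)%:R%:M.
  rewrite trmx_delta map_delta_mx; apply/matrixP => k l.
  rewrite !ord1 !mxE (bigD1 i) //= big1 => [|m' nm].
    by rewrite !mxE !eqxx /= mul1r addr0 andbT mulr1n.
  by rewrite !mxE (negbTE nm) andbF mul0r.
have Zz : Z *m z = 0.
  have T (x y w : 'cV[C]_2) (Q : 'M[C]_s) (c : 'cV[C]_s) :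
      ((x *m y^t*) *t Q) *m (w *t c : 'cV_(2 * s)) =
      (y^t* *m w) 0 0 *: (x *t (Q *m c)).
    rewrite (tensmx_mul _ _ w c) -mulmxA {1}[y^t* *m w]mx11_scalar.
    by rewrite mul_mx_scalar tensmxZl.
  rewrite /z mulmxDr /Z /two_block !mulmxDl !T !oE !mxE !eqxx /=.
  rewrite !scale1r !scale0r !addr0 !add0r.
  have -> : e0 *t (M *m a) + e1 *t (N^t* *m a) + (e0 *t (N *m b) + e1 *t (Y *m b))
      = e0 *t (M *m a + N *m b) + e1 *t (N^t* *m a + Y *m b).
    by rewrite !tensmxDr addrACA.
  by rewrite h1 h2 !tensmx0 addr0.
(* The rank-one terms are nonnegative at z with sum zero, so each product vector is orthogonal to
   z. *)
have : qform Z z = 0 by rewrite /qform -mulmxA Zz mulmx0 mxE.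
rewrite ZE /sep_sum qform_sum => /eqP; rewrite psumr_eq0; last first.
  by move=> k _; exact: qform_rank1_ge0.
move=> /allP/(_ p pr) /=; rewrite qform_rank1 expf_eq0 /= normr_eq0 => /eqP <-.
have xE (i : 'I_2) : (p.1 i 0)^* = (p.1^t* *m (delta_mx i 0 : 'cV[C]_2)) 0 0.
  by rewrite -colE !mxE.
by rewrite /z mulmxDr [RHS]mxE !dot_tens !xE.
Qed.

End EdgeExample.

(** * Non-separability of the edge matrix *)

Section EdgeNotSeparable.
Variable C : numClosedFieldType.
Local Notation A := (natmx C 4%N edgeA).
Local Notation B := (natmx C 4%N edgeB).
Local Notation X := (natmx C 4%N edgeX).
Local Notation e0 := (delta_mx 0 0 : 'cV[C]_2).
Local Notation e1 := (delta_mx 1 0 : 'cV[C]_2).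

Definition intcol (l : seq int) : 'cV[C]_4 := \col_i (l`_i)%:~R.

(* The equations express that x (x) y is orthogonal to the kernel of the edge
   matrix and that its partial conjugate is orthogonal to the kernel of the
   partial transpose. *)
Lemma product_orthogonal_kernels_eq0 (a b y0 y1 y2 y3 : C) :
  b * y1 = a * y0 -> b * y2 = a * y1 ->
  5 * a * y2 + b * (3 * y0 - 5 * y3) = 0 ->
  b^* * y1 = a^* * y2 -> b^* * y2 = a^* * y3 ->
  b^* * (5 * y0 - 3 * y3) = 5 * a^* * y1 ->
  (a = 0 /\ b = 0) \/ [/\ y0 = 0, y1 = 0, y2 = 0 & y3 = 0].
Proof.
move=> k1 k2 k3 g1 g2 g3.
have [a0|a0] := eqVneq a 0.
  have [b0|b0] := eqVneq b 0; [by left|right].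
  have bc0 : b^* != 0 by rewrite conjC_eq0.
  rewrite a0 conjC0 !mul0r mulr0 ?mul0r ?add0r in k1 k2 k3 g1 g2 g3.
  have y10 : y1 = 0 by move/eqP: k1; rewrite mulf_eq0 (negbTE b0) => /eqP.
  have y20 : y2 = 0 by move/eqP: k2; rewrite mulf_eq0 (negbTE b0) => /eqP.
  move/eqP: k3; rewrite mulf_eq0 (negbTE b0) subr_eq0 => /eqP k3.
  move/eqP: g3; rewrite ?mul0r mulf_eq0 (negbTE bc0) subr_eq0 => /eqP g3.
  have : 16 * y0 = 0.
    have -> : 16 * y0 = 5 * (5 * y0) - 3 * (3 * y0) by ring.
    by rewrite g3 k3; ring.
  move/eqP; rewrite mulf_eq0 pnatr_eq0 /= => /eqP y00; split=> //.
  move: k3; rewrite y00 mulr0 => /esym/eqP.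
  by rewrite mulf_eq0 pnatr_eq0 /= => /eqP.
have ac0 : a^* != 0 by rewrite conjC_eq0.
have e1 : y1 = b * y2 / a by rewrite k2 mulrC mulKf.
have e0 : y0 = b * y1 / a by rewrite k1 mulrC mulKf.
have e3 : y3 = b^* * y2 / a^* by rewrite g2 mulrC mulKf.
have [y20|y20] := eqVneq y2 0.
  by right; rewrite e3 e0 e1 y20 !(mulr0, mul0r).
left; exfalso.
(* [k2] and [g1] relate y1 and y2 in both directions, which forces |a| = |b|. *)
have nE : b^* * b = a^* * a.
  apply: (mulIf y20).
  have -> : b^* * b * y2 = b^* * (b * y2) by ring.
  by rewrite k2 mulrCA g1; ring.
(* Once y0 and y3 are expressed through y2, |a| = |b| cancels the terms with coefficient 5 in [k3],
   and only this product is left. *)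
have : 3 * a^* * b ^+ 3 * y2 = 0.
  have <- : a ^+ 2 * a^* * (5 * a * y2 + b * (3 * y0 - 5 * y3)) =
      3 * a^* * b ^+ 3 * y2.
    rewrite e0 e3 e1.
    have -> : a ^+ 2 * a^* * (5 * a * y2 + b * (3 * (b * (b * y2 / a) / a) -
        5 * (b^* * y2 / a^*))) =
        3 * a^* * b ^+ 3 * y2 + 5 * a ^+ 2 * y2 * (a^* * a - b^* * b).
      by field; rewrite a0 ac0.
    by rewrite nE subrr mulr0 addr0.
  by rewrite k3 mulr0.
move/eqP; rewrite mulf_eq0 (negbTE y20) orbF mulf_eq0 mulf_eq0 pnatr_eq0.
rewrite (negbTE ac0) expf_eq0 /= => /eqP b0; move: nE; rewrite b0 mulr0 => /esym/eqP.
by rewrite mulf_eq0 (negbTE ac0) (negbTE a0).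
Qed.

Lemma intcol_dot (y : 'cV[C]_4) l : (y^t* *m intcol l) 0 0 =
  (y 0 0 * (l`_0)%:~R + y 1 0 * (l`_1)%:~R + y (inord 2) 0 * (l`_2)%:~R +
   y (inord 3) 0 * (l`_3)%:~R)^*.
Proof.
rewrite mxE !big_ord_recl big_ord0 addr0 !mxE /=.
have cE (u : C) (m : int) : (u * m%:~R)^* = u^* * m%:~R.
  by rewrite -[m%:~R in RHS](rmorph_int Num.conj); exact: rmorphM.
have cD (u v : C) : (u + v)^* = u^* + v^* by exact: rmorphD.
rewrite !cD !cE !addrA; do !congr (_ + _); congr ((y _ _)^* * _);
  by apply/val_inj; rewrite /= ?inordK.
Qed.

Lemma natmx_intcol_eq0 (f g : nat -> nat -> nat) (a b : seq int) :
  (forall i, (i < 4)%N ->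
    (f i 0)%:Z * a`_0 + (f i 1)%:Z * a`_1 + (f i 2)%:Z * a`_2 +
      (f i 3)%:Z * a`_3 + ((g i 0)%:Z * b`_0 + (g i 1)%:Z * b`_1 +
      (g i 2)%:Z * b`_2 + (g i 3)%:Z * b`_3) = 0) ->
  natmx C 4%N f *m intcol a + natmx C 4%N g *m intcol b = 0.
Proof.
move=> fg; apply/matrixP => i j.
have e := congr1 (fun m : int => m%:~R : C) (fg i (ltn_ord i)).
rewrite [RHS]mxE; apply: (etrans _ e).
rewrite !mxE !big_ord_recl !big_ord0 !mxE /=.
by rewrite !(intrD, intrM) !addr0 !addrA.
Qed.

(** The range criterion: in a separable decomposition each product vector lies in the range of the
    matrix and its partial conjugate in that of the partial transpose; here no nonzero one does. *)
Lemma edge_not_Sep : ~ Sep C 2%N 4%N (two_block e0 e1 A B X).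
Proof.
move=> /SepP[r ZE].
have ZEp : two_block e0 e1 A (B^t*) X =
    sep_sum [seq (map_mx Num.conj p.1, p.2) | p <- r].
  rewrite -ptrans_two_block ZE /sep_sum big_map ptrans_sum.
  by apply: eq_bigr => p _; rewrite ptrans_rank1.
have r0 p : p \in r -> p.1 = 0 \/ p.2 = 0.
  move=> pr; set x := p.1; set y := p.2.
  have cM (u v : C) : (u * v)^* = u^* * v^* by exact: rmorphM.
  have cD (u v : C) : (u + v)^* = u^* + v^* by exact: rmorphD.
  have BtE : B^t* = natmx C 4%N (fun i j => edgeB j i).
    by apply/matrixP => i j; rewrite !mxE; exact: rmorph_nat.
  pose dot l := y 0 0 * (l`_0)%:~R + y 1 0 * (l`_1)%:~R +
    y (inord 2) 0 * (l`_2)%:~R + y (inord 3) 0 * (l`_3)%:~R.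
  have K a b : A *m intcol a + B *m intcol b = 0 ->
      B^t* *m intcol a + X *m intcol b = 0 -> x 0 0 * dot a + x 1 0 * dot b = 0.
    move=> h1 h2; have := sep_sum_kernel ZE h1 h2 pr.
    rewrite !intcol_dot -!cM -cD => /eqP; rewrite conjC_eq0 => /eqP; exact.
  have G a b : A *m intcol a + B^t* *m intcol b = 0 ->
      B *m intcol a + X *m intcol b = 0 ->
      (x 0 0)^* * dot a + (x 1 0)^* * dot b = 0.
    move=> h1 h2; rewrite -[B]trmxCK in h2.
    have pr' : (map_mx Num.conj x, y) \in
        [seq (map_mx Num.conj p.1, p.2) | p <- r] by apply/mapP; exists p.
    have := sep_sum_kernel ZEp h1 h2 pr'.
    by rewrite !intcol_dot !mxE -!cM -cD => /eqP; rewrite conjC_eq0 => /eqP; exact.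
  rewrite BtE in K G.
  pose y0 := y 0 0; pose y1 := y 1 0; pose y2 := y (inord 2) 0.
  pose y3 := y (inord 3) 0; pose xa := x 0 0; pose xb := x 1 0.
  have dotE l : dot l = y0 * (l`_0)%:~R + y1 * (l`_1)%:~R + y2 * (l`_2)%:~R +
    y3 * (l`_3)%:~R by [].
  have ck (f g : nat -> nat -> nat) a b := @natmx_intcol_eq0 f g a b.
  (* The pairs of lists passed to [K] form a basis of the three-dimensional kernel, those passed to
     [G] a basis of the kernel of the partial transpose. *)
  have k1 : xb * y1 = xa * y0.
    have := K [:: -1; 0; 0; 0] [:: 0; 1; 0; 0].
    rewrite !dotE /= => h; apply/eqP; rewrite -subr_eq0 -h; last 2 first.
    - by apply: ck => -[|[|[|[|//]]]].
    - by apply: ck => -[|[|[|[|//]]]].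
    by apply/eqP; rewrite -/xa -/xb; ring.
  have k2 : xb * y2 = xa * y1.
    have := K [:: 0; -1; 0; 0] [:: 0; 0; 1; 0].
    rewrite !dotE /= => h; apply/eqP; rewrite -subr_eq0 -h; last 2 first.
    - by apply: ck => -[|[|[|[|//]]]].
    - by apply: ck => -[|[|[|[|//]]]].
    by apply/eqP; rewrite -/xa -/xb; ring.
  have k3 : 5 * xa * y2 + xb * (3 * y0 - 5 * y3) = 0.
    have := K [:: 0; 0; 5; 0] [:: 3; 0; 0; -5].
    rewrite !dotE /= => h; rewrite -h; last 2 first.
    - by apply: ck => -[|[|[|[|//]]]].
    - by apply: ck => -[|[|[|[|//]]]].
    by rewrite -/xa -/xb; ring.
  have g1 : xb^* * y1 = xa^* * y2.
    have := G [:: 0; 0; -1; 0] [:: 0; 1; 0; 0].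
    rewrite !dotE /= => h; apply/eqP; rewrite -subr_eq0 -h; last 2 first.
    - by apply: ck => -[|[|[|[|//]]]].
    - by apply: ck => -[|[|[|[|//]]]].
    by apply/eqP; rewrite -/xa -/xb; ring.
  have g2 : xb^* * y2 = xa^* * y3.
    have := G [:: 0; 0; 0; -1] [:: 0; 0; 1; 0].
    rewrite !dotE /= => h; apply/eqP; rewrite -subr_eq0 -h; last 2 first.
    - by apply: ck => -[|[|[|[|//]]]].
    - by apply: ck => -[|[|[|[|//]]]].
    by apply/eqP; rewrite -/xa -/xb; ring.
  have g3 : xb^* * (5 * y0 - 3 * y3) = 5 * xa^* * y1.
    have := G [:: 0; -5; 0; 0] [:: 5; 0; 0; -3].
    rewrite !dotE /= => h; apply/eqP; rewrite -subr_eq0 -h; last 2 first.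
    - by apply: ck => -[|[|[|[|//]]]].
    - by apply: ck => -[|[|[|[|//]]]].
    by apply/eqP; rewrite -/xa -/xb; ring.
  have [[a0 b0]|[h0 h1 h2 h3]] :=
      product_orthogonal_kernels_eq0 k1 k2 k3 g1 g2 g3; [left|right].
    apply/matrixP => i j; rewrite (ord1 j) mxE.
    by case: (ord2_cases i) => ->.
  apply/matrixP => i j; rewrite (ord1 j) mxE.
  case: i => [[|[|[|[|//]]]] hi]; [rewrite -h0|rewrite -h1|rewrite -h2|rewrite -h3];
    by congr (y _ _); apply/val_inj; rewrite /= ?inordK.
have Z0 : two_block e0 e1 A B X = 0.
  rewrite ZE /sep_sum big_seq big1 // => p /r0[] ->.
    by rewrite tens0mx mul0mx.
  by rewrite tensmx0 mul0mx.
have := congr1 (fun Z => block Z 0 0) Z0; rewrite block_two_block block0 /=.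
move=> /matrixP/(_ 0 0); rewrite !mxE /= => /eqP.
by rewrite pnatr_eq0.
Qed.

End EdgeNotSeparable.

(** * Generators and realizations *)

Section LinearMaps.
Variable C : numClosedFieldType.

Lemma linear_bundle d n (f : 'M[C]_d -> 'M[C]_n) : linear f ->
  exists g : {linear 'M[C]_d -> 'M[C]_n}, g =1 f.
Proof.
move=> lf.
pose g : {linear 'M[C]_d -> 'M[C]_n} :=
  HB.pack f (GRing.isLinear.Build C 'M[C]_d 'M[C]_n _ f lf).
by exists g.
Qed.

Lemma eq_amplify d n (f g : 'M[C]_d -> 'M[C]_n) s (X : 'M[C]_(d * s)) :
  f =1 g -> amplify f X = amplify g X.
Proof.
by move=> fg; apply: eq_bigr => i _; apply: eq_bigr => j _; rewrite fg.
Qed.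

Lemma amplify_congr d n m (f : 'M[C]_d -> 'M[C]_n) (W : 'M[C]_(m, n)) s
    (X : 'M[C]_(d * s)) :
  (W *t 1%:M) *m amplify f X *m (W *t 1%:M)^t* =
  amplify (fun M => W *m f M *m W^t*) X.
Proof.
rewrite /amplify mulmx_sumr mulmx_suml; apply: eq_bigr => i _.
rewrite mulmx_sumr mulmx_suml; apply: eq_bigr => j _.
by rewrite adjmx_tens adjmx1 !tensmx_mul mul1mx mulmx1.
Qed.

Lemma psdmx_congrl m n (V : 'M[C]_(m, n)) (A : 'M[C]_n) :
  psdmx A -> psdmx (V *m A *m V^t*).
Proof. by rewrite -{1}[V]trmxCK; exact: psdmx_congr. Qed.

(* psi is block diagonal, indexed by the disjoint union of the 'I_(k j). *)
Lemma direct_sum_maps d m (k : 'I_m -> nat)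
    (phi : forall j, {linear 'M[C]_d -> 'M[C]_(k j)}) :
  exists (N : nat) (psi : {linear 'M[C]_d -> 'M[C]_N}),
    [/\ (forall j M, phi j (M^t*) = (phi j M)^t*) ->
          forall M, psi (M^t*) = (psi M)^t*,
        (forall j, phi j 1%:M = 1%:M) -> psi 1%:M = 1%:M,
        forall M, psdmx (psi M) <-> forall j, psdmx (phi j M)
      & forall s (X : 'M[C]_(d * s)),
          psdmx (amplify psi X) <-> forall j, psdmx (amplify (phi j) X)].
Proof.
pose T := {j : 'I_m & 'I_(k j)}; pose N := #|{: T}|.
pose W j : 'M[C]_(k j, N) :=
  \matrix_(a, b) (enum_val b == Tagged (fun j => 'I_(k j)) a :> T)%:R.
have WW j : W j *m (W j)^t* = 1%:M.
  apply/matrixP => a b; rewrite !mxE.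
  rewrite (bigD1 (enum_rank (Tagged (fun j => 'I_(k j)) a : T))) //=.
  rewrite big1 ?addr0 => [|c nc]; rewrite !mxE ?enum_rankK ?eqxx ?mul1r.
    by rewrite eq_Tagged /=; exact: rmorph_nat.
  rewrite (_ : (enum_val c == _) = false) ?mul0r //.
  by apply: contraNF nc => /eqP <-; rewrite enum_valK.
have WW0 i j : i != j -> W i *m (W j)^t* = 0.
  move=> ij; apply/matrixP => a b; rewrite !mxE big1 // => c _; rewrite !mxE.
  have [e|_] := eqVneq (enum_val c) (Tagged (fun j => 'I_(k j)) a); last by rewrite mul0r.
  rewrite (_ : (enum_val c == _) = false).
    by rewrite (rmorph0 Num.conj) mulr0.
  by rewrite e; apply/eqP => /(congr1 (@tag _ _)) /= /eqP; rewrite (negbTE ij).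
have W1 : \sum_j (W j)^t* *m W j = 1%:M.
  apply/matrixP => a b; rewrite summxE mxE.
  rewrite (bigD1 (tag (enum_val a))) //= big1 ?addr0 => [|j nj]; last first.
    rewrite mxE big1 // => c _; rewrite !mxE.
    rewrite (_ : (enum_val a == _) = false) ?(rmorph0 Num.conj) ?mul0r //.
    by apply: contraNF nj => /eqP ->.
  rewrite mxE (bigD1 (tagged (enum_val a))) //= big1 ?addr0 => [|c nc]; last first.
    rewrite !mxE (_ : (enum_val a == _) = false) ?(rmorph0 Num.conj) ?mul0r //.
    move: c nc; case: (enum_val a) => j x c nc.
    by rewrite eq_Tagged /= eq_sym (negbTE nc).
  rewrite !mxE; have -> : Tagged (fun j => 'I_(k j)) (tagged (enum_val a)) = enum_val a.
    by case: (enum_val a).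
  by rewrite eqxx (rmorph1 Num.conj) mul1r (inj_eq enum_val_inj) eq_sym.
pose f M := \sum_j (W j)^t* *m phi j M *m W j.
have [psi psiE] : exists g : {linear 'M[C]_d -> 'M[C]_N}, g =1 f.
  apply: linear_bundle => a X Y; rewrite /f scaler_sumr -big_split /=.
  apply: eq_bigr => j _; rewrite linearP mulmxDr mulmxDl.
  by rewrite -scalemxAr -scalemxAl.
have WpsiW j M : W j *m psi M *m (W j)^t* = phi j M.
  rewrite psiE /f mulmx_sumr mulmx_suml (bigD1 j) //= big1 ?addr0 => [|i ni].
    by rewrite !mulmxA WW mul1mx -mulmxA WW mulmx1.
  by rewrite !mulmxA WW0 1?eq_sym // !mul0mx.
exists N, psi; split.
- move=> ha M; rewrite !psiE /f adjmx_sum; apply: eq_bigr => j _.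
  by rewrite !adjmxM trmxCK ha mulmxA.
- move=> h1; rewrite psiE /f -[RHS]W1; apply: eq_bigr => j _.
  by rewrite h1 mulmx1.
- move=> M; split=> [h j|h]; first by rewrite -WpsiW; exact: psdmx_congrl.
  by rewrite psiE; apply: psdmx_sum => j _; exact: psdmx_congr.
- move=> s X; split=> [h j|h].
    rewrite -(eq_amplify X (WpsiW j)) -amplify_congr.
    exact: psdmx_congrl.
  rewrite (eq_amplify X psiE).
  have -> : amplify f X = \sum_j ((W j)^t* *t 1%:M) *m amplify (phi j) X *m
      ((W j)^t* *t 1%:M)^t*.
    under eq_bigr do rewrite amplify_congr trmxCK.
    rewrite /amplify [RHS]exchange_big /=; apply: eq_bigr => i _.
    rewrite [RHS]exchange_big /=; apply: eq_bigr => l _.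
    by rewrite /f tensmx_suml.
  by apply: psdmx_sum => j _; exact: psdmx_congrl.
Qed.

Lemma psdmx_tens1 n (A : 'M[C]_n) : psdmx (A *t (1%:M : 'M[C]_1)) -> psdmx A.
Proof.
move=> [_ h]; apply/psdmxP => x; have := h (x *t (1%:M : 'M[C]_1)).
rewrite qform_tens_prod (_ : qform 1%:M 1%:M = 1) ?mulr1 //.
by rewrite /qform adjmx1 !mulmx1 mxE eqxx.
Qed.

(** The Choi correspondence, with transposes placed so that amplifying this map at X gives the free
    pairing of B with X. *)
Definition choi_map d k (B : 'M[C]_(d * k)) (M : 'M[C]_d) : 'M[C]_k :=
  \sum_i \sum_j M i j *: (block B j i)^T.

Lemma choi_map_linear d k (B : 'M[C]_(d * k)) : linear (choi_map B).
Proof.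
move=> a X Y; rewrite /choi_map scaler_sumr -big_split; apply: eq_bigr => i _.
rewrite scaler_sumr -big_split; apply: eq_bigr => j _.
by rewrite !mxE scalerDl scalerA.
Qed.

Lemma choi_map_delta d k (B : 'M[C]_(d * k)) i j :
  choi_map B (delta_mx i j) = (block B j i)^T.
Proof.
rewrite /choi_map (bigD1 i) //= [X in _ + X]big1 ?addr0 => [|a na]; last first.
  by rewrite big1 // => b _; rewrite mxE (negbTE na) scale0r.
rewrite (bigD1 j) //= big1 ?addr0 => [|b nb]; last first.
  by rewrite mxE (negbTE nb) andbF scale0r.
by rewrite mxE !eqxx scale1r.
Qed.

Lemma amplify_choi_map d k (B : 'M[C]_(d * k)) s (X : 'M[C]_(d * s)) :
  psdmx (amplify (choi_map B) X) <->
  forall V : 'M[C]_(k, s), 0 <= \tr (compress V B *m X).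
Proof.
rewrite -psd_free_pairing (_ : amplify _ _ =
  \sum_i \sum_j (block B i j)^T *t block X j i) //.
rewrite exchange_big; apply: eq_bigr => i _; apply: eq_bigr => j _.
by rewrite choi_map_delta.
Qed.

Lemma choi_map_adj d k (B : 'M[C]_(d * k)) M :
  B \is hermsymmx -> choi_map B (M^t*) = (choi_map B M)^t*.
Proof.
move=> /hermsymmxP hB; rewrite /choi_map adjmx_sum exchange_big /=.
apply: eq_bigr => i _; rewrite adjmx_sum; apply: eq_bigr => j _.
rewrite adjmxE adjmxZ; congr (_ *: _).
by rewrite -[in LHS]hB block_adj; apply/matrixP => a b; rewrite !mxE.
Qed.

(** At x x^* (x) 1 the pairing tests compressions of B to level 1 against a product matrix, where
    block positivity suffices. *)
Lemma choi_map_pos d k (B : 'M[C]_(d * k)) (x : 'cV[C]_d) :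
  Bpsd C d k B -> psdmx (choi_map B (x *m x^t*)).
Proof.
move=> hB; apply: psdmx_tens1.
have [f fE] := linear_bundle (choi_map_linear B).
rewrite -fE -amplify_tens (eq_amplify _ fE); apply/amplify_choi_map => V.
have : Bpsd C d 1 (compress V B) by exact: Bpsd_compress_closed.
rewrite -tdual_Sep mxtrace_mulC; apply; apply: Sep_tens; first exact: psdmx_rank1.
exact: psdmx1.
Qed.

End LinearMaps.

(** * Generation by the maximally entangled projection, and explicit realizations *)

Section Generation.
Variables (C : numClosedFieldType) (d : nat).

Definition max_ent : 'cV[C]_(d * d) :=
  \sum_(i < d) ((delta_mx i 0 : 'cV[C]_d) *t (delta_mx i 0 : 'cV[C]_d)).

Definition max_ent_proj : 'M[C]_(d * d) := max_ent *m max_ent^t*.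

Lemma tens_colE m n (x : 'cV[C]_m) (y : 'cV[C]_n) i k :
  (x *t y) (mxtens_index (i, k)) (0 : 'I_1) = x i 0 * y k 0.
Proof.
rewrite -(tensmxE x y i k 0 0); congr ((_ *t _) _ _); exact/val_inj.
Qed.

(** Every bipartite vector is the image of the maximally entangled one under an operator on the
    second factor, so a single generator compresses to all rank-one positive matrices. *)
Lemma max_ent_generates s (w : 'cV[C]_(d * s)) :
  exists V : 'M[C]_(d, s), compress V max_ent_proj = w *m w^t*.
Proof.
exists (map_mx Num.conj (vec_rows w)); set V := map_mx _ _.
suff wE : ((1%:M : 'M[C]_d) *t V)^t* *m max_ent = w.
  have wE' : w^t* = max_ent^t* *m ((1%:M : 'M[C]_d) *t V).
    by rewrite -wE adjmxM trmxCK.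
  by rewrite /compress /max_ent_proj mulmxA wE -mulmxA wE'.
apply/matrixP => a b; case: (mxtens_indexP a) => i k; rewrite (ord1 b).
rewrite /max_ent mulmx_sumr summxE adjmx_tens adjmx1.
have E j : ((1%:M : 'M[C]_d) *t V^t*) *m
    ((delta_mx j 0 : 'cV[C]_d) *t (delta_mx j 0 : 'cV[C]_d)) =
    (delta_mx j 0 : 'cV[C]_d) *t col j (V^t*).
  by rewrite (tensmx_mul _ _ (delta_mx j 0 : 'cV[C]_d)) mul1mx -colE.
rewrite (bigD1 i) //= big1 ?addr0 => [|j nj].
  by rewrite E tens_colE !mxE !eqxx mul1r conjCK.
by rewrite E tens_colE !mxE eq_sym (negbTE nj) mul0r.
Qed.

Lemma cone_sum n (K : set 'M[C]_n) I (r : seq I) (F : I -> 'M[C]_n) :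
  convex_cone K -> (forall i, K (F i)) -> K (\sum_(i <- r) F i).
Proof. by move=> [K0 KD _] KF; apply: big_ind. Qed.

Lemma Psd_generated G : (0 < d)%N -> operator_system G -> G d max_ent_proj ->
  sub_family (Psd C d) G.
Proof.
move=> d0 [u [_ cG _ _ compG _ _]] Gm s s0 X /psdmx_sum_rank1[v ->].
apply: cone_sum => [|i]; first exact: cG.
by have [V <-] := max_ent_generates (v i); exact: compG.
Qed.

Lemma PsdG_generated G : (0 < d)%N -> operator_system G ->
  G d (ptrans max_ent_proj) -> sub_family (PsdG C d) G.
Proof.
move=> d0 [u [_ cG _ _ compG _ _]] Gm s s0 X /psdmx_sum_rank1[v Xv].
rewrite -[X]ptransK Xv ptrans_sum; apply: cone_sum => [|i]; first exact: cG.
have [V <-] := max_ent_generates (v i).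
by rewrite ptrans_compress; exact: compG.
Qed.

Lemma Psd_order_unit s (L : set 'M[C]_(d * s)) A : Psd C d s `<=` L ->
  A \is hermsymmx -> exists2 r : C, 0 < r & L (r *: 1%:M + A).
Proof.
by move=> PL /hermsym_psd_shift[r r0 rA]; exists r => //; exact: PL.
Qed.

Lemma operator_system_Psd : operator_system (Psd C d).
Proof.
apply: (operator_system_eq (F := tdual (Psd C d))).
  by move=> s _; rewrite tdual_Psd.
apply: operator_system_tdual; [exact: Psd_compress_closed|exact: Sep_sub_Psd|].
by move=> s A; apply: Psd_order_unit; rewrite tdual_Psd.
Qed.

Lemma operator_system_PsdG : operator_system (PsdG C d).
Proof.
apply: (operator_system_eq (F := tdual (PsdG C d))).
  by move=> s _; rewrite tdual_PsdG.
apply: operator_system_tdual; [exact: PsdG_compress_closed|exact: Sep_sub_PsdG|].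
move=> s A hA; have : ptrans A \is hermsymmx.
  by apply/hermsymmxP; rewrite adjmx_ptrans (hermsymmxP _ hA).
move=> /hermsym_psd_shift[r r0 rA]; exists r => //.
by rewrite tdual_PsdG /PsdG /= ptransD ptransZ ptrans1.
Qed.

Lemma finitely_generated_Psd : (0 < d)%N -> finitely_generated (Psd C d).
Proof.
move=> d0; exists 1%N, (fun=> d), (fun=> max_ent_proj); split=> //.
- exact: operator_system_Psd.
- by move=> j; exact: psdmx_rank1.
- by move=> G oG hG; apply: Psd_generated => //; exact: (hG 0).
Qed.

Lemma finitely_generated_PsdG : (0 < d)%N -> finitely_generated (PsdG C d).
Proof.
move=> d0; exists 1%N, (fun=> d), (fun=> ptrans max_ent_proj); split=> //.
- exact: operator_system_PsdG.
- by move=> j; apply: PsdG_ptrans; exact: psdmx_rank1.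
- by move=> G oG hG; apply: PsdG_generated => //; exact: (hG 0).
Qed.

Lemma finitely_generated_Decomp : (0 < d)%N ->
  (forall s, tdual (Dpsd C d) s = Decomp C d s) ->
  finitely_generated (Decomp C d).
Proof.
move=> d0 bip; exists 2%N, (fun=> d),
  (fun j : 'I_2 => if j == 0 then max_ent_proj else ptrans max_ent_proj).
split=> //.
- apply: (operator_system_eq (F := tdual (Dpsd C d))); first by move=> s _.
  apply: operator_system_tdual; [exact: Dpsd_compress_closed|exact: Sep_sub_Dpsd|].
  by move=> s A; apply: Psd_order_unit; rewrite bip; exact: Psd_sub_Decomp.
- move=> j; case: (j == 0); first by apply: Psd_sub_Decomp; exact: psdmx_rank1.
  by apply: PsdG_sub_Decomp; apply: PsdG_ptrans; exact: psdmx_rank1.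
- move=> G oG hG s s0 _ [X [Y [X0 Y0 ->]]].
  have GX : G s X by apply: Psd_generated => //; exact: (hG 0).
  have GY : G s Y by apply: PsdG_generated => //; exact: (hG 1).
  by case: oG => u [_ cG _ _ _ _ _]; have [_ + _] := cG s s0; apply.
Qed.

Lemma amplify_id s (X : 'M[C]_(d * s)) : amplify idfun X = X.
Proof. by rewrite [RHS]sum_delta_block. Qed.

Lemma amplify_trmx s (X : 'M[C]_(d * s)) : amplify trmx X = ptrans X.
Proof.
rewrite [in RHS](sum_delta_block X) ptrans_sum; apply: eq_bigr => i _.
by rewrite ptrans_sum; apply: eq_bigr => j _; rewrite ptrans_tens.
Qed.

Lemma adj_trmx (A : 'M[C]_d) : (A^t*)^T = (A^T)^t*.
Proof. by apply/matrixP => i j; rewrite !mxE. Qed.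

Lemma realizable_Psd : realizable 1%:M (Psd C d).
Proof.
exists d, (idfun : {linear 'M[C]_d -> 'M[C]_d}).
by split=> // s A _ _; rewrite amplify_id.
Qed.

Lemma realizable_PsdG : realizable 1%:M (PsdG C d).
Proof.
exists d, (@trmx C d d : {linear 'M[C]_d -> 'M[C]_d}).
split=> [A||s A _ _]; [exact: adj_trmx|exact: trmx1|].
by rewrite amplify_trmx.
Qed.

Lemma realizable_Dpsd : realizable 1%:M (Dpsd C d).
Proof.
pose phi (j : 'I_2) : {linear 'M[C]_d -> 'M[C]_d} :=
  if j == 0 then (idfun : {linear 'M[C]_d -> 'M[C]_d})
  else (@trmx C d d : {linear 'M[C]_d -> 'M[C]_d}).
have [N [psi [psia psi1 _ psiP]]] := direct_sum_maps phi.
exists N, psi; split.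
- apply: psia => j M; rewrite /phi; case: (j == 0) => //; exact: adj_trmx.
- by apply: psi1 => j; rewrite /phi; case: (j == 0) => //; exact: trmx1.
move=> s A _ _; rewrite psiP; split=> [[h1 h2] j|h].
  by rewrite /phi; case: (j == 0); rewrite ?amplify_id ?amplify_trmx.
split; first by have := h 0; rewrite /phi /= amplify_id.
by have := h 1; rewrite /phi /= amplify_trmx.
Qed.

End Generation.

(** * Obstructions *)

Section Obstructions.
Variables (C : numClosedFieldType) (d : nat).
Hypothesis d1 : (1 < d)%N.

Lemma exists_nat_notin (r : seq C) : exists k : nat, k%:R \notin r.
Proof.
pose l := [seq k%:R : C | k <- iota 0 (size r).+1].
have lu : uniq l by rewrite map_inj_uniq ?iota_uniq //; exact: (mulrIn (oner_neq0 C)).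
have [/allP h|/allPn[_ /mapP[k _ ->] kr]] := boolP (all (mem r) l); last by exists k.
by have := uniq_leq_size lu h; rewrite size_map size_iota ltnn.
Qed.

(* H = M f f^* - x x^* with x orthogonal to f and parallel to none of the
   given vectors. *)
Lemma witness_avoiding (ps : seq 'cV[C]_d) :
  exists (H : 'M[C]_d) (x : 'cV[C]_d),
    [/\ H \is hermsymmx, 0 < \tr H, forall p, p \in ps -> 0 <= qform H p
      & qform H x < 0].
Proof.
pose i0 : 'I_d := Ordinal (ltnW d1); pose i1 : 'I_d := Ordinal d1.
(* Avoiding these slopes, f^* p = 0 forces both coordinates of p to vanish, and then x^* p = 0 as
   well. *)
have [k kP] := exists_nat_notin [seq p i1 0 / p i0 0 | p : 'cV[C]_d <- ps].
pose f : 'cV[C]_d := k%:R *: delta_mx i0 0 - delta_mx i1 0.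
pose x : 'cV[C]_d := delta_mx i0 0 + k%:R *: delta_mx i1 0.
have kc : (k%:R : C)^* = k%:R by exact: rmorph_nat.
have dE (i : 'I_d) (p : 'cV[C]_d) : ((delta_mx i 0 : 'cV[C]_d)^t* *m p) 0 0 = p i 0.
  by rewrite trmx_delta map_delta_mx -rowE mxE.
have fE (p : 'cV[C]_d) : (f^t* *m p) 0 0 = k%:R * p i0 0 - p i1 0.
  rewrite /f adjmxB adjmxZ kc mulmxBl -scalemxAl mxE [X in X + _]mxE.
  by rewrite [X in _ + X = _]mxE !dE.
have xE (p : 'cV[C]_d) : (x^t* *m p) 0 0 = p i0 0 + k%:R * p i1 0.
  rewrite /x adjmxD adjmxZ kc mulmxDl -scalemxAl mxE [X in _ + X]mxE.
  by rewrite !dE.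
(* M dominates each ratio needed for a nonnegative form at p; the 2 makes tr H = (M - 1) (1 + k^2)
   positive. *)
pose M := 2 + \sum_(p <- ps) `|(x^t* *m p) 0 0| ^+ 2 / `|(f^t* *m p) 0 0| ^+ 2.
have M2 : 2 <= M.
  by rewrite lerDl; apply: sumr_ge0 => p _; rewrite divr_ge0 ?exprn_ge0.
have Mr : M \is Num.real by apply: ger0_real; exact: le_trans M2.
pose H := M *: (f *m f^t*) - x *m x^t*.
have HE p : qform H p = M * `|(f^t* *m p) 0 0| ^+ 2 - `|(x^t* *m p) 0 0| ^+ 2.
  by rewrite qformD qformN qformZ !qform_rank1.
have xi0 : x i0 0 = 1 by rewrite !mxE /= ?mulr0 ?addr0.
have xi1 : x i1 0 = k%:R by rewrite !mxE /= ?mulr1 ?add0r.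
have fi0 : f i0 0 = k%:R by rewrite !mxE /= ?mulr1 ?subr0.
have fi1 : f i1 0 = -1 by rewrite !mxE /= ?mulr0 ?add0r.
have k2 : 0 < 1 + k%:R ^+ 2 :> C by rewrite ltr_wpDr // exprn_ge0.
exists H, x; split.
- apply: qform_hermsym => p; rewrite HE rpredB ?rpredM //;
    by rewrite ger0_real ?exprn_ge0.
- have tE (v : 'cV[C]_d) : \tr (v *m v^t*) = (v^t* *m v) 0 0.
    by rewrite mxtrace_mulC /mxtrace big_ord1.
  rewrite linearB /= mxtraceZ !tE fE xE xi0 xi1 fi0 fi1.
  have -> : M * (k%:R * k%:R - -1) - (1 + k%:R * k%:R) =
      (M - 1) * (1 + k%:R ^+ 2) by ring.
  by rewrite mulr_gt0 // subr_gt0 (lt_le_trans _ M2) // ltr1n.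
- move=> p pps; rewrite HE subr_ge0.
  have [f0|f0] := eqVneq ((f^t* *m p) 0 0) 0.
    suff -> : (x^t* *m p) 0 0 = 0.
      by rewrite f0 normr0 expr0n mulr0.
    have p0 : p i0 0 = 0.
      apply/eqP; apply: contraNT kP => p0; apply/mapP; exists p => //.
      move: f0; rewrite fE => /eqP; rewrite subr_eq0 => /eqP <-.
      by rewrite mulfK.
    move: f0; rewrite fE xE p0 mulr0 sub0r => /eqP; rewrite oppr_eq0 => /eqP ->.
    by rewrite mulr0 addr0.
  rewrite -ler_pdivrMr ?exprn_gt0 ?normr_gt0 //.
  rewrite /M (big_rem p) //= addrCA lerDl addr_ge0 //.
  by apply: sumr_ge0 => q _; rewrite divr_ge0 ?exprn_ge0.
- rewrite HE fE xE xi0 xi1 mulr1 subrr normr0 expr0n mulr0 sub0r oppr_lt0.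
  by rewrite -expr2 exprn_gt0 // normr_gt0 gt_eqF.
Qed.

Lemma qform11 : qform (1%:M : 'M[C]_1) 1%:M = 1.
Proof. by rewrite /qform adjmx1 !mulmx1 mxE eqxx. Qed.

(* r dominates H (x) Q by writing H = P - h 1 with P >= 0. *)
Lemma witness_order_unit (H : 'M[C]_d) s (A : 'M[C]_(d * s)) :
  H \is hermsymmx -> 0 < \tr H -> A \is hermsymmx ->
  exists2 r : C, 0 < r & psdmx (r *: 1%:M + A) /\
    forall Q, psdmx Q -> 0 <= \tr ((H *t Q) *m (r *: 1%:M + A)).
Proof.
move=> hH tH hA; have [h h0 hP] := hermsym_psd_shift hH.
have hNA : - A \is hermsymmx.
  by apply/hermsymmxP; rewrite adjmxN (hermsymmxP _ hA).
have [c1 c10 A1] := hermsym_psd_shift hA.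
have [c2 c20 A2] := hermsym_psd_shift hNA.
pose c := c1 + c2; have c0 : 0 < c by rewrite addr_gt0.
have Ac : psdmx (c *: 1%:M + A).
  rewrite /c scalerDl addrAC; apply: psdmxD => //.
  by apply: psdmxZ; [exact: ltW|exact: psdmx1].
have Ac' : psdmx (c *: 1%:M - A).
  rewrite /c scalerDl -addrA; apply: psdmxD => //.
  by apply: psdmxZ; [exact: ltW|exact: psdmx1].
set P := h *: 1%:M + H in hP.
have tP : 0 <= \tr P by exact: mxtrace_psd.
(* As - c <= A <= c and H = P - h, the trace of (H (x) Q) A is at least - c (tr P + h d) tr Q; the
   second summand, multiplied by tr H tr Q, compensates it. *)
pose r := c + c * (\tr P + h * d%:R) / \tr H.
have e0 : 0 <= c * (\tr P + h * d%:R) / \tr H.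
  by rewrite divr_ge0 ?mulr_ge0 ?addr_ge0 ?mulr_ge0 // ltW.
exists r; first by rewrite ltr_wpDr.
split.
  rewrite /r scalerDl addrAC; apply: psdmxD => //.
  by apply: psdmxZ => //; exact: psdmx1.
move=> Q Q0; have tQ := mxtrace_psd Q0.
have tHQ (B : 'M[C]_d) : \tr ((B *t Q) *m (1%:M : 'M[C]_(d * s))) = \tr B * \tr Q.
  by rewrite mulmx1 mxtrace_tens.
have b1 : 0 <= c * (\tr P * \tr Q) + \tr ((P *t Q) *m A).
  rewrite -tHQ -mxtraceZ -mxtraceD scalemxAr -mulmxDr.
  by apply: mxtrace_psd_mul => //; exact: psdmx_tens.
have b2 : 0 <= c * (d%:R * \tr Q) - \tr (((1%:M : 'M[C]_d) *t Q) *m A).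
  rewrite -[d%:R]mxtrace1 -tHQ -mxtraceZ -linearB /= scalemxAr -mulmxBr.
  by apply: mxtrace_psd_mul => //; apply: psdmx_tens => //; exact: psdmx1.
have HP : H = P - h *: 1%:M by rewrite /P addrC addKr.
rewrite mulmxDr mxtraceD -scalemxAr mxtraceZ tHQ.
have -> : \tr ((H *t Q) *m A) = \tr ((P *t Q) *m A) -
    h * \tr (((1%:M : 'M[C]_d) *t Q) *m A).
  rewrite {1}HP tensmxDl tensmxNl tensmxZl mulmxBl -scalemxAl.
  by rewrite linearB /= mxtraceZ.
have -> : r * (\tr H * \tr Q) = c * (\tr H * \tr Q) +
    c * (\tr P + h * d%:R) * \tr Q.
  by rewrite /r mulrDl; congr (_ + _); rewrite mulrA divfK // gt_eqF.
have b3 : 0 <= h * (c * (d%:R * \tr Q) - \tr (((1%:M : 'M[C]_d) *t Q) *m A)).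
  by rewrite mulr_ge0 // ltW.
have b4 : 0 <= c * (\tr H * \tr Q) by rewrite !mulr_ge0 // ltW.
have := addr_ge0 b4 (addr_ge0 b1 b3); congr (_ <= _).
by ring.
Qed.

(** The dual of Sep enlarged by all H (x) Q contains the generators, since H is nonnegative at their
    first factors, but excludes the projection on x at level 1. *)
Lemma Sep_not_finitely_generated : ~ finitely_generated (Sep C d).
Proof.
move=> [n [k [A [k0 _ SA hG]]]].
have exr j : exists r, A j = sep_sum r by apply/SepP; exact: SA.
pose r j := sval (cid (exr j)).
have rE j : A j = sep_sum (r j) := svalP (cid (exr j)).
have [H [x [hH tH Hp Hx]]] :=
  witness_avoiding (flatten [seq [seq p.1 | p <- r j] | j <- enum 'I_n]).
pose L : Defs.family C d := fun s =>
  [set Y | Sep C d s Y \/ exists2 Q, psdmx Q & Y = H *t Q].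
have oL : operator_system (tdual L).
  apply: operator_system_tdual.
  - move=> s t V Y [SY|[Q Q0 ->]]; first by left; exact: Sep_compress.
    by right; exists (V^t* *m Q *m V); [exact: psdmx_congr|rewrite compress_tens].
  - by move=> s Y; left.
  - move=> s B hB; have [c c0 [cB cH]] := witness_order_unit hH tH hB.
    exists c => // Y [/Sep_sub_Psd Y0|[Q Q0 ->]]; first exact: mxtrace_psd_mul.
    exact: cH.
have AL j : tdual L (k j) (A j).
  move=> Y [/Sep_sub_Psd Y0|[Q Q0 ->]].
    by apply: mxtrace_psd_mul => //; apply: Sep_sub_Psd; exact: SA.
  rewrite rE /sep_sum mulmx_sumr raddf_sum big_seq /=; apply: sumr_ge0 => p pr.
  rewrite -qformE qform_tens_prod mulr_ge0 //; last by case: Q0.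
  apply: Hp; apply/flattenP; exists [seq p.1 | p <- r j].
    by apply/mapP; exists j; rewrite // mem_enum.
  by apply/mapP; exists p.
have := hG _ oL AL 1%N isT _ (Sep_rank1 x (1%:M : 'M[C]_1)).
move=> /(_ (H *t 1%:M)); rewrite -qformE qform_tens_prod qform11 mulr1.
move=> h; have := lt_le_trans Hx (h _); rewrite ltxx => h'.
suff : false by []; apply: h'; right.
by exists 1%:M => //; exact: psdmx1.
Qed.

(** The Choi matrix of a realization pairs nonnegatively with Bpsd, so it is separable. Then phi H
    is a sum of positive matrices weighted by finitely many values of the form of H, and cannot
    detect an H negative elsewhere. *)
Lemma Bpsd_not_realizable :
  (forall s, tdual (Bpsd C d) s = Sep C d s) -> ~ realizable 1%:M (Bpsd C d).
Proof.
move=> bip [n [phi [_ _ phiP]]].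
pose B : 'M[C]_(d * n) := \sum_i \sum_j delta_mx i j *t (phi (delta_mx j i))^T.
have phiE M : phi M = choi_map B M.
  rewrite {1}(matrix_sum_delta M) linear_sum; apply: eq_bigr => i _.
  rewrite linear_sum; apply: eq_bigr => j _.
  by rewrite linearZ /= /B block_sum_tens trmxK.
suff [H [x [hH HN Hx]]] : exists (H : 'M[C]_d) (x : 'cV[C]_d),
    [/\ H \is hermsymmx, psdmx (phi H) & qform H x < 0].
  have hH1 : H *t (1%:M : 'M[C]_1) \is hermsymmx.
    by apply/hermsymmxP; rewrite adjmx_tens adjmx1 (hermsymmxP _ hH).
  have [_ h] := phiP 1%N _ isT hH1.
  have := h _ x (1%:M : 'M[C]_1); rewrite qform_tens_prod qform11 mulr1 => h'.
  suff : false by [].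
  rewrite -(ltxx (0 : C)) (le_lt_trans _ Hx) // h' // amplify_tens.
  by apply: psdmx_tens => //; exact: psdmx1.
(* The Choi argument uses the realization at level n, which must be positive; for n = 0 every image
   is positive. *)
have [n0|n0] := posnP n.
  have [H [x [hH _ _ Hx]]] := witness_avoiding [::].
  exists H, x; split=> //; apply/psdmxP => w; rewrite /qform mxE big1 // => i _.
  by have := leq_trans (ltn_ord i) (eq_leq n0).
have : Sep C d n B.
  rewrite -bip => X hX; have hX' := Bpsd_herm hX.
  have [+ _] := phiP n X n0 hX' => /(_ hX).
  rewrite (eq_amplify X phiE) => /amplify_choi_map/(_ 1%:M).
  by rewrite compress1 mxtrace_mulC.
move=> /SepP[r BE].
have [H [x [hH _ Hp Hx]]] := witness_avoiding [seq p.1 | p <- r].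
exists H, x; split=> //.
have -> : phi H = \sum_(p <- r) qform H p.1 *: (p.2 *m p.2^t*)^T.
  have bE i j : block B j i = \sum_(p <- r) (p.1 j 0 * (p.1 i 0)^*) *: (p.2 *m p.2^t*).
    rewrite BE /sep_sum; apply/matrixP => a b; rewrite mxE !summxE.
    apply: eq_bigr => p _; rewrite mulmx_tens_adj tensmxE [RHS]mxE; congr (_ * _).
    by rewrite mxE big_ord1 adjmxE.
  have qE p : qform H p = \sum_i \sum_j H i j * (p j 0 * (p i 0)^*).
    rewrite qformE /mxtrace; apply: eq_bigr => i _; rewrite mxE.
    by apply: eq_bigr => j _; rewrite mxE big_ord1 adjmxE.
  rewrite phiE /choi_map.
  under eq_bigr do under eq_bigr do rewrite bE linear_sum scaler_sumr.
  under eq_bigr do rewrite exchange_big /=.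
  rewrite exchange_big; apply: eq_bigr => p _.
  rewrite qE scaler_suml; apply: eq_bigr => i _.
  rewrite scaler_suml; apply: eq_bigr => j _.
  by rewrite linearZ /= scalerA.
rewrite big_seq; apply: psdmx_sum => p pr; apply: psdmxZ.
  by apply: Hp; apply/mapP; exists p.
have -> : (p.2 *m p.2^t*)^T = map_mx Num.conj p.2 *m (map_mx Num.conj p.2)^t*.
  by rewrite trmx_mul; congr (_ *m _); apply/matrixP => i j; rewrite !mxE ?conjCK.
exact: psdmx_rank1.
Qed.

(* The hypothesis closes the cone of separable 2 x 4 matrices: the edge matrix
   is a limit of matrices that the map cannot distinguish from separable ones. *)
Lemma positive_map_not_exact n (phi : {linear 'M[C]_d -> 'M[C]_n}) :
  (forall X, tdual (Bpsd C 2%N) 4%N X -> Sep C 2%N 4%N X) ->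
  (forall M : 'M[C]_d, phi (M^t*) = (phi M)^t*) ->
  (forall x : 'cV[C]_d, psdmx (phi (x *m x^t*))) ->
  exists X : 'M[C]_(d * 4),
    [/\ psdmx X, psdmx (amplify phi X) & ~ Sep C d 4%N X].
Proof.
move=> bip phia phi0; apply: contrapT => noX.
have SepX (X : 'M[C]_(d * 4)) : psdmx X -> psdmx (amplify phi X) -> Sep C d 4%N X.
  by move=> X0 pX; apply: contrapT => nX; apply: noX; exists X.
have [x0 [x1 [J [J0 J1 loc]]]] := positive_map_local 4%N d1 phia phi0.
set e0 : 'cV[C]_2 := delta_mx 0 0 in J0; set e1 : 'cV[C]_2 := delta_mx 1 0 in J1.
set A := natmx C 4%N edgeA; set B := natmx C 4%N edgeB; set X := natmx C 4%N edgeX.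
have ee : e0 *m e0^t* + e1 *m e1^t* = 1%:M.
  apply/matrixP => i j; rewrite !mxE !big_ord1 !mxE.
  by case: (ord2_cases i) => ->; case: (ord2_cases j) => ->;
    rewrite /= ?(rmorph0 Num.conj) ?(rmorph1 Num.conj) ?mulr0 ?mulr1 ?addr0 ?add0r.
(* If positivity of the matrix and of its image implied separability, the shifted edge matrix,
   scaled towards x0, would be separable. *)
have near e : 0 < e -> Sep C 2%N 4%N (two_block e0 e1 A B X + e *: 1%:M).
  move=> ep; have [t t0 ht] := loc A B X e (edge_gram C) (edge_gramT C) ep.
  have tc : (t^-1)^* = t^-1 by apply: geC0_conj; rewrite invr_ge0 ltW.
  have Y0 : psdmx (two_block x0 (t *: x1) (A + e *: 1%:M) B (X + e *: 1%:M)).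
    rewrite two_block_shift; apply: psdmxD; first exact: two_block_psd (edge_gram C).
    apply: psdmxZ; first exact: ltW.
    apply: psdmx_tens; last exact: psdmx1.
    by apply: psdmxD; exact: psdmx_rank1.
  (* E undoes the scaling of x1, and operators on the first factor preserve separability. *)
  pose E : 'M[C]_2 := delta_mx 0 0 + t^-1 *: delta_mx 1 1.
  have E0 : E *m e0 = e0.
    rewrite mulmxDl -scalemxAl /e0 !mul_delta_col !mxE /=.
    by rewrite scale1r scale0r scaler0 addr0.
  have E1 : E *m (t *: e1) = e1.
    rewrite mulmxDl -!scalemxAl -!scalemxAr /e1 !mul_delta_col !mxE /=.
    by rewrite scale0r scaler0 add0r scale1r scalerA mulVf ?scale1r // gt_eqF.
  have := Sep_local (E *m J) (SepX _ Y0 ht).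
  rewrite two_block_local -!mulmxA J0 -scalemxAr J1 E0 E1 two_block_shift.
  by rewrite ee tensmx11.
have ZS : Sep C 2%N 4%N (two_block e0 e1 A B X).
  apply: bip => Z hZ; have hZ' := Bpsd_herm hZ.
  set a := \tr (Z *m _); set b := \tr Z.
  have hX : two_block e0 e1 A B X \is hermsymmx.
    by case: (two_block_psd e0 e1 (edge_gram C)).
  have ar : a \is Num.real.
    apply/CrealP; rewrite /a -[in LHS]mxtrace_tr.
    have -> : (\tr (Z *m two_block e0 e1 A B X)^T)^* =
        \tr ((Z *m two_block e0 e1 A B X)^t*) by rewrite trace_map_mx.
    by rewrite adjmxM (hermsymmxP _ hX) (hermsymmxP _ hZ') mxtrace_mulC.
  have b0 : 0 <= b.
    rewrite /b -[Z]mulmx1 -tensmx11.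
    have : tdual (Sep C 2%N) 4%N Z by rewrite tdual_Sep.
    by rewrite mxtrace_mulC; apply; apply: Sep_tens; exact: psdmx1.
  have lim e : 0 < e -> 0 <= a + e * b.
    move=> /near h; have : tdual (Sep C 2%N) 4%N Z by rewrite tdual_Sep.
    move=> /(_ _ h); rewrite mulmxDl mxtraceD -scalemxAl mul1mx mxtraceZ.
    by rewrite mxtrace_mulC.
  rewrite real_leNgt ?real0 //; apply/negP => a0.
  have b1 : 0 < b + 1 by rewrite ltr_wpDl.
  (* At this e the value a + e b equals a / (b + 1), which would be negative. *)
  have e0' : 0 < - a / (b + 1) by rewrite divr_gt0 // oppr_gt0.
  have := lim _ e0'; have -> : a + - a / (b + 1) * b = a / (b + 1).
    by field; rewrite gt_eqF.
  by rewrite pmulr_lge0 ?invr_gt0 // => /(lt_le_trans a0); rewrite ltxx.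
exact: edge_not_Sep ZS.
Qed.

Hypothesis bip2 : forall X, tdual (Bpsd C 2%N) 4%N X -> Sep C 2%N 4%N X.

Lemma Sep_not_realizable u : ~ realizable u (Sep C d).
Proof.
move=> [n [phi [phia _ phiP]]].
have phi0 (x : 'cV[C]_d) : psdmx (phi (x *m x^t*)).
  apply: psdmx_tens1; rewrite -amplify_tens; apply/phiP => //.
    apply/hermsymmxP; rewrite adjmx_tens adjmx1.
    by case: (psdmx_rank1 x) => /hermsymmxP ->.
  by apply: Sep_tens; [exact: psdmx_rank1|exact: psdmx1].
have [X [[hX X0] pX nX]] := positive_map_not_exact bip2 phia phi0.
by apply: nX; apply/phiP.
Qed.

(** If Bpsd were contained in the dual of L, then L would lie in the dual of Bpsd, which is Sep; but
    X is in L and not separable. *)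
Lemma Bpsd_not_finitely_generated :
  (forall s, tdual (Bpsd C d) s = Sep C d s) -> ~ finitely_generated (Bpsd C d).
Proof.
move=> bip [n [k [A [k0 _ BA hG]]]].
have exphi j : exists g : {linear 'M[C]_d -> 'M[C]_(k j)}, g =1 choi_map (A j).
  by apply: linear_bundle; exact: choi_map_linear.
pose phi j := sval (cid (exphi j)).
have phiE j : phi j =1 choi_map (A j) := svalP (cid (exphi j)).
have [N [psi [psia _ psiP ampP]]] := direct_sum_maps phi.
have psi_adj : forall M : 'M[C]_d, psi (M^t*) = (psi M)^t*.
  apply: psia => j M; rewrite !phiE choi_map_adj //.
  by apply: Bpsd_herm; exact: BA.
have psi_pos (x : 'cV[C]_d) : psdmx (psi (x *m x^t*)).
  by apply/psiP => j; rewrite phiE; apply: choi_map_pos; exact: BA.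
have [X [X0 pX nX]] := positive_map_not_exact bip2 psi_adj psi_pos.
(* Keeping L inside Psd puts Psd in its dual, which provides the order unit. *)
pose L : Defs.family C d := fun s => [set Y | psdmx Y /\ psdmx (amplify psi Y)].
have LP s : L s `<=` Psd C d s by move=> Y [].
have oL : operator_system (tdual L).
  apply: operator_system_tdual.
  - move=> s t V Y [Y0 pY]; split; first exact: psdmx_compress.
    by rewrite amplify_compress; exact: psdmx_compress.
  - move=> s Y SY; split; first exact: Sep_sub_Psd.
    move: SY => /SepP[r ->]; rewrite /sep_sum amplify_sum; apply: psdmx_sum => p _.
    rewrite mulmx_tens_adj amplify_tens; apply: psdmx_tens => //.
    exact: psdmx_rank1.
  - move=> s Y; apply: Psd_order_unit; rewrite -tdual_Psd.
    by apply: tdualS; exact: LP.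
have AL : contains_all A (tdual L).
  move=> j Y [_ /ampP/(_ j)]; rewrite (eq_amplify _ (phiE j)).
  by move=> /amplify_choi_map/(_ 1%:M); rewrite compress1 mxtrace_mulC.
apply: nX; rewrite -bip => B hB; rewrite mxtrace_mulC.
by apply: (hG _ oL AL 4%N isT B hB).
Qed.

End Obstructions.

Theorem proposition2p12 (R : realType) (d : nat) (hd : (2 <= d)%N) :
  let C : numClosedFieldType := R[i]%C in
  let u : 'M[C]_d := (1%:M)%R in
  (* (i) *)
  ((eq_family (free_dual (Sep C d)) (Bpsd C d) /\
    eq_family (free_dual (Bpsd C d)) (Sep C d)) /\
   (~ finitely_generated (Sep C d) /\ ~ realizable u (Sep C d)) /\
   (~ finitely_generated (Bpsd C d) /\ ~ realizable u (Bpsd C d))) /\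
  (* (ii) *)
  ((eq_family (free_dual (Psd C d)) (Psd C d) /\
    eq_family (free_dual (PsdG C d)) (PsdG C d)) /\
   (finitely_generated (Psd C d) /\ realizable u (Psd C d)) /\
   (finitely_generated (PsdG C d) /\ realizable u (PsdG C d))) /\
  (* (iii) *)
  ((eq_family (free_dual (Dpsd C d)) (Decomp C d) /\
    eq_family (free_dual (Decomp C d)) (Dpsd C d)) /\
   realizable u (Dpsd C d) /\ finitely_generated (Decomp C d)).
Proof.
move=> C u; have d0 : (0 < d)%N by exact: ltnW.
have bipB n s : tdual (Bpsd C n) s = Sep C n s by exact: tdual_Bpsd.
have bipD s : tdual (Dpsd C d) s = Decomp C d s by exact: tdual_Dpsd.
have bip2 X : tdual (Bpsd C 2%N) 4%N X -> Sep C 2%N 4%N X by rewrite bipB.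
have dual (F G : Defs.family C d) : compress_closed F ->
    (forall s, (Sep C d s `<=` F s)%classic) -> (forall s, tdual F s = G s) ->
    eq_family (free_dual F) G.
  by move=> cF SF FG s s0; rewrite -FG free_dual_tdual.
split; [|split].
- split; first split.
  + apply: dual; [by move=> s t V A; exact: Sep_compress|by move=> s X|exact: tdual_Sep].
  + by apply: dual; [exact: Bpsd_compress_closed|exact: Sep_sub_Bpsd|].
  split; split.
  + exact: Sep_not_finitely_generated.
  + exact: Sep_not_realizable.
  + exact: Bpsd_not_finitely_generated.
  + exact: Bpsd_not_realizable.
- split; first split.
  + by apply: dual; [exact: Psd_compress_closed|exact: Sep_sub_Psd|exact: tdual_Psd].
  + by apply: dual; [exact: PsdG_compress_closed|exact: Sep_sub_PsdG|exact: tdual_PsdG].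
  split; split.
  + exact: finitely_generated_Psd.
  + exact: realizable_Psd.
  + exact: finitely_generated_PsdG.
  + exact: realizable_PsdG.
- split; first split.
  + by apply: dual; [exact: Dpsd_compress_closed|exact: Sep_sub_Dpsd|].
  + apply: dual; [exact: Decomp_compress_closed| |exact: tdual_Decomp].
    by move=> s X SX; apply: Psd_sub_Decomp; exact: Sep_sub_Psd.
  split; [exact: realizable_Dpsd|exact: finitely_generated_Decomp].
Qed.
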